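(* Let $p\ge 3$, $n\ge 3$, let $a$ satisfy $p/2+a+1>0$, and let $L:[1,\infty)\to[0,\infty)$ satisfy (L1)–(L3) (given in the context). Consider the generalized Bayes estimator of $\theta$ with respect to the prior $$\pi(\theta,\sigma^2)=\frac{1}{\sigma^2}\times\frac{1}{\sigma^p}\,G(\|\theta\|/\sigma;a,L).$$ (1) Suppose $a>-2$. Then the generalized Bayes estimator is quasi-admissible. (2) Suppose $a=-2$ and, for some $b<1$, $\{\log(y)\}^b/L(y)$ is monotone non-decreasing in $y$. Then the generalized Bayes estimator is quasi-admissible.
   Context: Model: $X\sim N_p(\theta,\sigma^2 I_p)$ and $S\sim\sigma^2\chi^2_n$ are independent, $\theta\in\mathbb{R}^p$ and $\sigma^2>0$ both unknown. The mean $\theta$ is estimated under the loss $\|d-\theta\|^2/\sigma^2$. Let $W=\|X\|^2/S$ and, for $\phi:[0,\infty)\to\mathbb{R}$, $\delta_\phi(X,S)=(1-\phi(W)/W)X$. Prior: $$G(\|\mu\|;a,L)=\int_0^1\Big\{\frac{\lambda}{1-\lambda}\Big\}^{p/2}\exp\Big(-\frac{\lambda}{1-\lambda}\frac{\|\mu\|^2}{2}\Big)\lambda^aL(1/\lambda)\,d\lambda .$$ Assumptions on $L$ (''ultimately'' means on $[y_0,\infty)$ for some $y_0$): (L1) $L$ is slowly varying at infinity: $\lim_{y\to\infty}L(cy)/L(y)=1$ for all $c>0$; (L2) $L$ is ultimately monotone; (L3) $L$ is differentiable with ultimately monotone derivative $L'$. The generalized Bayes estimator minimizes posterior expected loss,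 i.e. it is $E[\theta/\sigma^2\mid X,S]/E[1/\sigma^2\mid X,S]$; it has the form $\delta_\phi$ with $$\phi(w)=\phi_{a,L}(w)=w\,\frac{\int_0^1\lambda^{p/2+a+1}L(1/\lambda)(1+w\lambda)^{-(p+n)/2-1}d\lambda}{\int_0^1\lambda^{p/2+a}L(1/\lambda)(1+w\lambda)^{-(p+n)/2-1}d\lambda}.$$ Quasi-admissibility: let $c_{p,n}=(p-2)/(n+2)$, $d_n=4/(n+2)$, and $$D_\phi(w)=\frac{\{\phi(w)-2c_{p,n}\}\phi(w)}{w}-d_n\phi'(w)\{1+\phi(w)\}.$$ $\varPhi$ is the class of functions $\phi:[0,\infty)\to\mathbb{R}$ that are absolutely continuous (on compact subintervals of $[0,\infty)$) and for which each term of $E[D_\phi(W)]$ is finite, i.e. $\phi(W)^2/W$, $\phi(W)/W$, $\phi'(W)$ and $\phi(W)\phi'(W)$ have finite expectation, for every $(\theta,\sigma^2)$. Let $$\Delta(w;\phi,g)=D_\phi(w)-D_{\phi+g}(w)=g(w)\Big\{2\frac{c_{p,n}-\phi(w)}{w}+d_n\phi'(w)-\frac{g(w)}{w}+d_ng'(w)\Big\}+d_ng'(w)\{1+\phi(w)\}.$$ $\delta_\phi$ is quasi-admissible if every $g\in\varPhi$ with $\Delta(w;\phi,g)\ge 0$ for all $w$ (at which it is defined, i.e. almost every $w\geq 0$) satisfies $g\equiv 0$. *)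

(* Defs.v *)
From HB Require Import structures.
From mathcomp Require Import all_boot all_order all_algebra.
From mathcomp Require Import all_classical all_reals all_analysis.

Set Implicit Arguments.
Unset Strict Implicit.
Unset Printing Implicit Defensive.

Import Order.TTheory GRing.Theory Num.Theory.
Import numFieldNormedType.Exports.

Local Open Scope classical_set_scope.
Local Open Scope ring_scope.

(* Lebesgue measure on R^n, with R^n represented by n-tuples: the image of the
   product measure under (x, t) |-> x :: t, starting from the unit mass on the
   one-point space of 0-tuples. *)

Section lebesgue_tuple_succ.
Context {R : realType} {n : nat}.
Variable m : {sigma_finite_measure set (n.-tuple R) -> \bar R}.

Definition cons_pair (xt : R * n.-tuple R) : n.+1.-tuple R :=
  [tuple of xt.1 :: xt.2].

Lemma measurable_cons_pair : measurable_fun [set: R * n.-tuple R] cons_pair.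
Proof. exact: measurable_cons. Qed.

Definition lebesgue_cons : set (n.+1.-tuple R) -> \bar R :=
  pushforward (@lebesgue_measure R \x m)%E cons_pair.

Let lebesgue_cons0 : lebesgue_cons set0 = 0%E.
Proof. by rewrite /lebesgue_cons /pushforward preimage_set0 measure0. Qed.

Let lebesgue_cons_ge0 A : (0 <= lebesgue_cons A)%E.
Proof. by rewrite /lebesgue_cons /pushforward; exact: measure_ge0. Qed.

Let lebesgue_cons_sigma_additive : semi_sigma_additive lebesgue_cons.
Proof.
move=> F mF tF mUF; rewrite /lebesgue_cons /pushforward preimage_bigcup.
apply: measure_semi_sigma_additive.
- by move=> i; rewrite -[X in measurable X]setTI; exact: measurable_cons_pair.
- apply/trivIsetP => /= i j _ _ ij; rewrite -preimage_setI.
  by move/trivIsetP : tF => /(_ _ _ _ _ ij) ->//; rewrite preimage_set0.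
- by rewrite -preimage_bigcup -[X in measurable X]setTI;
    exact: measurable_cons_pair.
Qed.

HB.instance Definition _ := isMeasure.Build _ _ _ lebesgue_cons
  lebesgue_cons0 lebesgue_cons_ge0 lebesgue_cons_sigma_additive.

Let lebesgue_cons_sigma_finite : sigma_finite setT lebesgue_cons.
Proof.
have /sigma_finiteP[F [FT ndF Foo]] := sigma_finiteT (@lebesgue_measure R).
have /sigma_finiteP[H [HT ndH Hoo]] := sigma_finiteT m.
have headE (xt : R * n.-tuple R) : thead (cons_pair xt) = xt.1 by [].
have beheadE (xt : R * n.-tuple R) : [tuple of behead (cons_pair xt)] = xt.2.
  exact/val_inj.
exists (fun i => [set t : n.+1.-tuple R | F i (thead t) /\ H i [tuple of behead t]]).
  apply/esym; rewrite -subTset => t _.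
  have [k _ Fk] : (\bigcup_i F i) (thead t) by rewrite -FT.
  have [l _ Hl] : (\bigcup_i H i) [tuple of behead t] by rewrite -HT.
  exists (maxn k l) => //; split.
  - by move: Fk; exact/subsetPset/ndF/leq_maxl.
  - by move: Hl; exact/subsetPset/ndH/leq_maxr.
move=> i; have [mF Ffin] := Foo i; have [mH Hfin] := Hoo i; split.
  apply: measurableI.
  - by rewrite -[X in measurable X]setTI; exact: (measurable_tnth ord0).
  - by rewrite -[X in measurable X]setTI; exact: measurable_behead.
rewrite /lebesgue_cons /pushforward.
rewrite (_ : cons_pair @^-1` _ = F i `*` H i); last first.
  by apply/seteqP; split=> xt /=; rewrite headE beheadE.
by rewrite product_measure1E// lte_mul_pinfty// ge0_fin_numE.
Qed.

HB.instance Definition _ := Measure_isSigmaFinite.Build _ _ _ lebesgue_cons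
  lebesgue_cons_sigma_finite.

End lebesgue_tuple_succ.

Fixpoint lebesgue_tuple {R : realType} (n : nat) :
    {sigma_finite_measure set (n.-tuple R) -> \bar R} :=
  match n with
  | 0 => \d_ [tuple]
  | k.+1 => lebesgue_cons (lebesgue_tuple k)
  end.

Section model.
Context {R : realType} (p n : nat).
Implicit Types (theta x : p.-tuple R) (v s : R) (phi g : R -> R).

Definition sqnorm x : R := \sum_(i < p) tnth x i ^+ 2.

(* Both the sample (x, s) and the parameter (theta, v), with v = sigma^2, range
   over R^p x (0, +oo). *)
Definition upper_half_space : set (p.-tuple R * R) := [set z | 0 < z.2].

Definition gamma_fun (z : R) : R :=
  (\int[lebesgue_measure]_(t in `]0, +oo[) (t `^ (z - 1) * expR (- t)))%R.

Definition chi2_pdf (t : R) : R :=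
  t `^ (n%:R / 2 - 1) * expR (- t / 2) / (2 `^ (n%:R / 2) * gamma_fun (n%:R / 2)).

(* Joint density of X ~ N_p(theta, v I_p) and S ~ v chi^2_n independent, on
   s > 0; normal_pdf takes the standard deviation. *)
Definition sampling_pdf theta v x s : R :=
  (\prod_(i < p) normal_pdf (tnth theta i) (Num.sqrt v) (tnth x i))
  * (chi2_pdf (s / v) / v).

Definition Wstat x s : R := sqnorm x / s.

(* h(W) has finite expectation under (theta, v). *)
Definition finite_expectation theta v (h : R -> R) : Prop :=
  (lebesgue_tuple p \x @lebesgue_measure R)%E.-integrable upper_half_space
    (fun z => (h (Wstat z.1 z.2) * sampling_pdf theta v z.1 z.2)%:E).

Definition shrinkage phi x s : p.-tuple R :=
  [tuple (1 - phi (Wstat x s) / Wstat x s) * tnth x i | i < p].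

Definition c_pn : R := (p%:R - 2) / (n%:R + 2).
Definition d_n : R := 4 / (n%:R + 2).

Definition D phi (w : R) : R :=
  (phi w - 2 * c_pn) * phi w / w - d_n * derive1 phi w * (1 + phi w).

Definition Delta phi g (w : R) : R := D phi w - D (phi \+ g) w.

Definition absolutely_continuous_on (a b : R) (f : R -> R) : Prop :=
  forall e, 0 < e -> exists2 d, 0 < d &
    forall (k : nat) (u v : 'I_k -> R),
      (forall i, a <= u i /\ u i <= v i /\ v i <= b) ->
      (forall i j, i != j -> v i <= u j \/ v j <= u i) ->
      \sum_(i < k) (v i - u i) < d ->
      \sum_(i < k) `|f (v i) - f (u i)| < e.

(* Functions on [0, +oo) are represented by functions on R. Values at negative
   arguments play no role: derive1 at w > 0 is local, and W = 0 has
   probability 0. *)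
Definition Phi phi : Prop :=
  (forall b, 0 < b -> absolutely_continuous_on 0 b phi) /\
  forall theta v, 0 < v ->
    [/\ finite_expectation theta v (fun w => phi w ^+ 2 / w),
        finite_expectation theta v (fun w => phi w / w),
        finite_expectation theta v (fun w => derive1 phi w) &
        finite_expectation theta v (fun w => phi w * derive1 phi w)].

(* Delta is defined where phi and g are derivable. *)
Definition quasi_admissible_fun phi : Prop :=
  forall g, Phi g ->
    {ae @lebesgue_measure R, forall w, 0 < w ->
       derivable phi w 1 -> derivable g w 1 -> 0 <= Delta phi g w} ->
    forall w, 0 <= w -> g w = 0.

(* As p >= 1, phi is determined on (0, +oo) by delta. *)
Definition quasi_admissible (delta : p.-tuple R -> R -> p.-tuple R) : Prop :=
  exists2 phi, (forall x s, 0 < s -> delta x s = shrinkage phi x s) &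
               quasi_admissible_fun phi.

(* G may be +oo at r = 0. *)
Definition G (a : R) (L : R -> R) (r : R) : \bar R :=
  (\int[lebesgue_measure]_(l in `]0%R, 1%R[)
    ((l / (1 - l)) `^ (p%:R / 2) * expR (- (l / (1 - l)) * (r ^+ 2 / 2))
     * l `^ a * L l^-1)%:E)%E.

(* Density of the prior with respect to d theta d v. *)
Definition prior (a : R) (L : R -> R) theta v : \bar R :=
  ((v^-1 * (Num.sqrt v ^+ p)^-1)%:E
   * G a L (Num.sqrt (sqnorm theta) / Num.sqrt v))%E.

Section generalized_bayes.
Variable pi : p.-tuple R -> R -> \bar R.

Definition posterior_integral (h : p.-tuple R -> R -> R) x s : \bar R :=
  (\int[(lebesgue_tuple p \x @lebesgue_measure R)]_(z in upper_half_space)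
     ((h z.1 z.2 * sampling_pdf z.1 z.2 x s)%:E * pi z.1 z.2))%E.

Definition posterior_expectation (h : p.-tuple R -> R -> R) x s : R :=
  fine (posterior_integral h x s) / fine (posterior_integral (fun _ _ => 1) x s).

(* E[theta / sigma^2 | x, s] / E[1 / sigma^2 | x, s], the minimizer of the
   posterior expectation of |d - theta|^2 / sigma^2. *)
Definition generalized_bayes x s : p.-tuple R :=
  [tuple posterior_expectation (fun theta v => tnth theta i / v) x s
         / posterior_expectation (fun _ v => v^-1) x s | i < p].

End generalized_bayes.

End model.

Section slowly_varying.
Context {R : realType}.
Implicit Types f df : R -> R.

Definition slowly_varying f : Prop :=
  forall c, 0 < c -> f (c * y) / f y @[y --> +oo] --> (1 : R).

Definition ultimately_monotone f : Prop :=
  exists y0 : R, {in `[y0, +oo[ &, nondecreasing_fun f} \/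
                 {in `[y0, +oo[ &, nonincreasing_fun f}.

(* df is the derivative of f on [1, +oo), one-sided at 1. *)
Definition derivative_on_ge1 f df : Prop :=
  forall y, 1 <= y ->
    (f z - f y) / (z - y) @[z --> within [set z | 1 <= z] y^'] --> df y.

End slowly_varying.

(* Main.v *)
From HB Require Import structures.
Require Import Defs.
From mathcomp Require Import all_boot all_order all_algebra.
From mathcomp Require Import all_classical all_reals all_analysis.
From mathcomp Require Import measurable_realfun ring lra.

Set Implicit Arguments.
Unset Strict Implicit.
Unset Printing Implicit Defensive.

Import Order.TTheory GRing.Theory Num.Theory.
Import numFieldNormedType.Exports.

Local Open Scope classical_set_scope.
Local Open Scope ring_scope.

(** The estimator is [shrinkage phi] with [phi w = w I1 / I0], where [I0] and [I1] are
    integrals over [l] in (0, 1) of [K l] and [l K l] against [(1 + w l) ^ -(q + 1)], with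
    [K l = l ^ (p/2 + a) L (1/l)] and [q = (p + n) / 2]. This is [generalized_bayesE]: with
    [l] kept as an additional coordinate, the product of the sampling density and of the
    prior is, by completion of a square, a normal density in [theta] with mean [(1 - l) x]
    and variance [v (1 - l)] times an inverse gamma density in [v], so that Tonelli's
    theorem gives all posterior moments.

    Let now [g] be in [Phi] with [Delta >= 0] almost everywhere, and put
    [Y = g (1 + phi + g / 2)]. The hypothesis says [d w Y' >= 2 (Y - (1 + c) g)]. The
    function [N = w ^ (p/2 - 1) m w], where [m] is the integral of [K l (1 + w l) ^ -q],
    satisfies [w N' / N = - (2 / d) (phi - c) / (1 + phi)] and is an integrating factor:
    [V = Y N] has [V' >= (1 + c) N g ^ 2 / (d w (1 + phi)) >= 0]. As [N], hence [V], tends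
    to 0 at 0, [V] and [Y] are nonnegative. So at each point [g >= 0] or [g <= -2], and the
    second alternative would extend down to 0, where the inequality then makes [Y] behave
    like a logarithm and become negative. Therefore [g >= 0].

    If [g w1 > 0], then [V >= V w1 > 0] after [w1]. With [Z = sqrt Y] the inequality gives
    [d w Z' >= Z - C0], so either [Z <= C0] throughout, or [Z] eventually grows like
    [w ^ (1 / d)], and with it [g], since [0 <= phi w <= w]. In the latter case [g ^ 2 / W]
    has infinite expectation, because [W] has a density of order [w ^ -(n/2 + 1)] at
    infinity and [2 / d = n / 2 + 1]; this contradicts [Phi]. It remains to exclude
    [Z <= C0], under which [Y] and [g] are bounded. If [a > -2], then [N] tends to 0 at
    infinity ([int_factor_vanishes]), so [Y = V / N] is unbounded. If [a = -2], then [phi] is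
    bounded ([bayes_phi_bounded]) and [N] is at most of order [1 + ln w]
    ([int_factor_le_ln]); then [V' >= kappa V ^ 2 / (w (1 + ln w))], so that
    [- 1 / V - kappa ln (1 + ln w)] is nondecreasing, although it tends to minus infinity.

    The function [g] is only absolutely continuous. Monotonicity is therefore deduced from
    almost everywhere inequalities with [ac_ae_nondecreasing], which rests on the
    representation of absolutely continuous functions as integrals: the total variation of
    such a function is absolutely continuous, and the Stieltjes measure of a nondecreasing
    absolutely continuous function has a density by the Radon-Nikodym theorem. *)

(** * Absolutely continuous functions as integrals *)

Section ac_seq.
Context {R : realType}.
Implicit Types (a b e : R) (p q : R * R) (l : seq (R * R)) (f : R -> R).

Definition nonoverlapping p q := (p.2 <= q.1) || (q.2 <= p.1).

Definition subitv a b p := [&& a <= p.1, p.1 <= p.2 & p.2 <= b].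

(** Families of intervals are sequences here, so that the intervals of a partition can
    be added to a family; the weak inequality survives passage to a supremum. *)
Definition ac_seq a b f := forall e, 0 < e -> exists2 d, 0 < d &
  forall l, all (subitv a b) l -> pairwise nonoverlapping l ->
    \sum_(p <- l) (p.2 - p.1) < d -> \sum_(p <- l) `|f p.2 - f p.1| <= e.

Lemma nonoverlapping_sym : symmetric nonoverlapping.
Proof. by move=> p q; rewrite /nonoverlapping orbC. Qed.

Lemma ac_seqP a b f : absolutely_continuous_on a b f -> ac_seq a b f.
Proof.
move=> acf e e0; have [d d0 H] := acf e e0; exists d => // l la lp lt_d.
have E (F : R * R -> R) : \sum_(p <- l) F p = \sum_(i < size l) F (nth (0, 0) l i).
  by rewrite (big_nth (0, 0)) big_mkord.
rewrite !E in lt_d *; apply: ltW.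
apply: (H _ (fun i => (nth (0, 0) l i).1) (fun i => (nth (0, 0) l i).2)) => //.
- by move=> i; move/all_nthP : la => /(_ (0,0) i (ltn_ord i)) /and3P[].
- move=> i j ij.
  have /(pairwiseP (0, 0)) P := lp.
  have [lij|lij|/val_inj eij] := ltngtP (val i) (val j).
  + by have /orP[] := P i j (ltn_ord _) (ltn_ord _) lij; [left|right].
  + by have /orP[] := P j i (ltn_ord _) (ltn_ord _) lij; [right|left].
  + by rewrite eij eqxx in ij.
Qed.

Definition pieces x (s : seq R) := zip (x :: s) s.

Lemma variation_pieces a b f s : itv_partition a b s ->
  variation a b f s = \sum_(p <- pieces a s) `|f p.2 - f p.1|.
Proof.
move=> abs; rewrite variation_zip//; move: abs => _.
by elim: s a => [|h t ih] a; rewrite /pieces ?big_nil//= !big_cons/= ih.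
Qed.

Lemma sum_pieces x s : \sum_(p <- pieces x s) (p.2 - p.1) = last x s - x.
Proof.
elim: s x => [|h t ih] x; rewrite /pieces/= ?big_nil ?subrr// big_cons/=.
by rewrite (ih h) addrC addrA subrK.
Qed.

Lemma path_last_ge x (s : seq R) : path <%O x s -> x <= last x s.
Proof.
elim: s x => [//|h t ih] x /= /andP[xh /ih]; exact/le_trans/ltW.
Qed.

Lemma all_pieces x s : path <%O x s -> all (subitv x (last x s)) (pieces x s).
Proof.
elim: s x => [//|h t ih] x /= /andP[xh ht].
rewrite /subitv/= lexx (ltW xh) (path_last_ge ht)/=.
have := ih h ht; apply: sub_all => p /and3P[p1 p2 p3].
by rewrite /subitv (le_trans (ltW xh) p1) p2 p3.
Qed.

Lemma pairwise_pieces x s : path <%O x s -> pairwise nonoverlapping (pieces x s).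
Proof.
elim: s x => [//|h t ih] x /= /andP[xh ht]; rewrite (ih _ ht) andbT.
by apply: sub_all (all_pieces ht) => p /and3P[p1 _ _]; rewrite /nonoverlapping/= p1.
Qed.

Lemma nonoverlapping_sub p q u v : nonoverlapping p (u, v) -> subitv u v q ->
  nonoverlapping p q.
Proof.
by move=> + /and3P[uq _ qv] => /orP[/= h|/= h]; apply/orP;
  [left; exact: le_trans uq|right; exact: le_trans h].
Qed.

(** Suprema over partitions are taken one interval at a time, which avoids
    splitting the tolerance among the intervals of the family. *)
Lemma ac_seq_total_variation a b f : ac_seq a b f ->
  forall e, 0 < e -> exists2 d, 0 < d &
  forall l, all (subitv a b) l -> pairwise nonoverlapping l ->
    \sum_(p <- l) (p.2 - p.1) < d ->
    (\sum_(p <- l) total_variation p.1 p.2 f <= e%:E)%E.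
Proof.
move=> acf e e0; have [d d0 H] := acf e e0; exists d => // l.
suff S l1 l2 : all (subitv a b) (l1 ++ l2) ->
    pairwise nonoverlapping (l1 ++ l2) ->
    \sum_(p <- l1 ++ l2) (p.2 - p.1) < d ->
    (\sum_(p <- l1) total_variation p.1 p.2 f +
     (\sum_(p <- l2) `|f p.2 - f p.1|)%:E <= e%:E)%E.
  move=> la lp ld; have := S l [::]; rewrite cats0 big_nil adde0; exact.
elim: l1 l2 => [|[u v] l1 ih] l2.
  by rewrite /= big_nil add0e lee_fin; exact: H.
rewrite /= => /andP[uv al] /andP[duv pl]; rewrite big_cons/= => lend.
have /and3P[/= au leuv vb] := uv.
have ih2 : (\sum_(p <- l1) total_variation p.1 p.2 f +
     (\sum_(p <- l2) `|f p.2 - f p.1|)%:E <= e%:E)%E.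
  by apply: ih => //; apply: le_lt_trans lend; rewrite lerDr subr_ge0.
rewrite big_cons/= -addeA.
move: leuv; rewrite le_eqVlt => /predU1P[<-|ltuv].
  by rewrite total_variationxx add0e.
set A := (\sum_(p <- l1) _ + _)%E in ih2 *.
have A0 : (0 <= A)%E.
  rewrite /A; apply: adde_ge0; last by rewrite lee_fin sumr_ge0.
  rewrite big_seq; apply: sume_ge0 => p pl1; apply: total_variation_ge0.
  by move/allP : al => /(_ p); rewrite mem_cat pl1 => /(_ isT) /and3P[].
have Af : A \is a fin_num by rewrite ge0_fin_numE// (le_lt_trans ih2)// ltry.
rewrite -leeBrDr//; apply: ge_ereal_sup => _ [_ [s uvs <-] <-].
rewrite leeBrDr// variation_pieces//; have [us /eqP luv] := uvs.
rewrite /A addeCA -EFinD [X in X%:E]addrC -big_cat/=; apply: ih.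
- rewrite catA all_cat al/=; have := all_pieces us; rewrite luv.
  apply: sub_all => p /and3P[p1 p2 p3].
  by rewrite /subitv (le_trans au p1) p2 (le_trans p3 vb).
- rewrite catA pairwise_cat pl (pairwise_pieces us) !andbT.
  apply/allrelP => p q pl12 qs.
  have : nonoverlapping p (u, v).
    by rewrite nonoverlapping_sym; move/allP : duv; apply.
  move/nonoverlapping_sub; apply.
  by have := all_pieces us; rewrite luv => /allP; apply.
- by rewrite catA big_cat/= sum_pieces luv addrC.
Qed.

End ac_seq.

Section dyadic_grid.
Context {R : realType}.
Variables (a b : R) (U : set R).
Hypothesis ab : a < b.

Definition grid k (i : nat) : R := a + (b - a) * (i%:R / 2 ^+ k).

Definition grid_cell k i : set R := `]grid k i, grid k i.+1].

Definition inner_cells k (i : nat) : bool := `[< grid_cell k i `<=` U >].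

(** An open set is the increasing union of the dyadic cells that it contains. These
    form finite disjoint families, to which absolute continuity applies directly. *)
Definition inner_approx k : set R :=
  \big[setU/set0]_(i < (2 ^ k)%N | inner_cells k i) grid_cell k i.

Lemma grid0 k : grid k 0 = a.
Proof. by rewrite /grid mul0r mulr0 addr0. Qed.

Lemma gridX k : grid k (2 ^ k)%N = b.
Proof.
have k0 : (2 : R) ^+ k != 0 by rewrite expf_neq0// pnatr_eq0.
by rewrite /grid natrX divff// mulr1 addrC subrK.
Qed.

Lemma ler_grid k i j : (i <= j)%N -> grid k i <= grid k j.
Proof.
by move=> ij; rewrite lerD2l ler_wpM2l ?subr_ge0 ?(ltW ab)// ler_wpM2r ?invr_ge0 ?exprn_ge0// ler_nat.
Qed.

Lemma gridS k i : grid k i.+1 = grid k i + (b - a) / 2 ^+ k.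
Proof. by rewrite /grid -natr1; field; rewrite expf_neq0// pnatr_eq0. Qed.

Lemma grid_double k i : grid k.+1 i.*2 = grid k i.
Proof.
rewrite /grid -mul2n natrM exprS; congr (_ + _ * _).
by field; rewrite expf_neq0// pnatr_eq0.
Qed.

Lemma grid_cell_exists k x : a < x -> x <= b ->
  exists2 i, (i < 2 ^ k)%N & grid_cell k i x.
Proof.
move=> ax; rewrite -(gridX k); move: (2 ^ k)%N => m.
elim: m => [|m ih] xm; first by rewrite grid0 leNgt ax in xm.
have [xm'|mx] := leP x (grid k m).
  by have [i im ?] := ih xm'; exists i => //; exact: ltnW.
by exists m => //; rewrite /grid_cell/= in_itv/= mx.
Qed.

Lemma inner_approxP k x : inner_approx k x <->
  exists2 i, (i < 2 ^ k)%N & grid_cell k i `<=` U /\ grid_cell k i x.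
Proof.
rewrite /inner_approx big_mkcond/=.
rewrite -(bigcup_mkord _ (fun i => if inner_cells k i then grid_cell k i else set0)).
split=> [[i /= ik]|[i ik [iU ix]]].
  by case: ifPn => // /asboolP iU ix; exists i.
by exists i => //; rewrite ifT//; exact/asboolP.
Qed.

Lemma inner_approx_sub k : inner_approx k `<=` U `&` `]a, b].
Proof.
move=> x /inner_approxP[i ik [iU ix]]; split; first exact: iU.
move: ix; rewrite /grid_cell/= !in_itv/= => /andP[ix xi]; apply/andP; split.
  by rewrite (le_lt_trans _ ix)// -(grid0 k) ler_grid.
by rewrite (le_trans xi)// -(gridX k) ler_grid.
Qed.

Lemma nondecreasing_inner_approx : nondecreasing_seq inner_approx.
Proof.
apply/nondecreasing_seqP => k; apply/subsetPset => x /inner_approxP[i ik [iU ix]].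
have [j jk [ji jx]] : exists2 j, (j < 2 ^ k.+1)%N &
    grid_cell k.+1 j `<=` grid_cell k i /\ grid_cell k.+1 j x.
  have E1 := grid_double k i; have E2 := grid_double k i.+1.
  have lti : (i.*2.+1 < 2 ^ k.+1)%N.
    by rewrite expnS mul2n -doubleS leq_double.
  have le1 : grid k.+1 i.*2 <= grid k.+1 i.*2.+1 by exact: ler_grid.
  have le2 : grid k.+1 i.*2.+1 <= grid k.+1 i.*2.+2 by exact: ler_grid.
  move: ix; rewrite /grid_cell/= in_itv/= => /andP[ix xi].
  have [xm|mx] := leP x (grid k.+1 i.*2.+1).
    exists i.*2; first exact: ltnW.
    split; last by rewrite /= in_itv/= E1 ix.
    move=> y; rewrite /= !in_itv/= E1 => /andP[-> /le_trans]; apply.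
    by rewrite -E2 doubleS.
  exists i.*2.+1 => //; split.
    move=> y; rewrite /= !in_itv/= => /andP[/(le_lt_trans le1)].
    by rewrite E1 => ->; rewrite -doubleS E2.
  by rewrite /= in_itv/= mx -doubleS E2.
apply/inner_approxP; exists j => //; split => //; exact: subset_trans ji iU.
Qed.

Lemma bigcup_inner_approx : open U -> \bigcup_k inner_approx k = U `&` `]a, b].
Proof.
move=> oU; apply/seteqP; split=> [x [k _ /inner_approx_sub//]|x [Ux]].
rewrite /= in_itv/= => /andP[ax xb].
have /nbhs_ballP[e /= e0 eU] := open_nbhs_nbhs (conj oU Ux).
have e'0 : 0 < e / (b - a) by rewrite divr_gt0// subr_gt0.
have [k _ kP] := near_infty_natSinv_expn_lt (PosNum e'0).
have {kP} := kP k (leqnn _); rewrite /= ltr_pdivlMr ?subr_gt0// => ke.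
exists k => //; apply/inner_approxP.
have [i ik ix] := grid_cell_exists k ax xb; exists i => //; split => //.
move=> y; move: ix; rewrite /grid_cell/= !in_itv/= gridS => /andP[ix xi] /andP[iy yi].
apply: eU; rewrite /ball/=.
have ke' : (b - a) / 2 ^+ k < e by rewrite mulrC -div1r.
by rewrite ltr_norml; apply/andP; split; lra.
Qed.

Lemma measurable_grid_cell k i : measurable (grid_cell k i : set R).
Proof. exact: measurable_itv. Qed.

Lemma measurable_inner_approx k : measurable (inner_approx k : set R).
Proof. by apply: bigsetU_measurable => i _; exact: measurable_grid_cell. Qed.

Lemma trivIset_grid_cell k : trivIset setT (grid_cell k).
Proof.
apply: ltn_trivIset => i j ij; rewrite -subset0 => x []/=.
rewrite /grid_cell/= !in_itv/= => /andP[_ xj] /andP[ix _].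
by have := lt_le_trans ix xj; rewrite ltNge ler_grid.
Qed.

Definition inner_pieces k : seq (R * R) :=
  [seq (grid k i, grid k i.+1) | i <- iota 0 (2 ^ k) & inner_cells k i].

Lemma all_inner_pieces k : all (subitv a b) (inner_pieces k).
Proof.
apply/allP => _ /mapP[i + ->]; rewrite mem_filter mem_iota add0n => /andP[_ ik].
rewrite /subitv/= ler_grid// andTb; apply/andP; split.
  by rewrite -(grid0 k) ler_grid.
by rewrite -(gridX k) ler_grid.
Qed.

Lemma pairwise_inner_pieces k : pairwise nonoverlapping (inner_pieces k).
Proof.
rewrite /inner_pieces pairwise_map.
have : pairwise ltn [seq i <- iota 0 (2 ^ k) | inner_cells k i].
  by rewrite -sorted_pairwise; [exact/sorted_filter/iota_ltn_sorted/ltn_trans|exact: ltn_trans].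
apply: sub_pairwise => i j ij; rewrite /nonoverlapping/=.
by rewrite ler_grid.
Qed.

Lemma measure_inner_approx (nu : {measure set (measurableTypeR R) -> \bar R}) (H : R -> R) k :
  (forall u v, u <= v -> nu `]u, v]%classic = (H v - H u)%:E) ->
  nu (inner_approx k) = (\sum_(p <- inner_pieces k) (H p.2 - H p.1))%:E.
Proof.
move=> nuE; rewrite /inner_approx measure_bigsetU_ord_cond/=; last 2 first.
- by move=> i _; exact: measurable_grid_cell.
- move=> i j _ _ ij; apply/val_inj/(trivIset_grid_cell _ _ ij) => //.
rewrite /inner_pieces big_map big_filter -sumEFin.
have -> : iota 0 (2 ^ k) = index_iota 0 (2 ^ k) by rewrite /index_iota subn0.
rewrite big_mkord; by apply: eq_bigr => i _; rewrite nuE// ler_grid.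
Qed.

End dyadic_grid.

Section ac_nondecreasing.
Context {R : realType}.
Variables (a b : R) (F : R -> R).
Hypothesis ab : a < b.
Hypothesis ndF : {in `[a, b] &, nondecreasing_fun F}.
Hypothesis acF : ac_seq a b F.

(* Extending [F] by constants outside the interval keeps it monotone and continuous. *)
Let clamp (x : R) : R := Num.min b (Num.max a x).

Let clamp_itv x : clamp x \in `[a, b].
Proof. by rewrite in_itv/= /clamp le_min ge_min lexx le_max lexx (ltW ab). Qed.

Let clampE x : x \in `[a, b] -> clamp x = x.
Proof.
by rewrite in_itv/= /clamp => /andP[ax xb]; rewrite (max_idPr ax) (min_idPr xb).
Qed.

Let clamp_nd x y : x <= y -> clamp x <= clamp y.
Proof.
move=> xy; rewrite /clamp le_min ge_min lexx/= ge_min; apply/orP; right.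
by rewrite ge_max !le_max lexx xy orbT.
Qed.

Let clamp_lip x y : x <= y -> clamp y - clamp x <= y - x.
Proof.
move=> xy; rewrite /clamp /Num.min /Num.max.
by case: ifPn; case: ifPn; case: ifPn; case: ifPn; rewrite -?leNgt; lra.
Qed.

Let Fc x := F (clamp x).

Let Fc_nd : nondecreasing Fc.
Proof. by move=> x y xy; apply: ndF => //; exact: clamp_nd. Qed.

Let Fc_rc : right_continuous Fc.
Proof.
move=> x; apply/cvgrPdist_le => e e0.
have [d d0 H] := acF e0.
near=> y.
have xy : x <= y by near: y; exact: nbhs_right_ge.
have yxd : y < x + d by near: y; apply: nbhs_right_lt; rewrite ltrDl.
rewrite distrC.
have := H [:: (clamp x, clamp y)]; rewrite /= !big_seq1/= andbT; apply => //.
  rewrite /subitv/= clamp_nd// andTb.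
  by move: (clamp_itv x) (clamp_itv y); rewrite !in_itv/= => /andP[-> _] /andP[_ ->].
by rewrite (le_lt_trans (clamp_lip xy))// ltrBlDl.
Unshelve. all: by end_near. Qed.

HB.instance Definition _ := isCumulative.Build R _ R Fc Fc_nd Fc_rc.

Let nu := lebesgue_stieltjes_measure Fc.

Let nuE u v : u <= v -> nu `]u, v]%classic = (Fc v - Fc u)%:E.
Proof.
move=> uv; rewrite /nu /lebesgue_stieltjes_measure /measure_extension/=.
rewrite -(wlength_itv_bnd Fc false false uv).
by rewrite measurable_mu_extE//; exact: is_ocitv.
Qed.

Let nu_fin : (nu `]a, b]%classic < +oo)%E.
Proof. by rewrite nuE ?ltry// ltW. Qed.

Let mab : measurable (`]a, b]%classic : set (measurableTypeR R)).
Proof. exact: measurable_itv. Qed.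

Let nur : {finite_measure set (measurableTypeR R) -> \bar R} :=
  @mfrestr _ (measurableTypeR R) R _ (lebesgue_stieltjes_measure Fc) mab nu_fin.

(** An open set of small length is exhausted by finite unions of grid cells,
    whose increments of [F] are controlled by absolute continuity. *)
Let nur_dominates : nur `<< @lebesgue_measure R.
Proof.
apply/null_content_dominatesP => A mA A0.
apply/eqP; rewrite eq_le measure_ge0 andbT; apply/lee_addgt0Pr => e e0.
rewrite add0e; have [d d0 H] := acF e0.
have [|U [oU AU UAd]] := lebesgue_regularity_outer mA _ d0.
  by rewrite A0 ltry.
have mU := open_measurable oU.
have Ud : (lebesgue_measure (U : set (measurableTypeR R)) < d%:E)%E.
  by rewrite (measureDI lebesgue_measure mU mA) (setIidr AU) [X in (_ + X)%E]A0 adde0.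
have step k : (nu (inner_approx a b U k) <= e%:E)%E.
  rewrite [leLHS](measure_inner_approx U ab k nuE) lee_fin.
  have wfp := all_inner_pieces U ab k.
  rewrite (eq_big_seq (fun p => `|F p.2 - F p.1|)).
    apply: H => //; first exact: pairwise_inner_pieces.
    rewrite -lte_fin -(@measure_inner_approx _ a b U ab lebesgue_measure idfun k).
      apply: le_lt_trans Ud; apply: le_measure; rewrite ?inE//.
        exact: measurable_inner_approx.
      by move=> x /(inner_approx_sub ab)[].
    move=> u v uv; rewrite [LHS]lebesgue_measure_itv/= lte_fin.
    move: uv; rewrite le_eqVlt => /predU1P[->|uv]; first by rewrite ltxx subrr.
    by rewrite uv EFinB.
  move=> p /(allP wfp)/and3P[ap p12 pb].
  have p1 : p.1 \in `[a, b] by rewrite in_itv/= ap (le_trans p12).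
  have p2 : p.2 \in `[a, b] by rewrite in_itv/= pb (le_trans ap).
  by rewrite /Fc !clampE// ger0_norm// subr_ge0 ndF.
rewrite /nur/= /mfrestr /mrestr/=.
apply: (@le_trans _ _ (nu (\bigcup_k inner_approx a b U k))).
  rewrite (bigcup_inner_approx ab oU); apply: le_measure; rewrite ?inE//.
  - exact: measurableI.
  - exact: measurableI.
  - exact: setSI.
have cvgU : nu \o inner_approx a b U @ \oo --> nu (\bigcup_k inner_approx a b U k).
  apply: (@nondecreasing_cvg_mu _ (measurableTypeR R) _ (lebesgue_stieltjes_measure Fc)).
  - exact: measurable_inner_approx.
  - by apply: bigcupT_measurable; exact: measurable_inner_approx.
  - exact: nondecreasing_inner_approx.
rewrite -(cvg_lim _ cvgU)//; apply: lime_le; first by apply/cvg_ex; eexists; exact: cvgU.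
exact: nearW.
Qed.

(** The density is the Radon-Nikodym derivative of the Stieltjes measure of [F],
    restricted to the interval. *)
Lemma ac_nondecreasing_integral : exists2 h : R -> R,
  (@lebesgue_measure R).-integrable setT (EFin \o h) &
  forall x y, a <= x -> x <= y -> y <= b ->
    F y - F x = \int[lebesgue_measure]_(t in `]x, y]) h t.
Proof.
have [h [h0 hfin inth nurE]] := radon_nikodym_sigma_finite nur_dominates.
exists (fine \o h).
  by apply: eq_integrable inth => // x _; rewrite /= fineK.
move=> x y ax xy yb.
have xab : x \in `[a, b] by rewrite in_itv/= ax (le_trans xy).
have yab : y \in `[a, b] by rewrite in_itv/= yb (le_trans ax).
have Ex : Fc x = F x by rewrite /Fc clampE.
have Ey : Fc y = F y by rewrite /Fc clampE.
have := nurE `]x, y]%classic (measurable_itv _).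
rewrite /nur/= /mfrestr /mrestr/= (setIidl _)//; last first.
  move=> z /=; rewrite !in_itv/= => /andP[xz zy].
  by rewrite (le_lt_trans ax xz) (le_trans zy yb).
rewrite /Rintegral.
under [in X in _ -> X]eq_integral do rewrite /= fineK//.
by move=> <-; rewrite [X in fine X](nuE xy) -Ex -Ey.
Qed.

End ac_nondecreasing.

Section ac_representation.
Context {R : realType}.
Implicit Types (a b : R) (f : R -> R).

Lemma ac_seq_bounded_variation a b f : a <= b -> ac_seq a b f ->
  bounded_variation a b f.
Proof.
move=> ab acf; apply/bounded_variationP => //.
rewrite ge0_fin_numE ?total_variation_ge0//.
have [d d0 H] := ac_seq_total_variation acf ltr01.
have H1 x y : a <= x -> x <= y -> y <= b -> y - x < d ->
    (total_variation x y f <= 1)%E.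
  move=> ax xy yb xyd; have := H [:: (x, y)]; rewrite !big_seq1/= /subitv/= ax xy yb.
  exact.
suff S k x : a <= x -> x <= b -> x - a <= k%:R * (d / 2) ->
    (total_variation a x f < +oo)%E.
  have dd0 : 0 < d / 2 by rewrite divr_gt0.
  apply: (S (Num.truncn ((b - a) / (d / 2))).+1) => //; rewrite -ler_pdivrMr//.
  exact/ltW/truncnS_gt.
elim: k x => [|k ih] x ax xb.
  rewrite mul0r subr_le0 => xa; have -> : x = a by apply/le_anti/andP.
  by rewrite total_variationxx ltry.
rewrite -natr1 mulrDl mul1r => xk.
have d20 : 0 < d / 2 by rewrite divr_gt0.
pose y := Num.max a (x - d / 2).
have ay : a <= y by rewrite /y le_max lexx.
have yx : y <= x by rewrite /y ge_max ax/= gerBl ltW.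
rewrite (total_variationD _ ay yx) lte_add_pinfty//.
  apply: ih => //; first exact: le_trans xb.
  rewrite /y lerBlDr ge_max; apply/andP; split.
    by rewrite lerDr mulr_ge0// ltW.
  by rewrite lerBlDr; lra.
apply: le_lt_trans (ltry 1); apply: H1 => //.
have : x - d / 2 <= y by rewrite /y le_max lexx orbT.
lra.
Qed.

(** Both [T] and [T - f] are nondecreasing and absolutely continuous, for [T] the
    total variation of [f] on the interval from [a]. *)
Lemma ac_integral a b f : a < b -> absolutely_continuous_on a b f ->
  exists2 h : R -> R, (@lebesgue_measure R).-integrable setT (EFin \o h) &
  forall x y, a <= x -> x <= y -> y <= b ->
    f y - f x = \int[lebesgue_measure]_(t in `]x, y]) h t.
Proof.
move=> ab /ac_seqP acf.
have bvf := ac_seq_bounded_variation (ltW ab) acf.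
have fin x y : a <= x -> x <= y -> y <= b -> total_variation x y f \is a fin_num.
  move=> ax xy yb; apply/bounded_variationP => //.
  apply: (bounded_variationl xy yb).
  exact: (bounded_variationr ax (le_trans xy yb)).
pose T x := fine (total_variation a x f).
have TB x y : a <= x -> x <= y -> y <= b ->
    T y - T x = fine (total_variation x y f).
  move=> ax xy yb; rewrite /T (total_variationD _ ax xy) fineD ?fin//.
    by rewrite addrC addKr.
  exact: le_trans yb.
have fT x y : a <= x -> x <= y -> y <= b -> `|f y - f x| <= T y - T x.
  move=> ax xy yb; rewrite TB// -lee_fin fineK ?fin//.
  exact: total_variation_ge.
have ndT : {in `[a, b] &, nondecreasing_fun T}.
  move=> x y; rewrite !in_itv/= => /andP[ax xb] /andP[ay yb] xy.
  by rewrite -subr_ge0; apply: le_trans (fT _ _ ax xy yb).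
have ndU : {in `[a, b] &, nondecreasing_fun (T \- f)}.
  move=> x y; rewrite !in_itv/= => /andP[ax xb] /andP[ay yb] xy.
  have := fT _ _ ax xy yb; have := ler_norm (f y - f x); lra.
have acT : ac_seq a b T.
  move=> e e0; have [d d0 H] := ac_seq_total_variation acf e0.
  exists d => // l la lp ld; rewrite -lee_fin; apply: le_trans (H l la lp ld).
  rewrite -sumEFin big_seq [leRHS]big_seq; apply: lee_sum => p pl.
  have /and3P[ap p12 pb] := allP la p pl.
  by rewrite TB// ger0_norm ?fineK ?fin// fine_ge0// total_variation_ge0.
have acU : ac_seq a b (T \- f).
  move=> e e0; have e20 : 0 < e / 2 by rewrite divr_gt0.
  have [d d0 H] := acT _ e20; exists d => // l la lp ld.
  apply: (@le_trans _ _ (2 * \sum_(p <- l) `|T p.2 - T p.1|)).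
    rewrite mulr_sumr big_seq [leRHS]big_seq; apply: ler_sum => p pl.
    have /and3P[ap p12 pb] := allP la p pl.
    have h1 := fT _ _ ap p12 pb.
    have h2 := ler_norm (T p.2 - T p.1).
    rewrite /= (_ : _ - _ - _ = (T p.2 - T p.1) - (f p.2 - f p.1)); last by ring.
    by apply: le_trans (ler_normB _ _) _; lra.
  by have := H l la lp ld; lra.
have [h inth hE] := ac_nondecreasing_integral ab ndT acT.
have [k intk kE] := ac_nondecreasing_integral ab ndU acU.
exists (h \- k).
  by have := integrableB measurableT inth intk; apply: eq_integrable.
move=> x y ax xy yb; rewrite RintegralB//; last 2 first.
- exact: integrableS inth.
- exact: integrableS intk.
by rewrite -hE// -kE//=; ring.
Qed.

Lemma ac_derivable_ae a b f h :
  (@lebesgue_measure R).-integrable setT (EFin \o h) ->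
  (forall x y, a <= x -> x <= y -> y <= b ->
    f y - f x = \int[lebesgue_measure]_(t in `]x, y]) h t) ->
  {ae @lebesgue_measure R, forall x, a < x < b -> is_derive x 1 f (h x)}.
Proof.
move=> inth fE.
have lh : locally_integrable setT h.
  by apply: open_integrable_locally => //; exact: openT.
have intS y : (@lebesgue_measure R).-integrable [set` Interval (BRight a) (BRight y)] (EFin \o h).
  exact: integrableS inth.
have := FTC1 intS lh; apply: filterS; first exact: (ae_filter_ringOfSetsType lebesgue_measure).
move=> x H /andP[ax xb]; have [dF FE] := H ax; apply: (near_eq_is_derive (f := fun y => f a +
    \int[lebesgue_measure]_(t in [set` Interval (BRight a) (BRight y)]) h t)).
  near=> y.
  have ay : a <= y by apply: ltW; near: y; exact: lt_nbhsr.
  have yb : y <= b by apply: ltW; near: y; exact: lt_nbhsl.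
  by rewrite -fE// addrC subrK.
rewrite -FE derive1E -[X in is_derive _ _ _ X]add0r.
by apply: is_deriveD; exact: DeriveDef.
Unshelve. all: by end_near. Qed.

(** An absolutely continuous function whose derivative is nonnegative almost
    everywhere is nondecreasing: it is the integral of that derivative. *)
Lemma ac_ae_nondecreasing a b f : a < b ->
  absolutely_continuous_on a b f ->
  {ae @lebesgue_measure R, forall x, a < x < b -> exists2 l, is_derive x 1 f l & 0 <= l} ->
  f a <= f b.
Proof.
move=> ab acf H; have [h inth hE] := ac_integral ab acf.
rewrite -subr_ge0 (hE _ _ (lexx a) (ltW ab) (lexx b)).
have mh : measurable_fun setT (EFin \o h) by exact: measurable_int inth.
apply: fine_ge0; rewrite -integral_itv_bndo_bndc; last exact: measurable_funTS.
rewrite [leRHS](@ae_eq_integral _ (measurableTypeR R) R lebesgue_measure _ (EFin \o (fun x => Num.max (h x) 0)))//.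
- by apply: integral_ge0 => x _; rewrite lee_fin le_max lexx orbT.
- exact: measurable_funTS.
- apply: measurable_funTS; apply/measurable_EFinP/measurable_maxr => //.
  exact/measurable_EFinP.
- apply: filterS2 (ac_derivable_ae inth hE) H.
    exact: (ae_filter_ringOfSetsType lebesgue_measure).
  move=> x hx lx; rewrite /= in_itv/= => xab; have {}hx := hx xab; have [l dl l0] := lx xab.
  congr EFin; rewrite (max_idPl _)//.
  by rewrite -(@derive_val _ _ _ _ _ _ _ hx) (@derive_val _ _ _ _ _ _ _ dl).
Qed.

Lemma ac_ae_derivable a b f : a < b -> absolutely_continuous_on a b f ->
  {ae @lebesgue_measure R, forall x, a < x < b -> derivable f x 1}.
Proof.
move=> ab acf; have [h inth hE] := ac_integral ab acf.
apply: filterS (ac_derivable_ae inth hE).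
  exact: (ae_filter_ringOfSetsType lebesgue_measure).
by move=> x H /H[].
Qed.

End ac_representation.

(** * Operations on absolutely continuous functions *)

Section ac_closure.
Context {R : realType}.
Implicit Types (a b K : R) (f g h : R -> R).

Local Notation ac := absolutely_continuous_on.

Lemma acW a b a' b' f : a <= a' -> b' <= b -> ac a b f -> ac a' b' f.
Proof.
move=> aa bb acf e e0; have [d d0 H] := acf e e0; exists d => // k u v uv.
apply: H => i; have [h1 [h2 h3]] := uv i.
by split; [exact: le_trans h1|split => //; exact: le_trans bb].
Qed.

(** Sums, products, inverses and square roots are all instances of this comparison. *)
Lemma ac_compare a b K g h f : 0 <= K -> ac a b g -> ac a b h ->
  (forall x y, a <= x -> x <= y -> y <= b ->
     `|f y - f x| <= K * (`|g y - g x| + `|h y - h x|)) ->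
  ac a b f.
Proof.
move=> K0 acg ach fgh e e0.
have e'0 : 0 < e / (2 * (K + 1)) by rewrite divr_gt0// mulr_gt0// ltr_wpDl.
have [d1 d10 H1] := acg _ e'0; have [d2 d20 H2] := ach _ e'0.
exists (Num.min d1 d2); first by rewrite lt_min d10.
move=> k u v uv disj; rewrite lt_min => /andP[s1 s2].
have {}H1 := H1 k u v uv disj s1; have {}H2 := H2 k u v uv disj s2.
apply: (@le_lt_trans _ _ (\sum_(i < k) K * (`|g (v i) - g (u i)| + `|h (v i) - h (u i)|))).
  by apply: ler_sum => i _; have [? [? ?]] := uv i; exact: fgh.
rewrite -mulr_sumr big_split/=.
set A := \sum_(i < k) `|g _ - _| in H1 *; set B := \sum_(i < k) `|h _ - _| in H2 *.
have A0 : 0 <= A by apply: sumr_ge0.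
have B0 : 0 <= B by apply: sumr_ge0.
apply: (@le_lt_trans _ _ ((K + 1) * (A + B))).
  by rewrite ler_wpM2r ?addr_ge0// lerDl.
have K1 : 0 < K + 1 by rewrite ltr_wpDl.
rewrite -ltr_pdivlMl//; apply: lt_le_trans (ltrD H1 H2) _.
by rewrite le_eqVlt; apply/orP; left; apply/eqP; field; rewrite gt_eqF.
Qed.

Lemma ac_lipschitz a b K f : 0 <= K ->
  (forall x y, a <= x -> x <= y -> y <= b -> `|f y - f x| <= K * (y - x)) ->
  ac a b f.
Proof.
move=> K0 H e e0; exists (e / (K + 1)).
  by rewrite divr_gt0// ltr_wpDl.
move=> k u v uv _ suv; apply: (@le_lt_trans _ _ ((K + 1) * \sum_(i < k) (v i - u i))).
  rewrite mulr_sumr; apply: ler_sum => i _; have [? [? ?]] := uv i.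
  by apply: (le_trans (H _ _ _ _ _)) => //; rewrite ler_wpM2r ?subr_ge0// lerDl.
by rewrite -ltr_pdivlMl 1?mulrC// ltr_wpDl.
Qed.

Lemma ac_cst a b K : ac a b (fun=> K).
Proof. by apply: (@ac_lipschitz _ _ 0) => // x y _ _ _; rewrite subrr normr0 mul0r. Qed.

Lemma ac_continuous a b f : a < b -> ac a b f -> {within `[a, b], continuous f}.
Proof.
move=> ab /ac_seqP acf.
have P e : 0 < e -> exists2 d, 0 < d & forall x y, a <= x -> x <= b -> a <= y -> y <= b ->
    `|x - y| < d -> `|f x - f y| <= e.
  move=> e0; have [d d0 H] := acf e e0; exists d => // x y ax xb ay yb xyd.
  wlog xy : x y ax xb ay yb xyd / x <= y.
    move=> W; have [/W|/ltW yx] := leP x y; first exact.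
    by rewrite distrC; apply: W => //; rewrite distrC.
  have := H [:: (x, y)]; rewrite /= /subitv/= !big_seq1/= ax xy yb distrC; apply => //.
  by rewrite distrC ger0_norm ?subr_ge0// in xyd.
apply/subspace_continuousP => x; rewrite /= in_itv/= => /andP[ax xb].
apply/cvgrPdist_le => e e0; have [d d0 H] := P e e0.
near=> y.
have /andP[ay yb] : a <= y <= b.
  by have : `[a, b]%classic y by near: y; exact: withinT.
apply: H => //.
near: y; apply: cvg_within; exact: (@nbhsx_ballx _ R^o x d d0).
Unshelve. all: by end_near. Qed.

Lemma ac_bounded a b f : a < b -> ac a b f ->
  exists2 M, 0 < M & forall x, a <= x -> x <= b -> `|f x| <= M.
Proof.
move=> ab acf; have cf := ac_continuous ab acf.
have [u _ Hu] := EVT_max (ltW ab) cf; have [v _ Hv] := EVT_min (ltW ab) cf.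
exists (`|f u| + `|f v| + 1); first by rewrite ltr_wpDl.
move=> x ax xb; have xab : x \in `[a, b] by rewrite in_itv/= ax.
have := Hu x xab; have := Hv x xab; have := ler_norm (f u).
have := ler_norm (- f v); rewrite normrN => *.
rewrite ler_norml; apply/andP; split; have := normr_ge0 (f u); have := normr_ge0 (f v); lra.
Qed.

Lemma ac_add a b f g : ac a b f -> ac a b g -> ac a b (fun x => f x + g x).
Proof.
move=> acf acg; apply: (ac_compare (ler01) acf acg) => x y _ _ _.
by rewrite mul1r opprD addrACA ler_normD.
Qed.

Lemma ac_mul a b f g : a < b -> ac a b f -> ac a b g -> ac a b (fun x => f x * g x).
Proof.
move=> ab acf acg; have [M M0 HM] := ac_bounded ab acf.
have [N N0 HN] := ac_bounded ab acg.
apply: (@ac_compare _ _ (M + N) f g) => //; first by rewrite addr_ge0// ltW.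
move=> x y ax xy yb.
rewrite (_ : _ - _ = (f y - f x) * g y + f x * (g y - g x)); last by ring.
apply: le_trans (ler_normD _ _) _; rewrite !normrM.
have h1 := HN y (le_trans ax xy) yb; have h2 := HM x ax (le_trans xy yb).
have := normr_ge0 (f y - f x); have := normr_ge0 (g y - g x) => G0 F0.
have : `|f y - f x| * `|g y| <= `|f y - f x| * N by rewrite ler_wpM2l.
have : `|f x| * `|g y - g x| <= M * `|g y - g x| by rewrite ler_wpM2r.
have := mulr_ge0 (ltW M0) F0; have := mulr_ge0 (ltW N0) G0; lra.
Qed.

Lemma ac_inv a b m f : 0 < m -> (forall x, a <= x -> x <= b -> m <= f x) ->
  ac a b f -> ac a b (fun x => (f x)^-1).
Proof.
move=> m0 mf acf; apply: (ac_compare (K := m ^- 2) _ acf (ac_cst a b 0)).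
  by rewrite invr_ge0 exprn_ge0// ltW.
move=> x y ax xy yb; rewrite subrr normr0 addr0.
have fy := mf y (le_trans ax xy) yb; have fx := mf x ax (le_trans xy yb).
have fy0 := lt_le_trans m0 fy; have fx0 := lt_le_trans m0 fx.
rewrite (_ : _ - _ = (f x * f y)^-1 * - (f y - f x)); last first.
  by field; rewrite !gt_eqF.
have fxy : 0 < f x * f y by rewrite mulr_gt0.
rewrite normrM normrN ler_wpM2r// gtr0_norm ?invr_gt0//.
by rewrite lef_pV2 ?posrE ?exprn_gt0// expr2 ler_pM// ltW.
Qed.

Lemma ac_sqrt a b m f : 0 < m -> (forall x, a <= x -> x <= b -> m <= f x) ->
  ac a b f -> ac a b (fun x => Num.sqrt (f x)).
Proof.
move=> m0 mf acf; apply: (ac_compare (K := (Num.sqrt m)^-1) _ acf (ac_cst a b 0)).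
  by rewrite invr_ge0 sqrtr_ge0.
move=> x y ax xy yb; rewrite subrr normr0 addr0.
have fy := mf y (le_trans ax xy) yb; have fx := mf x ax (le_trans xy yb).
have fy0 := lt_le_trans m0 fy; have fx0 := lt_le_trans m0 fx.
have sm0 : 0 < Num.sqrt m by rewrite sqrtr_gt0.
have sx0 : 0 < Num.sqrt (f x) by rewrite sqrtr_gt0.
have sxm : Num.sqrt m <= Num.sqrt (f x) by rewrite ler_wsqrtr.
have sy0 : 0 < Num.sqrt (f y) by rewrite sqrtr_gt0.
rewrite ler_pdivlMl// -[in leRHS](sqr_sqrtr (ltW fy0)) -[in leRHS](sqr_sqrtr (ltW fx0)).
rewrite subr_sqr normrM mulrC ler_wpM2l// gtr0_norm ?addr_gt0//; lra.
Qed.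

(** By the mean value theorem, a function with a bounded derivative is Lipschitz. *)
Lemma ac_derivable a b K f : (forall x, a <= x -> x <= b -> derivable f x 1) ->
  (forall x, a <= x -> x <= b -> `|'D_1 f x| <= K) -> ac a b f.
Proof.
move=> df dK; apply: (@ac_lipschitz _ _ (Num.max K 0)); first by rewrite le_max lexx orbT.
move=> x y ax xy yb.
have [||c] := @MVT_segment R f ('D_1 f) x y xy.
- move=> z; rewrite in_itv/= => /andP[xz zy]; apply: DeriveDef => //.
  by apply: df; [exact: le_trans ax (ltW xz)|exact: le_trans (ltW zy) yb].
- apply: derivable_within_continuous => z; rewrite in_itv/= => /andP[xz zy].
  by apply: df; [exact: le_trans ax xz|exact: le_trans zy yb].
rewrite in_itv/= => /andP[xc cy] ->; rewrite normrM (ger0_norm (x := y - x)) ?subr_ge0//.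
by rewrite ler_wpM2r ?subr_ge0// le_max dK// ?(le_trans ax)// (le_trans cy).
Qed.

Lemma ac_powR a b r : 0 < a -> a < b -> ac a b (fun x => x `^ r).
Proof.
move=> a0 ab; have der (x : R) : a <= x -> is_derive x 1 (fun y : R => y `^ r) (r * x `^ (r - 1)).
  by move=> ax; apply: is_derive1_powR; exact: lt_le_trans ax.
apply: (@ac_derivable _ _ (`|r| * (a `^ (r - 1) + b `^ (r - 1)))).
  by move=> x ax _; have [] := der x ax.
move=> x ax xb; have [_ ->] := der x ax.
have x0 := lt_le_trans a0 ax; have b0 := lt_trans a0 ab.
rewrite normrM ler_wpM2l// ger0_norm ?powR_ge0//.
have [r1|r1] := leP 0 (r - 1).
  by rewrite ler_wpDl ?powR_ge0// ge0_ler_powR// nnegrE ltW.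
rewrite ler_wpDr ?powR_ge0// -[X in x `^ X]opprK -[X in a `^ X]opprK !(powRN _ (- (r - 1))).
rewrite lef_pV2 ?posrE ?powR_gt0//; apply: ge0_ler_powR => //.
- by rewrite oppr_ge0 ltW.
- by rewrite nnegrE ltW.
- by rewrite nnegrE ltW.
Qed.

Lemma ac_ln a b : 0 < a -> a < b -> ac a b (@ln R).
Proof.
move=> a0 ab; apply: (@ac_derivable _ _ a^-1).
  by move=> x ax _; have [] := is_derive1_ln (lt_le_trans a0 ax).
move=> x ax xb; have x0 := lt_le_trans a0 ax; have [_ ->] := is_derive1_ln x0.
by rewrite gtr0_norm ?invr_gt0// lef_pV2.
Qed.

End ac_closure.

(** * The differential inequality *)

Section differential_inequality.
Context {R : realType}.
Variables (c d : R) (phi N g : R -> R).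
Hypotheses (c_ge0 : 0 <= c) (d_gt0 : 0 < d) (d_le1 : d <= 1).
Hypothesis phi_ge0 : forall w : R, 0 < w -> 0 <= phi w.
Hypothesis phi_le : forall w : R, 0 < w -> phi w <= w.
Hypothesis phi_der : forall w : R, 0 < w -> derivable phi w 1.
Hypothesis phi_ac : forall u v : R, 0 < u -> u < v -> absolutely_continuous_on u v phi.
Hypothesis N_gt0 : forall w : R, 0 < w -> 0 < N w.
Hypothesis N_der : forall w : R, 0 < w ->
  is_derive w 1 N (N w * (- (2 / (d * w)) * ((phi w - c) / (1 + phi w)))).
Hypothesis N_ac : forall u v : R, 0 < u -> u < v -> absolutely_continuous_on u v N.
Hypothesis N_cvg0 : forall e : R, 0 < e -> exists2 h, 0 < h &
  forall w : R, 0 < w -> w < h -> N w <= e.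
Hypothesis g_ac : forall b : R, 0 < b -> absolutely_continuous_on 0 b g.

Let Y (w : R) := g w * (1 + phi w + g w / 2).
Let V (w : R) := Y w * N w.

Hypothesis g_ineq : {ae @lebesgue_measure R, forall w : R, 0 < w -> derivable g w 1 ->
  2 / w * (Y w - (1 + c) * g w) <=
  d * ('D_1 g w * (1 + phi w + g w) + 'D_1 phi w * g w)}.

Let aeF := ae_filter_ringOfSetsType (@lebesgue_measure R).

Let g_acW u v : 0 < u -> u < v -> absolutely_continuous_on u v g.
Proof. by move=> u0 uv; apply: (acW (ltW u0) (lexx v)); apply: g_ac; exact: lt_trans uv. Qed.

Let Y_ac u v : 0 < u -> u < v -> absolutely_continuous_on u v Y.
Proof.
move=> u0 uv; have gac := g_acW u0 uv; apply: ac_mul => //; apply: ac_add.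
  by apply: ac_add; [exact: ac_cst|exact: phi_ac].
by apply: ac_mul => //; exact: ac_cst.
Qed.

Let V_ac u v : 0 < u -> u < v -> absolutely_continuous_on u v V.
Proof. by move=> u0 uv; apply: ac_mul => //; [exact: Y_ac|exact: N_ac]. Qed.

Let Y_der u v : 0 < u -> u < v -> {ae @lebesgue_measure R, forall x : R, u < x < v ->
  exists2 y, is_derive x 1 Y y & 2 / (d * x) * (Y x - (1 + c) * g x) <= y}.
Proof.
move=> u0 uv; apply: filterS2 (ac_ae_derivable uv (g_acW u0 uv)) g_ineq; first exact: aeF.
move=> x dg H uxv.
have x0 : 0 < x by case/andP : uxv => ux _; exact: lt_trans ux.
have {dg}gx := dg uxv; have {}H := H x0 gx; have phix := phi_der x0.
exists ('D_1 g x * (1 + phi x + g x) + 'D_1 phi x * g x); last first.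
  by rewrite -(ler_pM2l d_gt0); apply: le_trans H; rewrite le_eqVlt; apply/orP; left;
    apply/eqP; field; rewrite !gt_eqF.
have Dg : is_derive x 1 g ('D_1 g x) by exact: DeriveDef.
have Dphi : is_derive x 1 phi ('D_1 phi x) by exact: DeriveDef.
by apply: is_derive_eq; rewrite /GRing.scale/=; move: ('D_1 g x) ('D_1 phi x) (g x) (phi x) => g' f' gx0 fx0; field.
Qed.

(** The function [N] is the integrating factor of the part of the inequality that
    is linear in [g]; what remains is a square, whatever the sign of [g]. *)
Let V_der u v : 0 < u -> u < v -> {ae @lebesgue_measure R, forall x : R, u < x < v ->
  exists2 y, is_derive x 1 V y &
    (1 + c) * N x * g x ^+ 2 / (d * x * (1 + phi x)) <= y}.
Proof.
move=> u0 uv; apply: filterS (Y_der u0 uv); first exact: aeF.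
move=> x H uxv.
have x0 : 0 < x by case/andP : uxv => ux _; exact: lt_trans ux.
have [y Dy Hy] := H uxv; have DN := N_der x0.
exists (y * N x + Y x * (N x * (- (2 / (d * x)) * ((phi x - c) / (1 + phi x))))).
  by apply: is_derive_eq; rewrite /GRing.scale/=; ring.
have p0 : 0 < 1 + phi x by have := phi_ge0 x0; lra.
have Nx := N_gt0 x0.
have : 2 / (d * x) * (Y x - (1 + c) * g x) * N x <= y * N x by rewrite ler_wpM2r// ltW.
rewrite -(lerD2r (Y x * (N x * (- (2 / (d * x)) * ((phi x - c) / (1 + phi x)))))).
apply: le_trans; rewrite le_eqVlt; apply/orP; left; apply/eqP.
by rewrite /Y; field; rewrite !gt_eqF.
Qed.

Let ge0_V_der x : 0 < x -> 0 <= (1 + c) * N x * g x ^+ 2 / (d * x * (1 + phi x)).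
Proof.
move=> x0; have p0 := phi_ge0 x0; have Nx := N_gt0 x0.
have d0 := ltW d_gt0; have {}x0 := ltW x0; have {}Nx := ltW Nx.
have c1 : 0 <= 1 + c by rewrite addr_ge0.
have p1 : 0 <= 1 + phi x by rewrite addr_ge0.
by apply: divr_ge0; [apply: mulr_ge0; [exact: mulr_ge0|exact: sqr_ge0]|apply: mulr_ge0 => //; exact: mulr_ge0].
Qed.

Let V_nd u v : 0 < u -> u <= v -> V u <= V v.
Proof.
move=> u0; rewrite le_eqVlt => /predU1P[->//|uv].
apply: (ac_ae_nondecreasing uv (V_ac u0 uv)).
apply: filterS (V_der u0 uv); first exact: aeF.
move=> x H uxv; have [y Dy Hy] := H uxv.
have x0 : 0 < x by case/andP : uxv => ux _; exact: lt_trans ux.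
by exists y => //; apply: le_trans Hy; exact: ge0_V_der.
Qed.

(** As [N] tends to 0 at 0 and [Y] is bounded there, [V] starts at 0. *)
Let V_ge0 w : 0 < w -> 0 <= V w.
Proof.
move=> w0; have [M M0 HM] := ac_bounded w0 (g_ac w0).
rewrite leNgt; apply/negP => Vw.
pose B := M * (1 + w + M).
have B0 : 0 < B by rewrite mulr_gt0// !addr_gt0.
have e0 : 0 < - V w / (2 * B) by rewrite divr_gt0 ?oppr_gt0// mulr_gt0.
have [h h0 Hh] := N_cvg0 e0.
pose x := Num.min w h / 2.
have m0 : 0 < Num.min w h by rewrite lt_min w0.
have x0 : 0 < x by rewrite divr_gt0.
have xm : x < Num.min w h by rewrite /x; lra.
have [xw xh] : x < w /\ x < h by move: xm; rewrite lt_min => /andP.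
have Yx : - B <= Y x.
  rewrite lerNl; apply: le_trans (ler_norm _) _; rewrite normrN /Y normrM.
  have gx := HM x (ltW x0) (ltW xw).
  apply: ler_pM => //; apply: le_trans (ler_normD _ _) _.
  have -> : `|1 + phi x| = 1 + phi x by rewrite ger0_norm// addr_ge0// phi_ge0.
  have := phi_le x0; rewrite normrM [`|2^-1|]ger0_norm//; have := normr_ge0 (g x); lra.
have Nx := Hh x x0 xh; have Nx0 := N_gt0 x0.
have := V_nd x0 (ltW xw); apply/negP; rewrite -ltNge.
apply: (@lt_le_trans _ _ (- B * N x)); last by rewrite /V ler_wpM2r// ltW.
rewrite mulNr ltrNr; apply: (@le_lt_trans _ _ (B * (- V w / (2 * B)))).
  by rewrite ler_wpM2l// ltW.
rewrite [ltLHS](_ : _ = - V w / 2); last by field; rewrite gt_eqF.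
lra.
Qed.

Let Y_ge0 w : 0 < w -> 0 <= Y w.
Proof. by move=> w0; have := V_ge0 w0; rewrite /V pmulr_lge0// N_gt0. Qed.

(** The two roots of [g (1 + phi + g / 2)] are 0 and [- 2 (1 + phi) <= -2]. *)
Let g_dichotomy w : 0 < w -> 0 <= g w \/ g w <= -2.
Proof.
move=> w0; have := Y_ge0 w0; have := phi_ge0 w0; rewrite /Y => p Hy.
have [g0|g0] := leP 0 (g w); first by left.
right; rewrite leNgt; apply/negP => g2; move: Hy; apply/negP; rewrite -ltNge.
by rewrite nmulr_rlt0//; lra.
Qed.

(** A negative value would propagate down to the origin as [g <= -2], and the term
    [- 2 (1 + c) g / w] of the inequality is then not integrable at 0. *)
Let g_ge0 w0 : 0 < w0 -> 0 <= g w0.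
Proof.
move=> w0_gt0; rewrite leNgt; apply/negP => gw0.
have g2 w : 0 < w -> w <= w0 -> g w <= -2.
  move=> w_gt0; rewrite le_eqVlt => /predU1P[->|ww0].
    by have [] := g_dichotomy w0_gt0 => //; lra.
  have [gw|//] := g_dichotomy w_gt0.
  have [||z] := @IVT R g w w0 (-1) (ltW ww0).
  - exact/ac_continuous/g_acW.
  - have [|gw2] := g_dichotomy w0_gt0; first lra.
    by rewrite ge_min le_max; apply/andP; split; apply/orP; [right|left]; lra.
  rewrite in_itv/= => /andP[wz zw0] gz.
  by have [] := g_dichotomy (lt_le_trans w_gt0 wz); lra.
pose C := 4 / d.
have C0 : 0 < C by rewrite divr_gt0.
have nd e : 0 < e -> e < w0 -> Y e - C * ln e <= Y w0 - C * ln w0.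
  move=> e0 ew0; pose F (x : R) := Y x + (- C) * ln x.
  have : F e <= F w0; last by rewrite /F !mulNr.
  apply: ac_ae_nondecreasing => //.
    apply: ac_add; first exact: Y_ac.
    by apply: ac_mul => //; [exact: ac_cst|exact: ac_ln].
  apply: filterS (Y_der e0 ew0); first exact: aeF.
move=> x H exw; have [y Dy Hy] := H exw.
  have /andP[ex xw] := exw; have x0 : 0 < x by exact: lt_trans ex.
  have Dl := is_derive1_ln x0.
  exists (y - C * x^-1).
    by apply: is_derive_eq; rewrite /GRing.scale/=; ring.
  rewrite subr_ge0; apply: le_trans Hy.
  rewrite (_ : C / x = 2 / (d * x) * 2); last by rewrite /C; field; rewrite !gt_eqF.
  have dx : 0 < d * x by rewrite mulr_gt0.
  rewrite ler_pM2l ?divr_gt0//; have := g2 x x0 (ltW xw); have := Y_ge0 x0.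
  have cg : g x <= -2 -> c * g x <= 0 by move=> ?; rewrite mulr_ge0_le0//; lra.
  by move=> ? /[dup] /cg; lra.
pose A := Y w0 - C * ln w0.
pose e := Num.min (w0 / 2) (expR (- (A / C) - 1)).
have e0 : 0 < e by rewrite lt_min divr_gt0// expR_gt0.
have ew0 : e < w0 by rewrite gt_min; apply/orP; left; lra.
have := nd e e0 ew0; have := Y_ge0 e0.
have le : ln e <= - (A / C) - 1.
  by rewrite -[leRHS]expRK ler_ln ?posrE ?expR_gt0// ge_min lexx orbT.
have : C * ln e <= C * (- (A / C) - 1) by rewrite ler_wpM2l// ltW.
rewrite [X in _ <= X -> _](_ : _ = - A - C); last by field; rewrite gt_eqF.
by rewrite -/A; lra.
Qed.

Section positive_start.
Variable w1 : R.
Hypotheses (w1_gt0 : 0 < w1) (gw1 : 0 < g w1).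

Let V1 : 0 < V w1.
Proof.
rewrite /V mulr_gt0 ?N_gt0// /Y mulr_gt0//.
by have := phi_ge0 w1_gt0; have := gw1; lra.
Qed.

Let V_ge w : w1 <= w -> V w1 <= V w. Proof. exact: V_nd. Qed.

Let w_gt0 w : w1 <= w -> 0 < w. Proof. exact: lt_le_trans. Qed.

Let Y_gt0 w : w1 <= w -> 0 < Y w.
Proof.
move=> w1w; have := lt_le_trans V1 (V_ge w1w).
by rewrite /V pmulr_lgt0// N_gt0// w_gt0.
Qed.

Let Z (w : R) := Num.sqrt (Y w).

Let Z_gt0 w : w1 <= w -> 0 < Z w. Proof. by move=> /Y_gt0; rewrite sqrtr_gt0. Qed.

Let Z2 w : w1 <= w -> Z w ^+ 2 = Y w.
Proof. by move=> /Y_gt0/ltW/sqr_sqrtr. Qed.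

Let g_leZ w : w1 <= w -> g w <= 2 * Z w.
Proof.
move=> w1w; have w0 := w_gt0 w1w; have Zw := Z_gt0 w1w; have gw := g_ge0 w0.
rewrite -ler_sqr ?nnegrE//; last by lra.
rewrite exprMn Z2// /Y; have pg := mulr_ge0 gw (phi_ge0 w0).
have g2 := sqr_ge0 (g w); nra.
Qed.

Let C0 : R := 2 * (1 + c).
Let r : R := d^-1.

(** As [g <= 2 Z], the inequality implies [d w Z' >= Z - C0], so that [Z]
    grows like [w ^ (1 / d)] as soon as it exceeds [C0]. *)
Let Z_nd u v : w1 <= u -> u <= v ->
  (Z u - C0) * u `^ (- r) <= (Z v - C0) * v `^ (- r).
Proof.
move=> w1u; rewrite le_eqVlt => /predU1P[->//|uv]; have u0 := w_gt0 w1u.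
apply: (ac_ae_nondecreasing (f := fun x => (Z x - C0) * x `^ (- r)) uv).
  apply: ac_mul => //; last exact: ac_powR.
  apply: ac_add; last exact: ac_cst.
  have [M M0 HM] := ac_bounded uv (N_ac u0 uv).
  apply: (@ac_sqrt _ _ _ (V w1 / M)); [by rewrite divr_gt0| |exact: Y_ac].
  move=> x ux xv; have w1x := le_trans w1u ux.
  rewrite ler_pdivrMr//; apply: le_trans (V_ge w1x) _; rewrite /V ler_wpM2l ?Y_ge0 ?w_gt0//.
  by apply: le_trans (HM x ux xv); exact: ler_norm.
apply: filterS (Y_der u0 uv); first exact: aeF.
move=> x H uxv; have [y Dy Hy] := H uxv.
have /andP[ux xv] := uxv; have w1x := le_trans w1u (ltW ux); have x0 := w_gt0 w1x.
have Yx := Y_gt0 w1x; have Zx := Z_gt0 w1x.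
have Ds := is_derive1_sqrt Yx.
have DZ : is_derive x 1 Z ((2 * Z x)^-1 * y) by exact: is_derive1_comp.
have Dp : is_derive x 1 (fun t : R => t `^ (- r)) (- r * x `^ (- r - 1)).
  exact: is_derive1_powR.
have px : x `^ (- r) = x * x `^ (- r - 1).
  rewrite -[X in _ = X * _](powRr1 (ltW x0)) -powRD ?(gt_eqF x0) ?implybT//.
  by congr (_ `^ _); ring.
have pp : 0 < x `^ (- r - 1) by rewrite powR_gt0.
exists (((2 * Z x)^-1 * y * x - r * (Z x - C0)) * x `^ (- r - 1)).
  by apply: is_derive_eq; rewrite /GRing.scale/= px; ring.
rewrite pmulr_lge0// subr_ge0.
have gZ := g_leZ w1x.
have h1 : 2 / (d * x) * (Z x ^+ 2 - (1 + c) * (2 * Z x)) <= y.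
  apply: le_trans Hy; rewrite ler_wpM2l ?divr_ge0 ?mulr_ge0 ?(ltW d_gt0) ?(ltW x0)//.
  by rewrite Z2// lerD2l lerN2 ler_wpM2l// addr_ge0.
have k0 : 0 < (2 * Z x)^-1 * x by rewrite mulr_gt0// invr_gt0 mulr_gt0.
rewrite mulrAC; apply: le_trans (ler_wpM2l (ltW k0) h1).
by rewrite le_eqVlt; apply/orP; left; apply/eqP; rewrite /r /C0; field; rewrite !gt_eqF.
Qed.

Let growth w2 : w1 <= w2 -> C0 < Z w2 -> exists2 k, 0 < k &
  forall w : R, w2 <= w -> k * w `^ r <= Z w.
Proof.
move=> w12 Zw2; exists ((Z w2 - C0) * w2 `^ (- r)).
  by rewrite mulr_gt0 ?subr_gt0// powR_gt0// w_gt0.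
move=> w w2w; have w0 := w_gt0 (le_trans w12 w2w).
have := ler_wpM2r (powR_ge0 w r) (Z_nd w12 w2w) => /le_trans; apply.
rewrite -mulrA -powRD ?(gt_eqF w0) ?implybT// addNr powRr0 mulr1 gerBl.
by rewrite mulr_ge0// addr_ge0.
Qed.

(** If [g <= k' w ^ r], then [Y <= 3 k' w ^ (2 r)] because [phi <= w <= w ^ r]. *)
Let growth_g w2 k : w1 <= w2 -> 0 < k ->
  (forall w : R, w2 <= w -> k * w `^ r <= Z w) ->
  exists k' w3, 0 < k' /\ forall w : R, w3 <= w -> k' * w `^ r <= g w.
Proof.
move=> w12 k0 Hk; pose k' := Num.min 1 (k ^+ 2 / 3).
have k'0 : 0 < k' by rewrite lt_min ltr01 divr_gt0// exprn_gt0.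
exists k', (Num.max w2 1); split => // w; rewrite ge_max => /andP[w2w w_ge1].
have w1w := le_trans w12 w2w; have w0 := w_gt0 w1w.
rewrite leNgt; apply/negP => gk; have := Hk w w2w.
have kw0 : 0 < k * w `^ r by rewrite mulr_gt0// powR_gt0.
rewrite -ler_sqr ?nnegrE ?(ltW kw0) ?(ltW (Z_gt0 w1w))// Z2//; apply/negP; rewrite -ltNge.
have gw := g_ge0 w0.
set u := w `^ r in gk *.
have r1 : 1 <= r by rewrite /r invf_ge1.
have wu : w <= u by apply: le1r_powR.
have u1 : 1 <= u by exact: le_trans wu.
have k'1 : k' <= 1 by rewrite ge_min lexx.
have k'2 : k' * 3 <= k ^+ 2.
  by rewrite -ler_pdivlMr// ge_min lexx orbT.
have p0 := phi_ge0 w0; have pw := phi_le w0.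
apply: (@le_lt_trans _ _ ((k' * u) * (1 + u + k' * u / 2))).
  rewrite /Y; apply: ler_pM => //; [lra|lra|lra].
rewrite exprMn; apply: (@lt_le_trans _ _ (k' * 3 * u ^+ 2)); last first.
  by rewrite ler_wpM2r// sqr_ge0.
rewrite expr2 mulrA -[ltLHS]mulrA -[ltRHS]mulrA -[ltRHS]mulrA ltr_pM2l//.
rewrite mulrCA ltr_pM2l; last lra.
have : k' * u <= 1 * u by rewrite ler_wpM2r//; lra.
lra.
Qed.

Hypothesis N_alt :
  (forall e : R, 0 < e -> exists w0, forall w : R, w0 <= w -> N w <= e) \/
  (exists2 K, 0 < K & forall w : R, 1 <= w -> phi w <= K /\ N w <= K * (1 + ln w)).

(** While [Z <= C0] the function [Y] is bounded, and [Y N >= V w1] excludes that [N] tends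
    to 0. In the other case [V ^ 2 <= (B g) ^ 2 N K (1 + ln w)] turns the bound on the derivative of
    [V] into a Riccati inequality whose solutions blow up, [1 / (w (1 + ln w))] having the
    unbounded primitive [ln (1 + ln w)]. *)
Let Z_exceeds : exists2 w2, w1 <= w2 & C0 < Z w2.
Proof.
apply: contrapT => nex.
have ZC w : w1 <= w -> Z w <= C0.
  by move=> w1w; rewrite leNgt; apply/negP => ?; apply: nex; exists w.
have C00 : 0 <= C0 by rewrite mulr_ge0// addr_ge0.
have YC w : w1 <= w -> Y w <= C0 ^+ 2.
  by move=> w1w; rewrite -Z2// ler_sqr ?nnegrE ?ZC// ltW// Z_gt0.
case: N_alt => [N0|[K K0 HK]].
  have C1 : 0 < C0 ^+ 2 + 1 by rewrite ltr_wpDl// sqr_ge0.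
  have e0 : 0 < V w1 / (C0 ^+ 2 + 1) by rewrite divr_gt0.
  have [w0 Hw0] := N0 _ e0; pose w := Num.max w0 w1.
  have w1w : w1 <= w by rewrite le_max lexx orbT.
  have Nw : N w <= V w1 / (C0 ^+ 2 + 1) by apply: Hw0; rewrite le_max lexx.
  have := V_ge w1w; apply/negP; rewrite -ltNge /V.
  apply: (@le_lt_trans _ _ (C0 ^+ 2 * (V w1 / (C0 ^+ 2 + 1)))).
    by apply: ler_pM => //; [exact/ltW/Y_gt0|exact/ltW/N_gt0/w_gt0|exact: YC].
  rewrite mulrA ltr_pdivrMr// mulrC ltr_pM2l//; lra.
pose w3 := Num.max w1 1.
have w13 : w1 <= w3 by rewrite le_max lexx.
pose B := 1 + K + C0; have B0 : 0 < B by rewrite ltr_wpDr// ltr_pwDr.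
pose kappa := (1 + c) / (B ^+ 2 * d * (1 + K) * K).
have c1 : 0 < 1 + c by rewrite ltr_pwDl.
have kappa0 : 0 < kappa by rewrite divr_gt0// !mulr_gt0// ?exprn_gt0// ltr_pwDl// ltW.
have ln1_gt0 (x : R) : 1 <= x -> 0 < 1 + ln x.
  by move=> x1; rewrite ltr_pwDl// ln_ge0.
have nd v : w3 < v ->
    - (V w3)^-1 - kappa * ln (1 + ln w3) <= - (V v)^-1 - kappa * ln (1 + ln v).
  move=> w3v; pose F (x : R) := -1 * (V x)^-1 + (- kappa) * ln (1 + ln x).
  have w30 := w_gt0 w13.
  have : F w3 <= F v; last by rewrite /F !mulN1r !mulNr.
  have w31 : 1 <= w3 by rewrite le_max lexx orbT.
  apply: ac_ae_nondecreasing => //.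
    apply: ac_add; apply: ac_mul => //; try exact: ac_cst.
      apply: (@ac_inv _ _ _ (V w1)) => //; last exact: V_ac.
      by move=> x w3x _; apply: V_ge; exact: le_trans w3x.
    have dln (x : R) : w3 <= x -> is_derive x 1 (fun x : R => ln (1 + ln x)) ((1 + ln x)^-1 * x^-1).
      move=> w3x; have x0 : 0 < x by exact: lt_le_trans w3x.
      have D1 := is_derive1_ln x0.
      have D2 := is_derive1_ln (ln1_gt0 x (le_trans w31 w3x)).
      have D3 : is_derive x 1 (fun x : R => 1 + ln x) x^-1.
        by apply: is_derive_eq; rewrite add0r mul1r.
      exact: is_derive1_comp.
    apply: (@ac_derivable _ _ _ 1) => x w3x _; have [hd] := dln x w3x; first by move=> _; exact: hd.
    move=> ->.
    have x1 := le_trans w31 w3x; have x0 : 0 < x by exact: lt_le_trans w3x.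
    have l1 := ln1_gt0 x x1; rewrite ger0_norm ?mulr_ge0 ?invr_ge0 ?(ltW l1) ?(ltW x0)//.
    rewrite -invfM invf_le1 ?mulr_gt0//; have l0 := ln_ge0 x1.
    by rewrite -[leLHS]mulr1 ler_pM//; lra.
  apply: filterS (V_der w30 w3v); first exact: aeF.
  move=> x H wxv; have [y Dy Hy] := H wxv; have /andP[w3x xv] := wxv.
  have x0 : 0 < x by exact: lt_trans w3x.
  have w1x : w1 <= x by exact: le_trans w13 (ltW w3x).
  have x1 : 1 <= x by exact: le_trans w31 (ltW w3x).
  have l1 := ln1_gt0 x x1.
  have Vx : 0 < V x by exact: lt_le_trans (V_ge w1x).
  have D1 := is_derive1_ln x0; have D2 := is_derive1_ln l1.
  have D3 : is_derive x 1 (fun x : R => 1 + ln x) x^-1.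
    by apply: is_derive_eq; rewrite add0r mul1r.
  have D4 : is_derive x 1 (fun x : R => ln (1 + ln x)) ((1 + ln x)^-1 * x^-1).
    exact: is_derive1_comp.
  have D5 : is_derive x 1 (fun x : R => (V x)^-1) (- (V x) ^- 2 *: y).
    by apply: is_deriveV => //; rewrite gt_eqF.
  exists ((V x) ^- 2 * y - kappa * ((1 + ln x)^-1 * x^-1)).
    by apply: is_derive_eq; rewrite /GRing.scale/=; ring.
  rewrite subr_ge0 -ler_pdivrMl ?invr_gt0 ?exprn_gt0// invrK; apply: le_trans Hy.
  have [pK NK] := HK x x1; have p0 := phi_ge0 x0; have Nx := N_gt0 x0.
  have gx := g_ge0 x0; have g2Z := g_leZ w1x; have ZCx := ZC x w1x.
  have YB : Y x <= g x * B by rewrite /Y ler_wpM2l// /B; lra.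
  have Yx := Y_gt0 w1x.
  have VB : V x ^+ 2 <= (g x * B) ^+ 2 * N x * (K * (1 + ln x)).
    rewrite /V exprMn -mulrA; apply: ler_pM; rewrite ?sqr_ge0//.
      by rewrite 2!expr2; apply: ler_pM => //; exact: ltW.
    by rewrite expr2 ler_wpM2l// ltW.
  have kx : 0 < kappa * ((1 + ln x)^-1 * x^-1).
    by apply: mulr_gt0 => //; apply: mulr_gt0; rewrite invr_gt0.
  apply: le_trans (ler_wpM2r (ltW kx) VB) _.
  have K1 : 0 < 1 + K by rewrite ltr_pwDl// ltW.
  rewrite [leLHS](_ : _ = (1 + c) * N x * g x ^+ 2 / (d * x * (1 + K))); last first.
    by rewrite /kappa; field; rewrite !gt_eqF.
  have cNg : 0 <= (1 + c) * N x * g x ^+ 2 by rewrite !mulr_ge0 ?sqr_ge0// ltW.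
  have p1 : 0 < 1 + phi x by rewrite ltr_pwDl.
  rewrite ler_wpM2l// lef_pV2 ?posrE ?mulr_gt0 ?ltr_pwDl ?(ltW K0)//.
  by rewrite ler_pM2l ?mulr_gt0// lerD2l.
pose A := (V w3)^-1 + kappa * ln (1 + ln w3).
pose T := Num.max (A / kappa + 1) (ln (1 + ln w3) + 1).
pose v := expR (expR T - 1).
have lv : ln (1 + ln v) = T by rewrite /v expRK addrC subrK expRK.
have w31 : 1 <= w3 by rewrite le_max lexx orbT.
have w3v : w3 < v.
  have w30 := w_gt0 w13.
  rewrite -[w3]lnK ?posrE// /v ltr_expR ltrBrDl.
  rewrite -[ltLHS]lnK ?posrE ?ln1_gt0// ltr_expR.
  by rewrite /T lt_max; apply/orP; right; rewrite ltrDl.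
have := nd v w3v; rewrite lv; apply/negP; rewrite -ltNge.
have Vv : 0 < (V v)^-1.
  by rewrite invr_gt0; apply: lt_le_trans (V_ge (le_trans w13 (ltW w3v))).
have : kappa * (A / kappa + 1) <= kappa * T.
  by rewrite ler_wpM2l ?(ltW kappa0)// le_max lexx.
rewrite mulrDr mulr1 (mulrC A) mulVKf ?gt_eqF// /A; lra.
Qed.

Lemma ineq_growth_pos : exists k w3, 0 < k /\ forall w : R, w3 <= w -> k * w `^ d^-1 <= g w.
Proof.
have [w2 w12 Zw2] := Z_exceeds; have [k k0 Hk] := growth w12 Zw2.
exact: growth_g Hk.
Qed.

End positive_start.

Lemma ineq_zero_or_growth :
  (forall e : R, 0 < e -> exists w0, forall w : R, w0 <= w -> N w <= e) \/
  (exists2 K, 0 < K & forall w : R, 1 <= w -> phi w <= K /\ N w <= K * (1 + ln w)) ->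
  (forall w : R, 0 <= w -> g w = 0) \/
  exists k w3, 0 < k /\ forall w : R, w3 <= w -> k * w `^ d^-1 <= g w.
Proof.
move=> alt; have [g0|] := pselect (forall w : R, 0 < w -> g w = 0); last first.
  move/existsNP => [w /not_implyP[w0 /eqP gw]]; right.
  by apply: (@ineq_growth_pos w) => //; rewrite lt_def gw g_ge0.
left=> w; rewrite le_eqVlt => /predU1P[<-|]; last exact: g0.
apply/eqP; rewrite -normr_le0; apply/ler_addgt0Pr => e e0; rewrite add0r.
have [h h0 H] := ac_seqP (g_ac ltr01) e0.
pose x := Num.min h 1 / 2; have m0 : 0 < Num.min h 1 by rewrite lt_min h0 ltr01.
have x0 : 0 < x by rewrite divr_gt0.
have [xh x1] : x < h /\ x < 1.
  by have : x < Num.min h 1; [rewrite /x; lra|rewrite lt_min => /andP].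
have := H [:: (0, x)]; rewrite !big_seq1/= /subitv/= lexx (ltW x0) (ltW x1) subr0 g0//.
by rewrite sub0r normrN; apply.
Qed.

End differential_inequality.

(** * Integrals over the real line *)

Section monotone_integral.
Import HBNNSimple.

(** The integral is a supremum over the simple functions below the integrand, whence
    monotonicity; it applies in particular to iterated integrals. *)
Lemma ge0_le_integralW d (T : measurableType d) (R : realType)
    (m : {measure set T -> \bar R}) (D : set T) (f g : T -> \bar R) :
  (forall x, D x -> 0 <= f x)%E -> (forall x, D x -> f x <= g x)%E ->
  (\int[m]_(x in D) f x <= \int[m]_(x in D) g x)%E.
Proof.
move=> f0 fg; rewrite integral_mkcond [leRHS]integral_mkcond.
have f0' x : (0 <= (f \_ D) x)%E by rewrite patchE; case: ifPn => // /set_mem /f0.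
have fg' x : ((f \_ D) x <= (g \_ D) x)%E.
  by rewrite !patchE; case: ifPn => // /set_mem /fg.
have g0 x : (0 <= (g \_ D) x)%E by exact: le_trans (fg' x).
rewrite !ge0_integralTE//; apply: le_ereal_sup => _ [h hf <-].
by exists h => // x; exact: le_trans (fg' x).
Qed.

End monotone_integral.

Section real_integrals.
Context {R : realType}.
Local Notation mu := (@lebesgue_measure R).

Lemma powR_expRN_bounded (r : R) : 0 <= r ->
  exists2 C, 0 < C & forall u : R, 0 <= u -> u `^ r * expR (- u) <= C.
Proof.
move=> r0; pose m := (Num.truncn r).+1.
have rm : r <= m%:R by exact/ltW/truncnS_gt.
exists (1 + m`!%:R); first by rewrite ltr_wpDr.
move=> u u0; rewrite expRN ler_pdivrMr ?expR_gt0//.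
have e1 : 1 <= expR u by rewrite -expR0 ler_expR.
have m0 : (0 : R) < m`!%:R by rewrite ltr0n fact_gt0.
have em : u ^+ m <= m`!%:R * expR u.
  rewrite -ler_pdivrMl// mulrC; apply: le_trans (expR_ge1Dxn (Num.truncn r) u0).
  by rewrite lerDr.
have [u1|u1] := leP u 1.
  have : u `^ r <= 1 by rewrite -(powRr0 u); have [->|un0] := eqVneq u 0;
    [rewrite powRr0 /powR eqxx; case: eqP|rewrite ger_powR// lt_def un0 u0].
  rewrite mulrDl mul1r; have := mulr_gt0 m0 (expR_gt0 u); lra.
have : u `^ r <= u ^+ m by rewrite -powR_mulrn// ler_powR// ltW.
by rewrite mulrDl mul1r; have := expR_gt0 u; lra.
Qed.

(** The majorant [C / (1 + t ^ 2)] has a finite integral. *)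
Lemma integral_le_oneDsqr_fin (f : R -> R) (C : R) : 0 <= C ->
  (forall t, 0 < t -> 0 <= f t) -> (forall t, 0 < t -> f t * (1 + t ^+ 2) <= C) ->
  (\int[mu]_(t in `]0%R, +oo[) (f t)%:E < +oo)%E.
Proof.
move=> C0 f0 fC.
have mS1 : measurable_fun (setT : set R) (fun t => (oneDsqr t)^-1).
  by apply: continuous_measurable_fun; exact: continuous_oneDsqrV.
have mS : measurable_fun (setT : set R) (fun t => C * (oneDsqr t)^-1).
  exact: measurable_funM.
apply: (@le_lt_trans _ _ (\int[mu]_(t in `[0%R, +oo[) (C * (oneDsqr t)^-1)%:E)%E).
  apply: (@le_trans _ _ (\int[mu]_(t in `]0%R, +oo[) (C * (oneDsqr t)^-1)%:E)%E).
    apply: ge0_le_integralW => //.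
    - by move=> t; rewrite /= in_itv/= andbT => t0; rewrite lee_fin f0.
    - move=> t; rewrite /= in_itv/= andbT => t0; rewrite lee_fin.
      by rewrite ler_pdivlMr ?fC// (lt_le_trans ltr01 (oneDsqr_ge1 t)).
  apply: ge0_subset_integral => //.
  - by apply/measurable_EFinP; exact: measurable_funTS.
  - by move=> t _; rewrite lee_fin mulr_ge0// invr_ge0 (le_trans ler01 (oneDsqr_ge1 t)).
  - by move=> t; rewrite /= !in_itv/= !andbT => /ltW.
under eq_integral do rewrite EFinM.
rewrite ge0_integralZl ?lee_fin//=; last first.
  by apply/measurable_EFinP; exact: measurable_funTS.
apply: (@le_lt_trans _ _ (C%:E * (pi / 2)%:E)%E); last by rewrite -EFinM ltry.
by rewrite -(integral0y_oneDsqr R).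
Qed.

Lemma integral_gt0_itv (D : set R) (f : R -> \bar R) (u v c : R) :
  measurable D -> measurable_fun D f -> (forall t, D t -> (0 <= f t)%E) ->
  u < v -> 0 < c -> `[u, v] `<=` D -> (forall t, (u <= t <= v)%R -> (c%:E <= f t)%E) ->
  (0 < \int[mu]_(t in D) f t)%E.
Proof.
move=> mD mf f0 uv c0 uvD cf.
apply: (@lt_le_trans _ _ (\int[mu]_(t in `[u, v]) c%:E)%E).
  rewrite integral_cst//= lebesgue_measure_itv/= lte_fin uv -EFinB -EFinM.
  by rewrite lte_fin mulr_gt0// subr_gt0.
apply: (@le_trans _ _ (\int[mu]_(t in `[u, v]) f t)%E).
  apply: ge0_le_integralW => //.
  - by move=> t _; rewrite lee_fin ltW.
exact: ge0_subset_integral.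
Qed.

Lemma lebesgue_measure_scale (c : R) (A : set R) : 0 < c -> measurable A ->
  (c%:E * pushforward mu ( *%R c : R -> measurableTypeR R) A = mu A)%E.
Proof.
move=> c0 mA; have mc : measurable_fun setT ( *%R c : measurableTypeR R -> measurableTypeR R).
  exact: mulrl_measurable.
pose nu : {measure set (measurableTypeR R) -> \bar R} :=
  measure_function_pushforward__canonical__measure_function_Measure mu mc.
have : mscale (NngNum (ltW c0)) nu A = mu A; last by [].
apply/esym/lebesgue_measure_unique => //= _ [[a b]] _ <-.
rewrite /mscale/= /pushforward.
rewrite (_ : *%R c @^-1` _ = `]a / c, b / c]%classic); last first.
  apply/seteqP; split => x /=; rewrite !in_itv/= ltr_pdivrMr// ler_pdivlMr//.
    by rewrite mulrC [x * c]mulrC => /andP[-> ->].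
  by rewrite [x * c]mulrC => /andP[-> ->].
rewrite !lebesgue_measure_itv/= !lte_fin ltr_pM2r ?invr_gt0//.
by case: ifPn => _; rewrite ?mule0// -!EFinB -EFinM; congr EFin; field; rewrite gt_eqF.
Qed.

Lemma ge0_integral_scale (c : R) (f : R -> \bar R) : 0 < c ->
  measurable_fun setT f -> (forall x, 0 <= f x)%E ->
  (\int[mu]_x f x = c%:E * \int[mu]_x f (c * x)%R)%E.
Proof.
move=> c0 mf f0; have mc : measurable_fun setT ( *%R c : measurableTypeR R -> measurableTypeR R).
  exact: mulrl_measurable.
pose nu : {measure set (measurableTypeR R) -> \bar R} :=
  measure_function_pushforward__canonical__measure_function_Measure mu mc.
transitivity (\int[mscale (NngNum (ltW c0)) nu]_x f x)%E.
  apply: eq_measure_integral => A mA _; exact/esym/lebesgue_measure_scale.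
rewrite ge0_integral_mscale//=; congr (_ * _)%E.
by rewrite ge0_integral_pushforward.
Qed.

(** The integral over ]0, h[ equals the one over ]0, h / 2[ by homogeneity. *)
Lemma integral_inv_infty (h : R) : 0 < h ->
  (\int[mu]_(s in `]0%R, h[) (s^-1)%:E = +oo)%E.
Proof.
move=> h0; pose f (s : R) := (s `^ (-1))%:E.
have fE s : 0 < s -> f s = (s^-1)%:E by move=> s0; rewrite /f powR_inv1 ?ltW.
transitivity (\int[mu]_(s in `]0%R, h[) f s)%E.
  by apply: eq_integral => s; rewrite inE/= in_itv/= => /andP[/fE].
have h20 : 0 < h / 2 by rewrite divr_gt0.
have hh : h / 2 < h by lra.
have mf : measurable_fun (setT : set R) f.
  by apply/measurable_EFinP; exact: measurable_powR.
have f0 (k x : R) : `]0, k[%classic x -> (0 <= f x)%E.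
  by move=> _; rewrite lee_fin powR_ge0.
have mfh : measurable_fun (setT : set R) (f \_ `]0, h[).
  by apply/(measurable_restrictT _ _).1 => //; exact: measurable_funTS.
have mfh2 : measurable_fun (setT : set R) (fun x => (f \_ `]0, h[) (2 * x)).
  by apply: measurableT_comp => //; exact: mulrl_measurable.
have E : (\int[mu]_(s in `]0%R, h[) f s = \int[mu]_(s in `]0%R, (h / 2)%R[) f s)%E.
  rewrite integral_mkcond [RHS]integral_mkcond (@ge0_integral_scale 2)//; last first.
    by move=> x; rewrite patchE; case: ifPn => //; rewrite inE => /f0.
  rewrite -ge0_integralZl//; last first.
    by move=> x _; rewrite patchE; case: ifPn => //; rewrite inE => /f0.
  apply: eq_integral => x _; rewrite !patchE.
  have -> : (2 * x \in (`]0, h[%classic : set R)) = (x \in (`]0, (h / 2)[%classic : set R)).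
    by apply/idP/idP; rewrite !inE/= !in_itv/= => /andP[? ?]; apply/andP; split; lra.
  case: ifPn => [|_]; last by rewrite mule0.
  rewrite inE/= in_itv/= => /andP[x0 _]; rewrite (fE _ x0) fE ?mulr_gt0// -EFinM; congr EFin.
  by field; rewrite gt_eqF.
have split : (\int[mu]_(s in `]0%R, h[) f s =
    \int[mu]_(s in `]0%R, (h / 2)%R[) f s + \int[mu]_(s in `[(h / 2)%R, h[) f s)%E.
  rewrite (@itv_bndbnd_setU _ _ _ (BLeft (h / 2)))//; last by rewrite bnd_simp ltW.
  rewrite ge0_integral_setU//.
  - exact: measurable_funTS.
  - by move=> x _; rewrite lee_fin powR_ge0.
  - by apply/disj_setPLR => x/=; rewrite !in_itv/= => /andP[_ xh]; apply/negP; rewrite negb_and -ltNge xh.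
have J0 : (0 < \int[mu]_(s in `[(h / 2)%R, h[) f s)%E.
  apply: (@integral_gt0_itv _ _ (h / 2) (3 * h / 4) h^-1) => //.
  - exact: measurable_funTS.
  - by move=> x _; rewrite lee_fin powR_ge0.
  - lra.
  - by rewrite invr_gt0.
  - by move=> x /=; rewrite !in_itv/= => /andP[-> ?]/=; lra.
  - by move=> x /andP[hx xh]; rewrite fE ?lee_fin ?lef_pV2 ?posrE//; lra.
apply/eqP; apply: contraT; rewrite -ltey => Ioo.
have I0 : (0 <= \int[mu]_(s in `]0%R, h[) f s)%E.
  by apply: integral_ge0 => x _; rewrite lee_fin powR_ge0.
have : (\int[mu]_(s in `]0%R, h[) f s < \int[mu]_(s in `]0%R, h[) f s)%E.
  by rewrite {2}split -E lteDl// ge0_fin_numE.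
by rewrite ltxx.
Qed.

End real_integrals.

Section gamma.
Context {R : realType}.
Local Notation mu := (@lebesgue_measure R).

Lemma gamma_fun_gt0 (z : R) : 1 <= z -> 0 < gamma_fun z.
Proof.
move=> z1; have z0 : 0 <= z - 1 by rewrite subr_ge0.
pose f (t : R) := t `^ (z - 1) * expR (- t).
have mf D : measurable_fun (D : set R) f.
  apply: measurable_funTS; apply: measurable_funM; first exact: measurable_powR.
  by apply: measurableT_comp => //; exact: measurable_funN.
have f0 t : 0 < t -> 0 <= f t by move=> t0; rewrite mulr_ge0 ?powR_ge0 ?expR_ge0.
rewrite /gamma_fun /Rintegral fine_gt0//; apply/andP; split.
  apply: (@integral_gt0_itv _ _ _ 1 2 (expR (- 2))) => //.
  - exact/measurable_EFinP.
  - by move=> t; rewrite /= in_itv/= andbT lee_fin; exact: f0.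
  - by rewrite ltr1n.
  - by move=> t /=; rewrite !in_itv/= => /andP[t1 _]; rewrite (lt_le_trans ltr01 t1).
  - move=> t /andP[t1 t2]; rewrite lee_fin -[leLHS]mul1r ler_pM ?expR_ge0//.
      have e1 : 1 `^ (z - 1) = 1 :> R by rewrite powR1.
      rewrite -[leLHS]e1; apply: ge0_ler_powR => //; rewrite nnegrE //.
      exact: le_trans ler01 t1.
    by rewrite ler_expR lerN2.
have [A A0 HA] := powR_expRN_bounded z0.
have [B B0 HB] := @powR_expRN_bounded _ (z - 1 + 2) (addr_ge0 z0 (ler0n _ 2)).
apply: (@integral_le_oneDsqr_fin _ _ (A + B)) => //; first by rewrite addr_ge0// ltW.
move=> t t0; rewrite mulrDr mulr1; apply: lerD; first by apply: HA; exact: ltW.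
rewrite mulrAC -(powR_mulrn 2 (ltW t0)) -powRD ?(gt_eqF t0) ?implybT//.
by apply: HB; exact: ltW.
Qed.

End gamma.

(** * An infinite expectation *)

Section tuple_integral.
Context {R : realType}.
Local Notation mu := (@lebesgue_measure R).

Lemma measurable_prod_tnth p (f : 'I_p -> R -> R) :
  (forall i, measurable_fun setT (f i)) ->
  measurable_fun setT (fun x : p.-tuple R => \prod_(i < p) f i (tnth x i)).
Proof.
move=> mf; apply: measurable_prod => i _.
by apply: (measurableT_comp (mf i)); exact: measurable_tnth.
Qed.

Lemma integral_lebesgue_tuple_prod p (f : 'I_p -> R -> R) :
  (forall i, measurable_fun setT (f i)) -> (forall i t, 0 <= f i t) ->
  (\int[lebesgue_tuple p]_x (\prod_(i < p) f i (tnth x i))%:E =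
   \prod_(i < p) \int[mu]_t (f i t)%:E)%E.
Proof.
elim: p f => [|p ih] f mf f0.
  rewrite big_ord0 /= integral_dirac//.
    by rewrite diracT big_ord0 mul1e.
  by apply/measurable_EFinP; exact: measurable_prod_tnth.
have mF := measurable_prod_tnth mf.
have F0 x : (0 <= (\prod_(i < p.+1) f i (tnth x i))%:E)%E.
  by rewrite lee_fin prodr_ge0.
have mc : measurable_fun setT (cons_pair : measurableTypeR R * p.-tuple R -> p.+1.-tuple R).
  exact: measurable_cons_pair.
transitivity (\int[(mu \x lebesgue_tuple p)%E]_z
    (\prod_(i < p.+1) f i (tnth (cons_pair z) i))%:E)%E.
  have := @ge0_integral_pushforward _ _ _ _ _ _ mc
    (mu \x lebesgue_tuple p)%E setT (fun x => (\prod_(i < p.+1) f i (tnth x i))%:E).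
  by rewrite preimage_setT; apply => //; exact/measurable_EFinP.
rewrite fubini_tonelli1//; last first.
  apply/measurable_EFinP; exact: (measurableT_comp mF mc).
rewrite /fubini_F big_ord_recl -ih//.
have mP := measurable_prod_tnth (fun i => mf (lift ord0 i)).
have P0 y : (0 <= (\prod_(i < p) f (lift ord0 i) (tnth y i))%:E)%E.
  by rewrite lee_fin prodr_ge0.
rewrite -ge0_integralZr//; last 3 first.
- by apply/measurable_EFinP; exact: mf.
- by move=> x _; rewrite lee_fin.
- exact: integral_ge0.
apply: eq_integral => x _; rewrite -ge0_integralZl ?lee_fin//; last first.
  by apply/measurable_EFinP.
apply: eq_integral => y _; rewrite /= big_ord_recl EFinM; congr (_ * _)%E.
congr EFin; apply: eq_bigr => i _; rewrite (tnth_nth 0) /= (tnth_nth 0)//.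
Qed.

End tuple_integral.

Section growth.
Context {R : realType}.
Local Notation mu := (@lebesgue_measure R).
Variables (p n : nat) (g : R -> R) (k w3 : R).
Hypotheses (p0 : (0 < p)%N) (n2 : (2 <= n)%N) (k0 : 0 < k).
Hypothesis gk : forall w : R, w3 <= w -> k * w `^ (d_n n)^-1 <= g w.

Let W0 : R := Num.max 1 w3.
Let h : R := W0^-1.
Let eta : R := normal_pdf 0 1 2.
Let K0 : R := 2 `^ (n%:R / 2) * gamma_fun (n%:R / 2).
Let C : R := k ^+ 2 * eta ^+ p * expR (- 2^-1) / K0.
Let theta0 : p.-tuple R := [tuple 0 | i < p].

Let W0_ge1 : 1 <= W0. Proof. by rewrite le_max lexx. Qed.

Let K0_gt0 : 0 < K0.
Proof.
rewrite mulr_gt0 ?powR_gt0//; apply: gamma_fun_gt0.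
by rewrite ler_pdivlMr// mul1r ler_nat.
Qed.

Let eta_gt0 : 0 < eta.
Proof.
by rewrite /eta normal_pdfE ?oner_neq0// mulr_gt0 ?expR_gt0// normal_peak_gt0// oner_neq0.
Qed.

Let C_gt0 : 0 < C.
Proof. by rewrite divr_gt0// !mulr_gt0 ?exprn_gt0 ?expR_gt0. Qed.

Let normal_ge t : 1 <= t <= 2 -> eta <= normal_pdf 0 1 t.
Proof.
move=> /andP[t1 t2]; rewrite /eta !normal_pdfE ?oner_neq0// ler_wpM2l ?normal_peak_ge0//.
have t2' : t ^+ 2 <= 2 ^+ 2 by rewrite ler_sqr ?nnegrE//; lra.
rewrite /normal_fun ler_expR !subr0 !mulNr lerN2 expr1n.
by apply: ler_wpM2r t2'; rewrite invr_ge0.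
Qed.

(** On a box of fixed positive measure the expectation dominates the integral of
    [C / s] near [s = 0]. *)
Let lower_bound (x : p.-tuple R) s : (forall i, 1 <= tnth x i <= 2) -> 0 < s -> s < h ->
  C * s^-1 <= g (Wstat x s) ^+ 2 / Wstat x s * sampling_pdf n theta0 1 x s.
Proof.
move=> xB s0 sh.
have W00 : 0 < W0 by exact: lt_le_trans W0_ge1.
have sW : W0 <= s^-1.
  by rewrite -[W0]invrK lef_pV2 ?posrE ?invr_gt0//; exact: ltW.
have s1 : 1 <= s^-1 by exact: le_trans sW.
pose W := Wstat x s.
have Ws : s^-1 <= W.
  rewrite /W /Wstat ler_peMl ?(le_trans ler01 s1)// /sqnorm (bigD1 (Ordinal p0))//=.
  have /andP[x1 _] := xB (Ordinal p0).
  apply: (@le_trans _ _ (tnth x (Ordinal p0) ^+ 2)); first by rewrite expr_ge1// (le_trans ler01).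
  by rewrite lerDl sumr_ge0// => i _; exact: sqr_ge0.
have W1 : 1 <= W by exact: le_trans Ws.
have Wp : 0 < W by exact: lt_le_trans W1.
have gW : k * W `^ (d_n n)^-1 <= g W.
  by apply: gk; apply: le_trans (le_trans sW Ws); rewrite le_max lexx orbT.
have dn : (d_n n : R)^-1 = (n%:R + 2) / 4 by rewrite /d_n invf_div.
have h1 : k ^+ 2 * s `^ (- (n%:R / 2)) <= g W ^+ 2 / W.
  rewrite ler_pdivlMr//; apply: (@le_trans _ _ ((k * W `^ (d_n n)^-1) ^+ 2)); last first.
    by rewrite ler_sqr ?nnegrE ?mulr_ge0 ?powR_ge0// ?(ltW k0)//; apply: le_trans gW; rewrite mulr_ge0 ?powR_ge0 ?(ltW k0).
  rewrite exprMn -mulrA ler_wpM2l ?sqr_ge0// -powR_mulrn ?powR_ge0// -powRrM.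
  rewrite (_ : (d_n n)^-1 * 2 = n%:R / 2 + 1); last by rewrite dn; field.
  rewrite powRD ?(gt_eqF Wp) ?implybT// powRr1 ?(ltW Wp)// ler_wpM2r ?(ltW Wp)//.
  rewrite powRN -powR_inv1 ?powR_ge0// -powRrM mulrC powRrM powR_inv1 ?(ltW s0)//.
  apply: ge0_ler_powR => //.
  - by rewrite nnegrE (le_trans ler01 s1).
  - by rewrite nnegrE ltW.
have h2 : eta ^+ p * (s `^ (n%:R / 2 - 1) * expR (- 2^-1) / K0) <= sampling_pdf n theta0 1 x s.
  rewrite /sampling_pdf divr1 sqrtr1.
  apply: ler_pM.
  - by rewrite exprn_ge0// ltW.
  - by rewrite !mulr_ge0 ?powR_ge0 ?expR_ge0// invr_ge0 ltW.
  - rewrite -[p in _ ^+ p]card_ord -prodr_const; apply: ler_prod => i _.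
    by rewrite (ltW eta_gt0)/= /theta0 tnth_mktuple normal_ge.
  - rewrite /chi2_pdf divr1 ler_wpM2r ?invr_ge0 ?(ltW K0_gt0)// ler_wpM2l ?powR_ge0//.
    rewrite ler_expR mulNr lerN2 ler_pdivrMr// mulVf//.
    by rewrite -(invrK s) invf_le1 ?invr_gt0.
apply: le_trans (ler_pM _ _ h1 h2); last 2 first.
- by rewrite mulr_ge0 ?sqr_ge0 ?powR_ge0.
- by rewrite !mulr_ge0 ?exprn_ge0 ?powR_ge0 ?expR_ge0 ?invr_ge0 ?(ltW eta_gt0) ?(ltW K0_gt0).
rewrite [leRHS](_ : _ = C * (s `^ (- (n%:R / 2)) * s `^ (n%:R / 2 - 1))); last first.
  by rewrite /C; ring.
rewrite -powRD ?(gt_eqF s0) ?implybT// (_ : - _ + _ = -1); last by ring.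
by rewrite powR_inv1 ?(ltW s0).
Qed.

(** The exponent is critical: with [theta = 0] and [v = 1], near [s = 0] the density of
    [s] is of order [s ^ (n/2 - 1)] and [g ^ 2 / W] at least of order [s ^ -(n/2)]. *)
Lemma growth_infinite_expectation :
  ~ finite_expectation n theta0 1 (fun w => g w ^+ 2 / w).
Proof.
rewrite /finite_expectation => /integrableP[_ Foo].
pose I12 (t : R) : R := \1_`[1, 2] t.
pose H (z : p.-tuple R * R) : \bar R :=
  ((\prod_(i < p) I12 (tnth z.1 i))%:E * ((fun s => (C * s `^ (-1))%:E) \_ `]0%R, h[) z.2)%E.
have mI : measurable_fun setT I12 by exact: measurable_indic.
have mS : measurable_fun setT ((fun s : R => (C * s `^ (-1))%:E) \_ `]0, h[).
  apply/(measurable_restrictT _ _).1 => //; apply/measurable_EFinP/measurable_funTS.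
  by apply: measurable_funM => //; exact: measurable_powR.
have S0 s : (0 <= ((fun s : R => (C * s `^ (-1))%:E) \_ `]0%R, h[) s)%E.
  by rewrite patchE; case: ifPn => // _; rewrite lee_fin mulr_ge0 ?powR_ge0// ltW.
have mH : measurable_fun setT H.
  apply: emeasurable_funM.
    by apply/measurable_EFinP; apply: (measurableT_comp (measurable_prod_tnth (fun=> mI))).
  exact: (measurableT_comp mS).
have H0 z : (0 <= H z)%E by rewrite mule_ge0// lee_fin prodr_ge0.
have h0 : 0 < h by rewrite invr_gt0; exact: lt_le_trans W0_ge1.
have : (\int[(lebesgue_tuple p \x mu)%E]_z H z = +oo)%E.
  rewrite fubini_tonelli1// /fubini_F.
  transitivity (\int[lebesgue_tuple p]_x ((\prod_(i < p) I12 (tnth x i))%:E * +oo))%E.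
    apply: eq_integral => x _; rewrite /H/= ge0_integralZl//; last first.
      by rewrite lee_fin prodr_ge0.
    congr (_ * _)%E; rewrite -integral_mkcond.
    under eq_integral do rewrite EFinM.
    rewrite ge0_integralZl//; last 3 first.
    - apply/measurable_EFinP/measurable_funTS; exact: measurable_powR.
    - by move=> s _; rewrite lee_fin powR_ge0.
    - by rewrite lee_fin ltW.
    transitivity (C%:E * \int[mu]_(s in `]0%R, h[) (s^-1)%:E)%E.
      congr (_ * _)%E; apply: eq_integral => s; rewrite inE/= in_itv/= => /andP[s0 _].
      by rewrite powR_inv1 ?ltW.
    by rewrite integral_inv_infty// gt0_muley.
  rewrite ge0_integralZr//; last 2 first.
  - by apply/measurable_EFinP; exact: (measurable_prod_tnth (fun=> mI)).
  - by move=> x _; rewrite lee_fin prodr_ge0.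
  rewrite (integral_lebesgue_tuple_prod (f := fun=> I12))//.
  under eq_bigr do rewrite integral_indic//= setIT lebesgue_measure_itv/= lte_fin ltr1n/= -EFinB.
  by rewrite prodEFin gt0_muley// lte_fin prodr_gt0// => i _; rewrite subr_gt0 ltr1n.
apply/eqP; rewrite -ltey//; apply: le_lt_trans Foo.
rewrite [leRHS]integral_mkcond; apply: ge0_le_integralW => //.
move=> [x s] _; rewrite /H/=.
have [/forallP xB|/forallPn[i xi]] := boolP [forall i : 'I_p, 1 <= tnth x i <= 2]; last first.
  rewrite (bigD1 i)//= /I12 indicE memNset ?mul0r ?mul0e ?patchE//.
    by case: ifPn.
  by rewrite /= in_itv/=; exact/negP.
have -> : \prod_(i < p) I12 (tnth x i) = 1.
  by apply: big1 => i _; rewrite /I12 indicE mem_set//= in_itv/=.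
rewrite mul1e !patchE; case: ifPn => [|_]; last first.
  by case: ifPn => _; [rewrite (_ : point = 0%E)|].
rewrite inE/= in_itv/= => /andP[s0 sh]; rewrite mem_set//= lee_fin powR_inv1 ?(ltW s0)//.
by apply: le_trans (ler_norm _); exact: lower_bound.
Qed.

End growth.

(** * Stieltjes transforms *)

Section stieltjes_transform.
Context {R : realType}.
Local Notation mu := (@lebesgue_measure R).
Variable K : R -> R.
Hypothesis mK : measurable_fun (`]0, 1[%classic : set R) K.
Hypothesis K0 : forall l, 0 < l < 1 -> 0 <= K l.
Hypothesis intK : (\int[mu]_(l in `]0%R, 1%R[) (K l)%:E < +oo)%E.
Hypothesis intK_gt0 : (0 < \int[mu]_(l in `]0%R, 1%R[) (K l)%:E)%E.

(** The generalized Stieltjes transforms of [K], with an additional power [l ^ k] so that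
    the family is stable under differentiation in [w]. *)
Definition stj_fun (k : nat) (s w l : R) : R := K l * l ^+ k * (1 + w * l) `^ (- s).

Definition stj (k : nat) (s w : R) : R := \int[mu]_(l in `]0, 1[) stj_fun k s w l.

Lemma measurable_stj_fun k s w : measurable_fun (`]0, 1[%classic : set R) (stj_fun k s w).
Proof.
apply: measurable_funM.
  by apply: measurable_funM => //; exact: measurable_funX.
apply: measurable_funTS.
apply: (@measurableT_comp _ _ _ _ _ _ (fun x : R => x `^ (- s))).
  exact: measurable_powR.
by apply: measurable_funD => //; exact: mulrl_measurable.
Qed.

Lemma stj_fun_ge0 k s w l : 0 <= w -> 0 < l < 1 -> 0 <= stj_fun k s w l.
Proof.
move=> w0 /andP[l0 l1]; rewrite /stj_fun !mulr_ge0 ?powR_ge0 ?exprn_ge0 ?(ltW l0)//.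
by apply: K0; rewrite l0.
Qed.

Lemma stj_fun_le k s w l : 0 <= s -> 0 <= w -> 0 < l < 1 -> stj_fun k s w l <= K l.
Proof.
move=> s0 w0 /andP[l0 l1]; rewrite /stj_fun -mulrA -[leRHS]mulr1 ler_wpM2l ?K0 ?l0//.
rewrite mulr_ile1 ?powR_ge0 ?exprn_ge0 ?exprn_ile1 ?(ltW l0) ?(ltW l1)//.
rewrite powRN invf_le1 ?powR_gt0//; last by rewrite ltr_wpDr// mulr_ge0// ltW.
by rewrite -[leLHS](powRr0 (1 + w * l)) ler_powR// lerDl mulr_ge0// ltW.
Qed.

Lemma integrable_kernel : mu.-integrable (`]0, 1[%classic : set R) (EFin \o K).
Proof.
apply/integrableP; split; first exact/measurable_EFinP.
apply: le_lt_trans intK; rewrite le_eqVlt; apply/orP; left; apply/eqP.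
by apply: eq_integral => l; rewrite inE/= in_itv/= => /K0 Kl; rewrite ger0_norm.
Qed.

Lemma integrable_stj_fun k s w : 0 <= s -> 0 <= w ->
  mu.-integrable (`]0, 1[%classic : set R) (EFin \o stj_fun k s w).
Proof.
move=> s0 w0; apply: (le_integrable _ _ _ integrable_kernel) => //.
  by apply/measurable_EFinP; exact: measurable_stj_fun.
move=> l; rewrite /= in_itv/= => l01; rewrite lee_fin.
by rewrite !ger0_norm ?stj_fun_ge0 ?K0// stj_fun_le.
Qed.

Lemma integral_stj k s w : 0 <= s -> 0 <= w ->
  (\int[mu]_(l in `]0%R, 1%R[) (stj_fun k s w l)%:E = (stj k s w)%:E)%E.
Proof.
move=> s0 w0; rewrite /stj /Rintegral fineK//.
exact: (integrable_fin_num _ (integrable_stj_fun _ _ _)).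
Qed.

Definition mass := stj 0 0 0.

Lemma massE : (mass%:E = \int[mu]_(l in `]0%R, 1%R[) (K l)%:E)%E.
Proof.
rewrite /mass -integral_stj//; apply: eq_integral => l _.
by rewrite /stj_fun oppr0 powRr0 expr0 !mulr1.
Qed.

Lemma mass_gt0 : 0 < mass. Proof. by rewrite -lte_fin massE. Qed.

Lemma stj_ge0 k s w : 0 <= w -> 0 <= stj k s w.
Proof.
move=> w0; apply: Rintegral_ge0 => l; rewrite /= in_itv/=.
exact: stj_fun_ge0.
Qed.

Lemma stj_le_mass k s w : 0 <= s -> 0 <= w -> stj k s w <= mass.
Proof.
move=> s0 w0; rewrite -lee_fin massE -integral_stj//; apply: ge0_le_integralW => //.
- by move=> l; rewrite /= in_itv/= lee_fin => ?; exact: stj_fun_ge0.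
- by move=> l; rewrite /= in_itv/= lee_fin => ?; exact: stj_fun_le.
Qed.

Lemma stj0_ge s w v : 0 <= s -> 0 <= w -> w <= v ->
  (1 + v) `^ (- s) * mass <= stj 0 s w.
Proof.
move=> s0 w0 wv; have v0 := le_trans w0 wv.
rewrite -lee_fin EFinM massE -ge0_integralZl//; last 2 first.
- exact/measurable_EFinP.
- by rewrite lee_fin powR_ge0.
rewrite -integral_stj//; apply: ge0_le_integralW => //.
- by move=> l; rewrite /= in_itv/= -EFinM lee_fin => /K0 Kl; rewrite mulr_ge0 ?powR_ge0.
move=> l; rewrite /= in_itv/= -EFinM lee_fin => l01; have Kl := K0 l01.
have /andP[l0 l1] := l01.
rewrite /stj_fun expr0 mulr1 mulrC ler_wpM2l// !powRN.
have wl0 : 0 <= w * l by rewrite mulr_ge0// ltW.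
rewrite lef_pV2 ?posrE ?powR_gt0 ?ltr_wpDr//; apply: ge0_ler_powR; rewrite ?nnegrE ?addr_ge0//.
by rewrite lerD2l; apply: le_trans wv; rewrite -[leRHS]mulr1 ler_wpM2l// ltW.
Qed.

Lemma stj0_gt0 s w : 0 <= s -> 0 <= w -> 0 < stj 0 s w.
Proof.
move=> s0 w0; apply: lt_le_trans (stj0_ge s0 w0 (lexx w)).
by rewrite mulr_gt0 ?mass_gt0// powR_gt0// ltr_wpDr.
Qed.

Lemma stj0_split s w : 0 <= s -> 0 <= w ->
  stj 0 s w = stj 0 (s + 1) w + w * stj 1 (s + 1) w.
Proof.
move=> s0 w0; have s1 : 0 <= s + 1 by rewrite addr_ge0.
rewrite /stj -RintegralZl//; last exact: integrable_stj_fun.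
rewrite -RintegralD//; last 2 first.
- exact: integrable_stj_fun.
- have m01 : measurable (`]0, 1[%classic : set (measurableTypeR R)) by exact: measurable_itv.
  by have := integrableZl m01 w (integrable_stj_fun 1 s1 w0); apply: eq_integrable.
apply: eq_Rintegral => l; rewrite inE/= in_itv/= => /andP[l0 l1].
have p0 : 0 < 1 + w * l by rewrite ltr_wpDr// mulr_ge0// ltW.
have pe : (1 + w * l) `^ (- s) = (1 + w * l) * (1 + w * l) `^ (- (s + 1)).
  rewrite -[X in _ = X * _](powRr1 (ltW p0)) -powRD ?(gt_eqF p0) ?implybT//.
  by congr (_ `^ _); ring.
by rewrite /stj_fun pe; ring.
Qed.

Lemma stj1_le s w : 0 <= s -> 0 <= w -> stj 1 s w <= stj 0 s w.
Proof.
move=> s0 w0; apply: le_Rintegral => //; [exact: integrable_stj_fun|exact: integrable_stj_fun|].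
move=> l; rewrite /= in_itv/= => l01; have /andP[l0 l1] := l01.
rewrite /stj_fun ler_wpM2r ?powR_ge0// ler_wpM2l ?K0//.
by rewrite expr0 expr1 ltW.
Qed.

Lemma is_derive_stj k (s w : R) : 0 <= s -> 0 < w ->
  is_derive w 1 (stj k s) (- s * stj k.+1 (s + 1) w).
Proof.
move=> s0 w0.
pose f := stj_fun k s.
have df (x l : R) : 0 < x -> 0 < l < 1 ->
    is_derive x 1 (f ^~ l) (- s * stj_fun k.+1 (s + 1) x l).
  move=> x0 /andP[l0 l1].
  have p0 : 0 < 1 + x * l by rewrite ltr_wpDr// mulr_ge0// ltW.
  have D1 := @is_derive1_powR R (- s) _ p0.
  have D2 : is_derive x 1 (fun y : R => 1 + y * l) l.
    by apply: is_derive_eq; rewrite /GRing.scale/=; ring.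
  have D3 : is_derive x 1 (fun y : R => (1 + y * l) `^ (- s)) (- s * (1 + x * l) `^ (- s - 1) * l).
    exact: (@is_derive1_comp _ (fun z : R => z `^ (- s))).
  rewrite /f /stj_fun; apply: is_derive_eq.
  by rewrite /GRing.scale/= opprD exprS; ring.
have w1 : `]0, (w + 1)[%classic w by rewrite /= in_itv/= w0 ltrDl ltr01.
have s1 : 0 <= s + 1 by rewrite addr_ge0.
have iG : mu.-integrable (`]0, 1[%classic : set R) (EFin \o (fun l => s * `|K l|)).
  have m01 : measurable (`]0, 1[%classic : set (measurableTypeR R)) by exact: measurable_itv.
  have := integrableZl m01 s (integrable_abse integrable_kernel).
  by apply: eq_integrable.
have G0 y : 0 <= s * `|K y| by rewrite mulr_ge0.
have intf (x : R) : `]0, (w + 1)[%classic x -> mu.-integrable (`]0, 1[%classic : set R) (EFin \o f x).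
  by rewrite /= in_itv/= => /andP[x0 _]; apply: integrable_stj_fun => //; exact: ltW.
have derf (x y : R) : `]0, (w + 1)[%classic x -> `]0, 1[%classic y -> derivable (f ^~ y) x 1.
  by rewrite /= !in_itv/= => /andP[x0 _] y01; have [] := df x y x0 y01.
have G_ub (x y : R) : `]0, (w + 1)[%classic x -> `]0, 1[%classic y ->
    `|partial1of2 f x y| <= s * `|K y|.
  rewrite /= !in_itv/= => /andP[x0 _] y01; rewrite partial1of2E.
  have [_ ->] := df x y x0 y01.
  rewrite normrM normrN (ger0_norm s0) ler_wpM2l// !ger0_norm ?K0 ?stj_fun_le ?(ltW x0)//.
  by rewrite stj_fun_ge0// ltW.
have m01 : measurable (`]0, 1[%classic : set (measurableTypeR R)) by exact: measurable_itv.
have d1 := derivable_under_integral m01 w1 intf derf G0 iG G_ub.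
have d2 := differentiation_under_integral m01 w1 intf derf G0 iG G_ub.
apply: DeriveDef; first exact: d1.
rewrite -derive1E [LHS]d2 /stj -RintegralZl//; last exact/integrable_stj_fun/ltW.
apply: eq_Rintegral => l; rewrite inE/= in_itv/= => l01.
by rewrite partial1of2E; have [_ ->] := df w l w0 l01.
Qed.

End stieltjes_transform.

(** * Quasi-admissibility of a ratio of Stieltjes transforms *)

Section quasi_admissible_stieltjes.
Context {R : realType}.
Local Notation mu := (@lebesgue_measure R).
Variables (p n : nat) (K : R -> R).
Implicit Types w u v s x l : R.
Hypotheses (p3 : (3 <= p)%N) (n2 : (2 <= n)%N).
Hypothesis mK : measurable_fun (`]0, 1[%classic : set R) K.
Hypothesis K0 : forall l, 0 < l < 1 -> 0 <= K l.
Hypothesis intK : (\int[mu]_(l in `]0%R, 1%R[) (K l)%:E < +oo)%E.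
Hypothesis intK_gt0 : (0 < \int[mu]_(l in `]0%R, 1%R[) (K l)%:E)%E.

Definition half_dim : R := (p%:R + n%:R) / 2.

Definition bayes_phi (w : R) : R :=
  w * stj K 1 (half_dim + 1) w / stj K 0 (half_dim + 1) w.

Definition int_factor (w : R) : R := w `^ (p%:R / 2 - 1) * stj K 0 half_dim w.

Local Notation q := half_dim.
Local Notation phi := bayes_phi.
Local Notation N := int_factor.
Let c : R := c_pn p n.
Let d : R := d_n n.

Let p_ge3 : 3 <= p%:R :> R. Proof. by rewrite (ler_nat R 3 p). Qed.
Let n_ge2 : 2 <= n%:R :> R. Proof. by rewrite (ler_nat R 2 n). Qed.

Let q_ge0 : 0 <= q. Proof. by rewrite divr_ge0// addr_ge0. Qed.
Let q1_ge0 : 0 <= q + 1. Proof. by rewrite addr_ge0. Qed.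

Let I0_gt0 w : 0 <= w -> 0 < stj K 0 (q + 1) w. Proof. exact: stj0_gt0. Qed.

Let I1_ge0 w : 0 <= w -> 0 <= stj K 1 (q + 1) w. Proof. exact: stj_ge0. Qed.

Lemma bayes_phi_ge0 w : 0 < w -> 0 <= phi w.
Proof.
move=> w0; apply: divr_ge0; last exact/ltW/I0_gt0/ltW.
by apply: mulr_ge0; [exact: ltW|exact/I1_ge0/ltW].
Qed.

Lemma bayes_phi_le w : 0 < w -> phi w <= w.
Proof.
move=> w0; rewrite /bayes_phi ler_pdivrMr ?I0_gt0 ?(ltW w0)// ler_wpM2l ?(ltW w0)//.
by apply: stj1_le => //; exact: ltW.
Qed.

Lemma onepD_bayes_phi w : 0 < w -> 1 + phi w = stj K 0 q w / stj K 0 (q + 1) w.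
Proof.
move=> w0; rewrite (stj0_split mK K0 intK q_ge0 (ltW w0)) /bayes_phi.
by field; rewrite gt_eqF// I0_gt0// ltW.
Qed.

Let D0 w : 0 < w -> is_derive w 1 (stj K 0 (q + 1)) (- (q + 1) * stj K 1 (q + 1 + 1) w).
Proof. exact: is_derive_stj. Qed.

Let D1 w : 0 < w -> is_derive w 1 (stj K 1 (q + 1)) (- (q + 1) * stj K 2 (q + 1 + 1) w).
Proof. exact: is_derive_stj. Qed.

Let phi_der w : 0 < w -> derivable phi w 1.
Proof.
move=> w0; have [d0 _] := D0 w0; have [d1 _] := D1 w0.
have I0n : stj K 0 (q + 1) w != 0 by rewrite gt_eqF// I0_gt0// ltW.
have dV := derivableV I0n d0; have dM := derivableM (@derivable_id _ _ w 1) d1.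
have := derivableM dM dV; exact.
Qed.

Let stj_ac k s u v : 0 <= s -> 0 < u -> u < v -> absolutely_continuous_on u v (stj K k s).
Proof.
move=> s0 u0 uv; apply: (@ac_derivable _ _ _ (s * mass K)) => x ux _.
  by have [] := is_derive_stj mK K0 intK k s0 (lt_le_trans u0 ux).
have x0 := lt_le_trans u0 ux; have [_ ->] := is_derive_stj mK K0 intK k s0 x0.
rewrite normrM normrN (ger0_norm s0) ler_wpM2l//.
rewrite ger0_norm ?stj_ge0 ?(ltW x0)//.
by apply: stj_le_mass => //; [exact: addr_ge0|exact: ltW].
Qed.

Let phi_ac u v : 0 < u -> u < v -> absolutely_continuous_on u v phi.
Proof.
move=> u0 uv; apply: ac_mul => //.
  apply: ac_mul => //; last exact: stj_ac.
  by apply: (@ac_lipschitz _ _ _ 1) => // x y _ xy _; rewrite mul1r ger0_norm ?subr_ge0.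
apply: (@ac_inv _ _ _ ((1 + v) `^ (- (q + 1)) * mass K)).
- rewrite mulr_gt0 ?powR_gt0 ?mass_gt0//.
  by rewrite ltr_wpDr// (le_trans (ltW u0) (ltW uv)).
- by move=> x ux xv; apply: stj0_ge => //; exact: le_trans (ltW u0) ux.
- exact: stj_ac.
Qed.

Let N_gt0 w : 0 < w -> 0 < N w.
Proof. by move=> w0; rewrite /int_factor mulr_gt0 ?powR_gt0// stj0_gt0// ltW. Qed.

Let N_ac u v : 0 < u -> u < v -> absolutely_continuous_on u v N.
Proof. by move=> u0 uv; apply: ac_mul => //; [exact: ac_powR|exact: stj_ac]. Qed.

(** The logarithmic derivative of [stj K 0 q] is [- q I1 / m], and [w I1 = m - I0] by
    [stj0_split]; hence it is a function of [phi = m / I0 - 1] only. *)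
Let N_der (w : R) : 0 < w ->
  is_derive w 1 N (N w * (- (2 / (d * w)) * ((phi w - c) / (1 + phi w)))).
Proof.
move=> w0; have w0' := ltW w0.
have Dp := @is_derive1_powR R (p%:R / 2 - 1) _ w0.
have Ds := is_derive_stj mK K0 intK 0 q_ge0 w0.
rewrite /int_factor; apply: is_derive_eq; rewrite /GRing.scale/=.
have I0 := I0_gt0 w0'.
have m0 : 0 < stj K 0 q w by exact: stj0_gt0.
have p1 : 1 + phi w != 0 by rewrite gt_eqF// ltr_pwDl// bayes_phi_ge0.
rewrite onepD_bayes_phi//.
have -> : phi w = stj K 0 q w / stj K 0 (q + 1) w - 1.
  by rewrite -onepD_bayes_phi//; ring.
have pw : w `^ (p%:R / 2 - 1) = w * w `^ (p%:R / 2 - 1 - 1).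
  rewrite -[X in _ = X * _](powRr1 w0') -powRD ?(gt_eqF w0) ?implybT//.
  by congr (_ `^ _); ring.
have mE : w * stj K 1 (q + 1) w = stj K 0 q w - stj K 0 (q + 1) w.
  by rewrite (stj0_split mK K0 intK q_ge0 w0'); ring.
rewrite pw; move: m0 I0 mE; move: (stj K 0 q w) (stj K 0 (q + 1) w) (stj K 1 (q + 1) w) (w `^ _).
move=> m J0 J1 A m0 J00 mE.
have -> : J1 = (m - J0) / w by rewrite -mE mulrC mulKf// gt_eqF.
have n0 : 0 < n%:R + 2 :> R by rewrite ltr_wpDl.
by rewrite /half_dim /c /d /c_pn /d_n; field; rewrite !gt_eqF.
Qed.

Let N_cvg0 e : 0 < e -> exists2 h, 0 < h & forall w, 0 < w -> w < h -> N w <= e.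
Proof.
move=> e0; pose r : R := p%:R / 2 - 1; have r0 : 0 < r by rewrite /r; have := p_ge3; lra.
have M0 := mass_gt0 mK K0 intK intK_gt0.
exists ((e / mass K) `^ r^-1); first by rewrite powR_gt0// divr_gt0.
move=> w w0 wh; rewrite /int_factor -/r -[leRHS](divfK (lt0r_neq0 M0)).
apply: ler_pM; first exact: powR_ge0.
- by apply: stj_ge0 => //; exact: ltW.
- have := ge0_ler_powR (ltW r0) _ _ (ltW wh); rewrite !nnegrE powR_ge0 (ltW w0) -powRrM.
  by rewrite mulVf ?gt_eqF// powRr1 ?divr_ge0 ?(ltW e0) ?(ltW M0)//; apply.
- by apply: stj_le_mass => //; exact: ltW.
Qed.

(** Each alternative on the growth at infinity of the integrating factor excludes that
    a nonzero [g] stays bounded. *)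
Lemma stieltjes_quasi_admissible :
  (forall e : R, 0 < e -> exists w0, forall w : R, w0 <= w -> N w <= e) \/
  (exists2 M, 0 < M & forall w : R, 1 <= w -> phi w <= M /\ N w <= M * (1 + ln w)) ->
  quasi_admissible_fun p n phi.
Proof.
move=> alt g [g_ac g_exp] Hg.
have n0 : 0 < n%:R + 2 :> R by rewrite ltr_wpDl.
have c_ge0 : 0 <= c by rewrite divr_ge0 ?(ltW n0)// subr_ge0; have := p_ge3; lra.
have d_gt0 : 0 < d by rewrite divr_gt0.
have d_le1 : d <= 1 by rewrite ler_pdivrMr// mul1r; have := n_ge2; lra.
have ineq : {ae mu, forall w, 0 < w -> derivable g w 1 ->
    2 / w * (g w * (1 + phi w + g w / 2) - (1 + c) * g w) <=
    d * ('D_1 g w * (1 + phi w + g w) + 'D_1 phi w * g w)}.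
  apply: filterS Hg; first exact: (ae_filter_ringOfSetsType mu).
  move=> w H w0 gw; have phiw := phi_der w0; have {H} := H w0 phiw gw.
  rewrite /Delta /D !derive1E deriveD// -/c -/d => H.
  rewrite -subr_ge0; apply: (le_trans H); rewrite le_eqVlt; apply/orP; left; apply/eqP.
  by rewrite /=; field; rewrite gt_eqF.
have [//|[k [w3 [k0 Hk]]]] := @ineq_zero_or_growth R c d phi N g c_ge0 d_gt0 d_le1
  bayes_phi_ge0 bayes_phi_le phi_der phi_ac N_gt0 N_der N_ac N_cvg0 g_ac ineq alt.
exfalso; have p0 : (0 < p)%N by exact: leq_trans p3.
have [+ _ _ _] := g_exp [tuple 0 | i < p] 1 ltr01.
exact: (growth_infinite_expectation p0 n2 k0 Hk).
Qed.

End quasi_admissible_stieltjes.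

(** * Slowly varying kernels *)

Section power_integral.
Context {R : realType}.
Local Notation mu := (@lebesgue_measure R).
Implicit Types l r e x : R.

Lemma integral_powR_itv r e : 0 < r -> 0 < e -> e < 1 ->
  (\int[mu]_(l in `[e, 1%R]) (l `^ (r - 1))%:E <= (r^-1)%:E)%E.
Proof.
move=> r0 e0 e1; pose F l : R := r^-1 * l `^ r.
have dF l : 0 < l -> is_derive l 1 F (l `^ (r - 1)).
  move=> l0; have Dp := @is_derive1_powR R r _ l0; apply: is_derive_eq.
  by rewrite /GRing.scale/= mulrA mulVf ?gt_eqF// mul1r.
have cF l : 0 < l -> {for l, continuous F}.
  by move=> l0; apply/differentiable_continuous/derivable1_diffP; have [] := dF l l0.
have cp l : 0 < l -> {for l, continuous (fun x : R => x `^ (r - 1))}.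
  move=> l0; apply/differentiable_continuous/derivable1_diffP.
  by have [] := @is_derive1_powR R (r - 1) _ l0.
rewrite (@continuous_FTC2 _ (fun l => l `^ (r - 1)) F e 1)//.
- rewrite -EFinB lee_fin /F powR1 mulr1 gerBl mulr_ge0 ?powR_ge0// invr_ge0 ltW//.
- apply: continuous_in_subspaceT => l; rewrite inE/= in_itv/= => /andP[el _].
  exact/cp/(lt_le_trans e0).
- split.
  + by move=> l; rewrite in_itv/= => /andP[el _]; have [] := dF l (lt_trans e0 el).
  + exact/cvg_at_right_filter/cF.
  + exact/cvg_at_left_filter/cF.
- move=> l; rewrite in_itv/= => /andP[el _].
  by rewrite derive1E; have [_ ->] := dF l (lt_trans e0 el).
Qed.

Lemma integral_powR_fin r : 0 < r ->
  (\int[mu]_(l in `]0%R, 1%R[) (l `^ (r - 1))%:E < +oo)%E.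
Proof.
move=> r0; pose F n : set R := `[n.+2%:R^-1, 1]%classic.
have F0 n l : F n l -> 0 < l.
  by rewrite /F/= in_itv/= => /andP[+ _]; apply: lt_le_trans; rewrite invr_gt0.
have mf (D : set R) : measurable_fun D (fun l => (l `^ (r - 1))%:E).
  by apply/measurable_EFinP/measurable_funTS; exact: measurable_powR.
have ndF : nondecreasing_seq F.
  apply/nondecreasing_seqP => n; apply/subsetPset => l.
  rewrite /F/= !in_itv/= => /andP[nl ->]; rewrite andbT; apply: le_trans nl.
  by rewrite lef_pV2 ?posrE// ler_nat.
have mF n : measurable (F n : set (measurableTypeR R)) by exact: measurable_itv.
have mUF : measurable (\bigcup_n F n : set (measurableTypeR R)) by exact: bigcupT_measurable.
apply: (@le_lt_trans _ _ (\int[mu]_(l in \bigcup_n F n) (l `^ (r - 1))%:E)%E).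
  apply: ge0_subset_integral => //.
  - exact: mf.
  - by move=> l _; rewrite lee_fin powR_ge0.
  - move=> l; rewrite /= in_itv/= => /andP[l0 l1].
    exists (Num.truncn l^-1) => //; rewrite /F/= in_itv/= (ltW l1) andbT.
    rewrite -[leRHS]invrK lef_pV2 ?posrE ?invr_gt0//.
    by apply: le_trans (ltW (truncnS_gt _)) _; rewrite ler_nat.
have cv : (\int[mu]_(l in F n) (l `^ (r - 1))%:E)%E @[n --> \oo] -->
    (\int[mu]_(l in \bigcup_n F n) (l `^ (r - 1))%:E)%E.
  apply: ge0_nondecreasing_set_cvg_integral => //; first by move=> n; exact: mf.
  by move=> n l _; rewrite lee_fin powR_ge0.
rewrite -(cvg_lim _ cv)//; apply: (@le_lt_trans _ _ (r^-1)%:E); last by rewrite ltry.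
apply: lime_le; first by apply/cvg_ex; eexists; exact: cv.
apply: nearW => n; apply: integral_powR_itv => //; rewrite ?invr_gt0//.
by rewrite invf_lt1// ltr1n.
Qed.

Definition powR_mass r : R := \int[mu]_(l in `]0, 1[) (l `^ (r - 1)).

Lemma powR_massE r : 0 < r ->
  (\int[mu]_(l in `]0%R, 1%R[) (l `^ (r - 1))%:E = (powR_mass r)%:E)%E.
Proof.
move=> r0; rewrite /powR_mass /Rintegral fineK// ge0_fin_numE ?integral_powR_fin//.
by apply: integral_ge0 => l _; rewrite lee_fin powR_ge0.
Qed.

End power_integral.

Section slowly_varying_kernel.
Context {R : realType}.
Local Notation mu := (@lebesgue_measure R).
Implicit Types c e l r u v w x y : R.
Variable L : R -> R.
Hypothesis L_ge0 : forall y, 1 <= y -> 0 <= L y.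
Hypothesis L_slow : slowly_varying L.
Hypothesis L_der : exists dL, derivative_on_ge1 L dL.

(** [L] is only given on [1, +oo); this extension is continuous everywhere. *)
Definition ext1 y : R := L (Num.max 1 y).

Lemma ext1E y : 1 <= y -> ext1 y = L y.
Proof. by move=> y1; rewrite /ext1 (max_idPr y1). Qed.

Lemma ext1_ge0 y : 0 <= ext1 y.
Proof. by apply: L_ge0; rewrite le_max lexx. Qed.

Lemma continuous_ext1 : continuous ext1.
Proof.
have [dL HL] := L_der; move=> x; pose y := Num.max 1 x.
have y1 : 1 <= y by rewrite le_max lexx.
have /cvgrPdist_lt/(_ 1 ltr01) := HL y y1.
rewrite near_withinE => -[d /= d0 Hd].
apply/cvgrPdist_lt => e e0.
have k0 : 0 < `|dL y| + 1 by rewrite ltr_wpDl.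
near=> z.
have xz : `|x - z| < Num.min d (e / (`|dL y| + 1)).
  by near: z; apply: cvgr_dist_lt => //; rewrite lt_min d0 divr_gt0.
have {xz} [xzd xze] : `|x - z| < d /\ `|x - z| < e / (`|dL y| + 1).
  by move: xz; rewrite lt_min => /andP.
rewrite /ext1 -/y; set t := Num.max 1 z.
have t1 : 1 <= t by rewrite le_max lexx.
have yt : `|y - t| <= `|x - z|.
  rewrite /y /t /Num.max; case: ifPn => h1; case: ifPn => h2; rewrite -?leNgt in h1 h2.
  - by [].
  - by rewrite !ger0_norm ?subr_ge0//; lra.
  - by rewrite distrC [leRHS]distrC !ger0_norm ?subr_ge0//; lra.
  - by rewrite subrr normr0.
have [->|ty] := eqVneq t y; first by rewrite subrr normr0.
have := Hd t; rewrite /ball/= => /(_ (le_lt_trans yt xzd) ty t1) H.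
have ty0 : 0 < `|t - y| by rewrite normr_gt0 subr_eq0.
have : `|(L t - L y) / (t - y)| < `|dL y| + 1.
  rewrite -[X in `|X|](subrK (dL y)) addrC; apply: le_lt_trans (ler_normD _ _) _.
  by rewrite ltrD2l distrC.
rewrite normf_div ltr_pdivrMr// distrC => /lt_trans; apply.
by rewrite -ltr_pdivlMl// mulrC; apply: le_lt_trans xze; rewrite distrC.
Unshelve. all: by end_near. Qed.

(** Positivity is part of the conclusion: a zero of [L] would make the quotient 0. *)
Lemma slowly_varying_le c r : 0 < c -> 1 < r ->
  exists2 y0, 1 <= y0 & forall y, y0 <= y -> 0 < L y /\ L (c * y) <= r * L y.
Proof.
move=> c0 r1; pose e := Num.min (r - 1) 2^-1.
have e0 : 0 < e by rewrite lt_min subr_gt0 r1/= invr_gt0.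
have /cvgrPdist_lt/(_ e e0)[M [Mr HM]] := L_slow c0.
exists (Num.max 1 (M + 1)); first by rewrite le_max lexx.
move=> y; rewrite ge_max => /andP[y1 yM].
have {HM} H := HM y (lt_le_trans (ltr_pwDr ltr01 (lexx M)) yM).
have Ly0 : L y != 0.
  apply/eqP => Ly; move: H; rewrite Ly invr0 mulr0 subr0 normr1 lt_min => /andP[_].
  by rewrite invf_gt1// ltNge ler1n.
have Ly : 0 < L y by rewrite lt_def Ly0 L_ge0.
split => //; rewrite -ler_pdivrMr//.
have : `|1 - L (c * y) / L y| < r - 1 by apply: lt_le_trans H _; rewrite ge_min lexx.
by rewrite ltr_distlC => /andP[_ ?]; lra.
Qed.

Lemma ge1_bounded b : 1 <= b -> exists2 B, 0 < B & forall y, 1 <= y -> y <= b -> L y <= B.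
Proof.
move=> b1; have cL : {within `[1, b], continuous ext1}.
  by apply: continuous_subspaceT; exact: continuous_ext1.
have [u _ Hu] := EVT_max b1 cL; exists (ext1 u + 1); first by rewrite ltr_wpDl// ext1_ge0.
move=> y y1 yb; rewrite -ext1E//; apply: le_trans (Hu y _) _; first by rewrite in_itv/= y1.
by rewrite lerDl.
Qed.

(** A slowly varying function grows more slowly than any power: doubling the
    argument multiplies it by at most [2 `^ e] eventually. *)
Lemma slowly_varying_powR e : 0 < e ->
  exists2 C, 0 < C & forall y, 1 <= y -> L y <= C * y `^ e.
Proof.
move=> e0; have r1 : 1 < 2 `^ e.
  have e1 : 1 `^ e = 1 :> R by rewrite powR1.
  by rewrite -[ltLHS]e1; apply: gt0_ltr_powR; rewrite ?nnegrE ?ltr1n.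
have [y0 y01 H] := slowly_varying_le (ltr0n R 2) r1.
have b1 : 1 <= 2 * y0 by lra.
have [B B0 HB] := ge1_bounded b1; exists B => // y y1.
have ye u : 1 <= u -> 1 <= u `^ e.
  by move=> u1; rewrite -[leLHS](powRr0 u) ler_powR// ltW.
suff S k u : 1 <= u -> u <= 2 ^+ k * (2 * y0) -> L u <= B * u `^ e.
  pose k := (Num.truncn y).+1; apply: (S k) => //.
  have yk : y <= k%:R by exact/ltW/truncnS_gt.
  apply: (le_trans yk); apply: (@le_trans _ _ (2 ^+ k)).
    by rewrite -natrX ler_nat ltnW// ltn_expl.
  by rewrite ler_peMr// exprn_ge0.
elim: k u => [|k ih] u u1.
  rewrite expr0 mul1r => uy; apply: le_trans (HB u u1 uy) _.
  by rewrite ler_peMr ?ye// ltW.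
move=> uk; have [uy|uy] := leP u (2 * y0).
  by apply: le_trans (HB u u1 uy) _; rewrite ler_peMr ?ye// ltW.
have u2 : y0 <= u / 2 by lra.
have u21 : 1 <= u / 2 by exact: le_trans u2.
have [_] := H _ u2; rewrite (_ : 2 * (u / 2) = u); last by field.
move=> /le_trans; apply.
have {}ih : L (u / 2) <= B * (u / 2) `^ e.
  apply: ih => //; rewrite ler_pdivrMr//; apply: le_trans uk _.
  by rewrite exprS le_eqVlt; apply/orP; left; apply/eqP; ring.
apply: (@le_trans _ _ (2 `^ e * (B * (u / 2) `^ e))).
  by rewrite ler_wpM2l// powR_ge0.
rewrite mulrCA -powRM//; last by apply: le_trans u21.
by rewrite (_ : 2 * (u / 2) = u)//; field.
Qed.

Variable al : R.
Hypothesis al_gtN1 : -1 < al.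

Definition kern l : R := l `^ al * ext1 l^-1.

Lemma kernE l : 0 < l < 1 -> kern l = l `^ al * L l^-1.
Proof. by move=> /andP[l0 l1]; rewrite /kern ext1E// invf_ge1// ltW. Qed.

Lemma kern_ge0 l : 0 < l < 1 -> 0 <= kern l.
Proof. by move=> _; rewrite mulr_ge0 ?powR_ge0 ?ext1_ge0. Qed.

Lemma continuous_kern l : 0 < l -> {for l, continuous kern}.
Proof.
move=> l0; apply: continuousM.
  apply/differentiable_continuous/derivable1_diffP.
  by have [] := @is_derive1_powR R al _ l0.
apply: continuous_comp; last exact: continuous_ext1.
by apply: inv_continuous; rewrite gt_eqF.
Qed.

Lemma measurable_kern : measurable_fun (`]0, 1[%classic : set R) kern.
Proof.
apply: open_continuous_measurable_fun; first exact: interval_open.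
by move=> l; rewrite inE/= in_itv/= => /andP[l0 _]; exact: continuous_kern.
Qed.

Lemma kern_le e : 0 < e ->
  exists2 C, 0 < C & forall l, 0 < l < 1 -> kern l <= C * l `^ (al - e).
Proof.
move=> e0; have [C C0 HC] := slowly_varying_powR e0; exists C => // l l01.
have /andP[l0 l1] := l01.
rewrite kernE// powRB ?(gt_eqF l0) ?implybT// mulrCA ler_wpM2l ?powR_ge0//.
rewrite -powRN; apply: le_trans (HC _ _) _; first by rewrite invf_ge1// ltW.
by rewrite powRN -powR_inv1 ?(ltW l0)// -powRrM mulN1r powRN.
Qed.

Lemma kern_fin : (\int[mu]_(l in `]0%R, 1%R[) (kern l)%:E < +oo)%E.
Proof.
have e0 : 0 < (al + 1) / 2 by have := al_gtN1; lra.
have [C C0 HC] := kern_le e0.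
apply: (@le_lt_trans _ _ (C%:E * \int[mu]_(l in `]0%R, 1%R[) (l `^ ((al + 1) / 2 - 1))%:E)%E).
  rewrite -ge0_integralZl//; last 3 first.
  - by apply/measurable_EFinP/measurable_funTS; exact: measurable_powR.
  - by move=> l _; rewrite lee_fin powR_ge0.
  - by rewrite lee_fin ltW.
  apply: ge0_le_integralW => //.
  - by move=> l; rewrite /= in_itv/= lee_fin; exact: kern_ge0.
  - move=> l; rewrite /= in_itv/= => /HC; rewrite -EFinM lee_fin.
    by rewrite (_ : (al + 1) / 2 - 1 = al - (al + 1) / 2); last by field.
by rewrite powR_massE// -EFinM ltry.
Qed.

(** Arbitrarily large arguments of [L], at which it is positive, correspond to small
    values of [l]. *)
Lemma kern_gt0 t : 0 < t -> t <= 1 ->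
  (0 < \int[mu]_(l in `]0%R, t[) (kern l)%:E)%E.
Proof.
move=> t0 t1; have [y0 y01 H] := slowly_varying_le ltr01 (ltr1n R 2).
pose y := y0 + t^-1; have ti0 : 0 < t^-1 by rewrite invr_gt0.
have yy0 : y0 < y by rewrite ltrDl.
pose u : R := (2 * y)^-1; pose v : R := y^-1.
have y_gt0 : 0 < y by exact: lt_trans (lt_le_trans ltr01 y01) yy0.
have u0 : 0 < u by rewrite invr_gt0 mulr_gt0.
have uv : u < v by rewrite ltf_pV2 ?posrE ?mulr_gt0//; lra.
have vt : v < t by rewrite -[t]invrK ltf_pV2 ?posrE// /y ltr_pwDl// (lt_le_trans ltr01).
have ck : {within `[u, v], continuous kern}.
  apply: continuous_in_subspaceT => l; rewrite inE/= in_itv/= => /andP[ul _].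
  exact/continuous_kern/(lt_le_trans u0).
have [m muv Hm] := EVT_min (ltW uv) ck.
have : 0 < kern m.
  move: muv; rewrite in_itv/= => /andP[um mv].
  have m0 := lt_le_trans u0 um.
  rewrite kernE ?m0 ?(lt_le_trans (le_lt_trans mv vt))// mulr_gt0 ?powR_gt0//.
  have : y0 <= m^-1.
    apply: (@le_trans _ _ v^-1); first by rewrite invrK ltW.
    by rewrite lef_pV2 ?posrE//; exact: lt_trans uv.
  by move=> /H[].
have sub : `]0, t[ `<=` `]0, 1[.
  by move=> l; rewrite /= !in_itv/= => /andP[-> lt]; exact: lt_le_trans lt t1.
move=> km; apply: (@integral_gt0_itv _ _ _ u v (kern m)) => //.
- by apply/measurable_EFinP; apply: measurable_funS measurable_kern.
- by move=> l /sub; rewrite /= in_itv/= lee_fin; exact: kern_ge0.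
- move=> l; rewrite /= !in_itv/= => /andP[ul lv].
  by rewrite (lt_le_trans u0 ul) (le_lt_trans lv vt).
Qed.

End slowly_varying_kernel.

(** * The integrating factor for a > -2 *)

Section growth_of_int_factor.
Context {R : realType}.
Local Notation mu := (@lebesgue_measure R).
Implicit Types c e l r s t u v w x y : R.

Lemma powRN_le_powRN q s x : 0 <= s -> s <= q -> 0 < x -> (1 + x) `^ (- q) <= x `^ (- s).
Proof.
move=> s0 sq x0; have x1 : 1 <= 1 + x by rewrite lerDl ltW.
apply: (@le_trans _ _ ((1 + x) `^ (- s))); first by rewrite ler_powR// lerN2.
rewrite !powRN lef_pV2 ?posrE ?powR_gt0 ?(lt_le_trans ltr01 x1)//.
by apply: ge0_ler_powR => //; rewrite ?nnegrE ?(le_trans ler01 x1) ?(ltW x0)// lerDr.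
Qed.

(** For large [x] the quotient [(1 + 2 x) / (1 + x)] is close to 2, and its power
    [-q] is less than [2 ^ -g]. For bounded [x] the two sides are compared through
    [(1 + x) ^ -q <= C (1 + x) ^ -(q + 1)]. *)
Lemma powR_onepD_split g q : 0 < g -> g < q -> exists2 C, 0 < C & forall x, 0 <= x ->
  (1 + 2 * x) `^ (- q) <= 2 `^ (- g) * (1 + x) `^ (- q) + C * (1 + x) `^ (- (q + 1)).
Proof.
move=> g0 gq; have q0 : 0 < q by exact: lt_trans gq.
pose s := g / q; have s1 : s < 1 by rewrite ltr_pdivrMr// mul1r.
have s0 : 0 < s by rewrite divr_gt0.
have a2 : 2 `^ s < 2.
  rewrite lt_neqAle ler1_powR ?(ltW s1) ?ler1n// andbT.
  apply/eqP => /(congr1 (@ln R)); rewrite ln_powR => /eqP.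
  rewrite -subr_eq0 -{2}[ln 2]mul1r -mulrBl mulf_eq0 subr_eq0 (lt_eqF s1)/=.
  by rewrite gt_eqF// ln_gt0// ltr1n.
pose x0 := (2 - 2 `^ s)^-1; have x00 : 0 < x0 by rewrite invr_gt0 subr_gt0.
exists (1 + x0); first by rewrite ltr_wpDl.
move=> x x_ge0; have p1 : 0 < 1 + x by rewrite ltr_wpDr.
have p2 : 0 < 1 + 2 * x by rewrite ltr_wpDr// mulr_ge0.
have [xx0|xx0] := leP x0 x.
  rewrite ler_wpDr ?mulr_ge0 ?powR_ge0 ?addr_ge0 ?(ltW x00)//.
  rewrite (_ : - g = s * - q); last by rewrite /s mulrN divfK// gt_eqF.
  rewrite powRrM -powRM ?powR_ge0 ?(ltW p1)// !powRN lef_pV2 ?posrE ?powR_gt0 ?mulr_gt0 ?powR_gt0//.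
  apply: ge0_ler_powR; rewrite ?nnegrE ?mulr_ge0 ?powR_ge0 ?(ltW p1) ?(ltW p2) ?(ltW q0)//.
  have : 1 <= (2 - 2 `^ s) * x by rewrite -ler_pdivrMl ?subr_gt0// mulr1.
  lra.
rewrite ler_wpDl ?mulr_ge0 ?powR_ge0//.
apply: (@le_trans _ _ ((1 + x) `^ (- q))).
  rewrite !powRN lef_pV2 ?posrE ?powR_gt0//.
  by apply: ge0_ler_powR; rewrite ?nnegrE ?(ltW p1) ?(ltW p2) ?(ltW q0)//; lra.
rewrite (_ : (1 + x) `^ (- q) = (1 + x) * (1 + x) `^ (- (q + 1))).
  by rewrite ler_wpM2r ?powR_ge0// lerD2l ltW.
rewrite -[X in _ = X * _](powRr1 (ltW p1)) -powRD ?(gt_eqF p1) ?implybT//.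
by congr (_ `^ _); ring.
Qed.

Lemma integral_powR_onepD_fin r q : 0 < r -> r + 1 <= q ->
  (\int[mu]_(x in `]0%R, +oo[) (x `^ (r - 1) * (1 + x) `^ (- q))%:E < +oo)%E.
Proof.
move=> r0 rq; pose f x := x `^ (r - 1) * (1 + x) `^ (- q).
have q0 : 0 < q by apply: lt_le_trans rq; rewrite ltr_wpDl// ltW.
have mf : measurable_fun (setT : set R) f.
  apply: measurable_funM; first exact: measurable_powR.
  apply: (@measurableT_comp _ _ _ _ _ _ (fun x : R => x `^ (- q))).
    exact: measurable_powR.
  exact: measurable_funD.
have f0 x : 0 <= f x by rewrite mulr_ge0 ?powR_ge0.
have E01 : (\int[mu]_(x in `]0%R, 1%R[) (f x)%:E < +oo)%E.
  apply: le_lt_trans (integral_powR_fin r0); apply: ge0_le_integralW => //.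
  - by move=> x _; rewrite lee_fin.
  - move=> x; rewrite /= in_itv/= => /andP[x0 _]; rewrite lee_fin /f -[leRHS]mulr1.
    rewrite ler_wpM2l ?powR_ge0// -[leRHS](powRr0 (1 + x)).
    by rewrite ler_powR ?oppr_le0 ?(ltW q0)// lerDl ltW.
pose g x := if x < 1 then 0 else f x.
have g0 x : 0 <= g x by rewrite /g; case: ifPn.
have mg : measurable_fun (setT : set R) g.
  by apply: measurable_fun_ifT => //; exact: measurable_fun_ltr.
have Eg : (\int[mu]_(x in `]0%R, +oo[) (g x)%:E < +oo)%E.
  apply: (@integral_le_oneDsqr_fin _ _ 2) => //.
  move=> x x0; rewrite /g; case: ifPn; first by rewrite mul0r.
  rewrite -leNgt => x1; rewrite /f.
  apply: (@le_trans _ _ (x `^ (r - 1) * x `^ (- q) * (2 * x ^+ 2))).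
    apply: ler_pM; rewrite ?mulr_ge0 ?powR_ge0 ?addr_ge0 ?sqr_ge0//.
      by rewrite ler_wpM2l ?powR_ge0// powRN_le_powRN// ltW.
    have : 1 <= x ^+ 2 by rewrite expr_ge1// ltW.
    lra.
  rewrite mulrCA -powR_mulrn ?(ltW x0)// -!powRD ?(gt_eqF x0) ?implybT//.
  rewrite -[leRHS]mulr1 ler_wpM2l//.
  apply: (@le_trans _ _ (x `^ 0)); last by rewrite powRr0.
  by rewrite ler_powR//; lra.
rewrite (@itv_bndbnd_setU _ _ _ (BLeft 1))//; last by rewrite bnd_simp.
rewrite ge0_integral_setU//; last 3 first.
- by apply/measurable_EFinP; exact: measurable_funTS.
- by move=> x _; rewrite lee_fin f0.
- by apply/disj_setPLR => x/=; rewrite !in_itv/= => /andP[_ x1]; apply/negP; rewrite andbT -ltNge.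
rewrite lte_add_pinfty//; apply: le_lt_trans Eg.
apply: (@le_trans _ _ (\int[mu]_(x in `[1%R, +oo[) (g x)%:E)%E).
  rewrite le_eqVlt; apply/orP; left; apply/eqP; apply: eq_integral => x.
  by rewrite inE/= in_itv/= andbT /g => x1; rewrite ltNge x1.
apply: ge0_subset_integral => //.
- by apply/measurable_EFinP; exact: measurable_funTS.
- by move=> x _; rewrite lee_fin.
- by move=> x; rewrite /= !in_itv/= !andbT; exact: lt_le_trans.
Qed.

Section asymptotics.
Variables (p n : nat) (L : R -> R) (a : R).
Hypotheses (p3 : (3 <= p)%N) (n2 : (2 <= n)%N).
Hypothesis L_ge0 : forall y, 1 <= y -> 0 <= L y.
Hypothesis L_slow : slowly_varying L.
Hypothesis L_der : exists dL, derivative_on_ge1 L dL.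
Hypothesis a_lb : 0 < p%:R / 2 + a + 1.

Let al : R := p%:R / 2 + a.
Local Notation K := (kern L al).
Local Notation q := (half_dim p n : R).
Let gam : R := p%:R / 2 - 1.

Let p_ge3 : 3 <= p%:R :> R. Proof. by rewrite (ler_nat R 3 p). Qed.
Let n_ge2 : 2 <= n%:R :> R. Proof. by rewrite (ler_nat R 2 n). Qed.
Let gam_gt0 : 0 < gam. Proof. by rewrite /gam; have := p_ge3; lra. Qed.
Let al_gtN1 : -1 < al. Proof. by rewrite /al; move: a_lb; lra. Qed.
Let qE : q = gam + 1 + n%:R / 2. Proof. by rewrite /half_dim /gam; field. Qed.
Let q_ge0 : 0 <= q. Proof. by rewrite qE; have := gam_gt0; have := n_ge2; lra. Qed.

Let mK := measurable_kern L_der al.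
Let K0 := kern_ge0 L_ge0 al.
Let intK := kern_fin L_ge0 L_slow L_der al_gtN1.

(** As [L] is smaller than any power, [m w] is at most of order [w ^ -s] for some
    [s > p/2 - 1], by the bound [(1 + w l) ^ -q <= (w l) ^ -s]. *)
Lemma int_factor_vanishes : -2 < a ->
  forall e, 0 < e -> exists w0, forall w, w0 <= w -> int_factor p n K w <= e.
Proof.
move=> a2 e e0; pose h := (a + 2) / 3; have h0 : 0 < h by rewrite /h; lra.
pose k := Num.min h 1; have k0 : 0 < k by rewrite lt_min h0 ltr01.
have kh : k <= h by rewrite ge_min lexx.
have k1 : k <= 1 by rewrite ge_min lexx orbT.
pose s := gam + k; have s0 : 0 <= s by rewrite /s; have := gam_gt0; lra.
have sq : s <= q by rewrite qE /s; have := n_ge2; lra.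
pose r := al - h - s + 1; have r0 : 0 < r by rewrite /r /al /s /gam; rewrite /h in kh *; lra.
have [C C0 HC] := kern_le L_ge0 L_slow L_der al h0.
have P0 : 0 <= powR_mass r by apply: Rintegral_ge0 => l _; exact: powR_ge0.
exists ((C * powR_mass r / e) `^ k^-1 + 1) => w ww.
have w0 : 0 < w by apply: lt_le_trans ww; rewrite ltr_wpDl ?powR_ge0.
have H : stj K 0 q w <= C * w `^ (- s) * powR_mass r.
  rewrite -lee_fin -(integral_stj mK K0 intK)//; last exact: ltW.
  rewrite EFinM -powR_massE// -ge0_integralZl//; last 3 first.
  - by apply/measurable_EFinP/measurable_funTS; exact: measurable_powR.
  - by move=> l _; rewrite lee_fin powR_ge0.
  - by rewrite lee_fin mulr_ge0 ?powR_ge0// ltW.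
  apply: ge0_le_integralW => //.
  - move=> l; rewrite /= in_itv/= lee_fin => l01.
    by apply: stj_fun_ge0 => //; exact: ltW.
  move=> l; rewrite /= in_itv/= -EFinM lee_fin => l01; have /andP[l0 l1] := l01.
  rewrite /stj_fun expr0 mulr1.
  apply: (@le_trans _ _ (C * l `^ (al - h) * (w * l) `^ (- s))).
    by apply: ler_pM; rewrite ?powR_ge0 ?K0 ?HC// powRN_le_powRN// mulr_gt0.
  have -> : l `^ (r - 1) = l `^ (al - h) * l `^ (- s).
    by rewrite -powRD ?(gt_eqF l0) ?implybT//; congr (_ `^ _); rewrite /r; ring.
  rewrite powRM ?(ltW w0) ?(ltW l0)// le_eqVlt; apply/orP; left; apply/eqP; ring.
rewrite /int_factor -/gam; apply: (@le_trans _ _ (w `^ gam * (C * w `^ (- s) * powR_mass r))).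
  by rewrite ler_wpM2l ?powR_ge0.
rewrite [leLHS](_ : _ = C * powR_mass r * (w `^ gam * w `^ (- s))); last by ring.
rewrite -powRD ?(gt_eqF w0) ?implybT// (_ : gam + - s = - k); last by rewrite /s; ring.
rewrite powRN ler_pdivrMr ?powR_gt0// -ler_pdivrMl// [leLHS]mulrC.
have A0 : 0 <= C * powR_mass r / e by rewrite !mulr_ge0 ?invr_ge0 ?(ltW C0) ?(ltW e0).
rewrite -[leLHS](powRr1 A0) -(mulVf (lt0r_neq0 k0)) powRrM.
apply: ge0_ler_powR; rewrite ?nnegrE ?powR_ge0 ?(ltW w0) ?(ltW k0)//.
by apply: le_trans ww; rewrite lerDl.
Qed.

End asymptotics.

End growth_of_int_factor.

(** * The integrating factor for a = -2 *)

Section critical_case.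
Context {R : realType}.
Local Notation mu := (@lebesgue_measure R).
Implicit Types c e l r s t u v w x y : R.
Variables (p n : nat) (L : R -> R).
Hypotheses (p3 : (3 <= p)%N) (n2 : (2 <= n)%N).
Hypothesis L_ge0 : forall y, 1 <= y -> 0 <= L y.
Hypothesis L_slow : slowly_varying L.
Hypothesis L_der : exists dL, derivative_on_ge1 L dL.

(** By monotonicity [L y] is bounded by a multiple of [(ln y) ^ b], and [b <= 1]. *)
Lemma slowly_varying_le_ln b : b < 1 ->
  {in `]1, +oo[ &, nondecreasing_fun (fun y => ln y `^ b / L y)} ->
  exists2 C, 0 < C & forall y, 1 <= y -> L y <= C * (1 + ln y).
Proof.
move=> b1 nd; have [y0 y01 H] := slowly_varying_le L_ge0 L_slow ltr01 (ltr1n R 2).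
pose y1 := Num.max y0 (expR 1).
have e1 : 1 < expR 1 :> R by rewrite expR_gt1.
have y1_gt1 : 1 < y1 by rewrite lt_max e1 orbT.
have ly1 : 1 <= ln y1.
  by rewrite -[leLHS](expRK 1) ler_ln ?posrE ?expR_gt0 ?(lt_trans ltr01)// le_max lexx orbT.
have [Ly1 _] : 0 < L y1 /\ L (1 * y1) <= 2 * L y1 by apply: H; rewrite le_max lexx.
pose F1 := ln y1 `^ b / L y1.
have F10 : 0 < F1 by rewrite divr_gt0// powR_gt0// (lt_le_trans ltr01).
have [B B0 HB] := ge1_bounded L_ge0 L_der (ltW y1_gt1).
exists (B + F1^-1); first by rewrite addr_gt0// invr_gt0.
move=> y y_ge1; have ly0 := ln_ge0 y_ge1.
have Fi0 : 0 < F1^-1 by rewrite invr_gt0.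
have [yy1|yy1] := leP y y1.
  apply: (le_trans (HB y y_ge1 yy1)); have := mulr_ge0 (ltW B0) ly0.
  have := mulr_ge0 (ltW Fi0) ly0; lra.
have [Ly _] : 0 < L y /\ L (1 * y) <= 2 * L y.
  by apply: H; apply: le_trans (ltW yy1); rewrite le_max lexx.
have ly1' : 1 <= ln y.
  apply: (le_trans ly1); rewrite ler_ln ?posrE ?ltW//.
    exact: lt_trans y1_gt1.
  by apply: lt_trans yy1; exact: lt_trans y1_gt1.
have := nd y1 y; rewrite !in_itv/= !andbT => /(_ y1_gt1 (lt_trans y1_gt1 yy1) (ltW yy1)).
rewrite -/F1 ler_pdivlMr// mulrC -ler_pdivlMr// => /le_trans; apply.
have : ln y `^ b <= ln y.
  by rewrite -[leRHS](powRr1 ly0) ler_powR// ltW.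
rewrite -(ler_pM2r Fi0) => /le_trans; apply.
have := mulr_ge0 (ltW B0) ly0; lra.
Qed.

Let al : R := p%:R / 2 + -2.
Local Notation K := (kern L al).
Local Notation q := (half_dim p n : R).
Let gam : R := p%:R / 2 - 1.

Let p_ge3 : 3 <= p%:R :> R. Proof. by rewrite (ler_nat R 3 p). Qed.
Let n_ge2 : 2 <= n%:R :> R. Proof. by rewrite (ler_nat R 2 n). Qed.
Let gam_gt0 : 0 < gam. Proof. by rewrite /gam; have := p_ge3; lra. Qed.
Let alE : al = gam - 1. Proof. by rewrite /al /gam; ring. Qed.
Let al_gtN1 : -1 < al. Proof. by rewrite alE; have := gam_gt0; lra. Qed.
Let qE : q = gam + 1 + n%:R / 2. Proof. by rewrite /half_dim /gam; field. Qed.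
Let q_ge0 : 0 <= q. Proof. by rewrite qE; have := gam_gt0; have := n_ge2; lra. Qed.

Let mK := measurable_kern L_der al.
Let K0 := kern_ge0 L_ge0 al.
Let intK := kern_fin L_ge0 L_slow L_der al_gtN1.

(** The bound follows from the substitution [x = w l], after which [1 + ln (w / x)] is
    at most [1 + ln w] times [1 + (2 / gam) x ^ -(gam / 2)]. *)
Lemma int_factor_le_ln C : 0 < C -> (forall y, 1 <= y -> L y <= C * (1 + ln y)) ->
  exists2 M, 0 < M & forall w, 1 <= w -> int_factor p n K w <= M * (1 + ln w).
Proof.
move=> C0 HC.
pose A1 := \int[mu]_(x in `]0, +oo[) (x `^ (gam - 1) * (1 + x) `^ (- q)).
pose A2 := \int[mu]_(x in `]0, +oo[) (x `^ (gam / 2 - 1) * (1 + x) `^ (- q)).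
have AE r : 0 < r -> r <= gam ->
    (\int[mu]_(x in `]0%R, +oo[) (x `^ (r - 1) * (1 + x) `^ (- q))%:E =
     (\int[mu]_(x in `]0, +oo[) (x `^ (r - 1) * (1 + x) `^ (- q)))%:E)%E.
  move=> r0 rg; rewrite /Rintegral fineK// ge0_fin_numE.
    by apply: integral_powR_onepD_fin => //; rewrite qE; have := n_ge2; lra.
  by apply: integral_ge0 => x _; rewrite lee_fin mulr_ge0 ?powR_ge0.
have g20 : 0 < gam / 2 by rewrite divr_gt0.
have A1_ge0 : 0 <= A1 by apply: Rintegral_ge0 => x _; rewrite mulr_ge0 ?powR_ge0.
have A2_ge0 : 0 <= A2 by apply: Rintegral_ge0 => x _; rewrite mulr_ge0 ?powR_ge0.
have mP r : measurable_fun (setT : set R) (fun x => x `^ (r - 1) * (1 + x) `^ (- q)).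
  apply: measurable_funM; first exact: measurable_powR.
  apply: (@measurableT_comp _ _ _ _ _ _ (fun x : R => x `^ (- q))).
    exact: measurable_powR.
  exact: measurable_funD.
exists (C * (A1 + 2 / gam * A2) + 1).
  by rewrite ltr_wpDl// mulr_ge0 ?addr_ge0 ?mulr_ge0 ?invr_ge0 ?(ltW C0) ?(ltW gam_gt0).
move=> w w1; have w0 : 0 < w by exact: lt_le_trans w1.
have lw := ln_ge0 w1; have wi0 : 0 < w^-1 by rewrite invr_gt0.
pose B x := C * w `^ (1 - gam) * (1 + ln w) *
  (x `^ (gam - 1) * (1 + x) `^ (- q) + 2 / gam * (x `^ (gam / 2 - 1) * (1 + x) `^ (- q))).
have tg0 : 0 <= 2 / gam by rewrite divr_ge0// ltW.
have lw1 : 0 <= 1 + ln w by rewrite addr_ge0.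
have Cw0 : 0 <= C * w `^ (1 - gam) * (1 + ln w).
  by rewrite mulr_ge0// mulr_ge0 ?powR_ge0// ltW.
have B0 x : 0 <= B x.
  apply: mulr_ge0; first exact: Cw0.
  by apply: addr_ge0; [|apply: mulr_ge0 => //]; rewrite mulr_ge0 ?powR_ge0.
have KB x : 0 < x -> x < w -> K (w^-1 * x) * (1 + w * (w^-1 * x)) `^ (- q) <= B x.
  move=> x0 xw; rewrite mulrA mulfV ?gt_eqF// mul1r.
  have l0 : 0 < w^-1 * x by rewrite mulr_gt0.
  have l1 : w^-1 * x < 1 by rewrite mulrC ltr_pdivrMr ?mul1r.
  have li1 : 1 <= (w^-1 * x)^-1 by rewrite invf_ge1//; exact: ltW.
  have lnE : ln (w^-1 * x)^-1 = ln w - ln x.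
    by rewrite invfM invrK ln_div ?posrE.
  have lx : - ln x <= 2 / gam * x `^ (- (gam / 2)).
    have h : - (gam / 2) * ln x <= x `^ (- (gam / 2)).
      by rewrite -ln_powR; apply/ltW/ln_sublinear/powR_gt0.
    rewrite [leLHS](_ : _ = 2 / gam * (- (gam / 2) * ln x)); first by rewrite ler_wpM2l.
    by field; rewrite gt_eqF.
  have x20 : 0 <= 2 / gam * x `^ (- (gam / 2)).
    by rewrite mulr_ge0 ?powR_ge0.
  have L1 : L (w^-1 * x)^-1 <= C * ((1 + ln w) * (1 + 2 / gam * x `^ (- (gam / 2)))).
    apply: le_trans (HC _ li1) _; rewrite ler_wpM2l ?(ltW C0)// lnE.
    have := mulr_ge0 lw x20; lra.
  rewrite kernE ?l0// powRM ?(ltW wi0) ?(ltW x0)//.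
  have -> : w^-1 `^ al = w `^ (1 - gam).
    rewrite -powR_inv1 ?(ltW w0)// -powRrM; congr (_ `^ _); rewrite alE; ring.
  apply: (@le_trans _ _ (w `^ (1 - gam) * x `^ al *
     (C * ((1 + ln w) * (1 + 2 / gam * x `^ (- (gam / 2))))) * (1 + x) `^ (- q))).
    by rewrite ler_wpM2r ?powR_ge0// ler_wpM2l// mulr_ge0 ?powR_ge0.
  have px : x `^ (gam / 2 - 1) = x `^ al * x `^ (- (gam / 2)).
    by rewrite -powRD ?(gt_eqF x0) ?implybT//; congr (_ `^ _); rewrite alE; field.
  by rewrite /B px -alE le_eqVlt; apply/orP; left; apply/eqP; ring.
have mB : measurable_fun (setT : set R) B.
  apply: measurable_funM => //; apply: measurable_funD; first exact: mP.
  by apply: measurable_funM => //; exact: mP.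
have BE : (\int[mu]_(x in `]0%R, +oo[) (B x)%:E =
    (C * w `^ (1 - gam) * (1 + ln w) * (A1 + 2 / gam * A2))%:E)%E.
  under eq_integral do rewrite EFinM.
  rewrite ge0_integralZl//; last 2 first.
  - apply/measurable_EFinP/measurable_funTS; apply: measurable_funD; first exact: mP.
    by apply: measurable_funM => //; exact: mP.
  - move=> x _; rewrite lee_fin; apply: addr_ge0; last apply: mulr_ge0 => //.
      by rewrite mulr_ge0 ?powR_ge0.
    by rewrite mulr_ge0 ?powR_ge0.
  rewrite [RHS]EFinM; congr (_ * _)%E.
  under eq_integral do rewrite EFinD.
  rewrite ge0_integralD//; last 4 first.
  - by move=> x _; rewrite lee_fin mulr_ge0 ?powR_ge0.
  - by apply/measurable_EFinP/measurable_funTS; exact: mP.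
  - by move=> x _; rewrite lee_fin mulr_ge0// mulr_ge0 ?powR_ge0.
  - by apply/measurable_EFinP; apply: measurable_funM => //; apply: measurable_funTS; exact: mP.
  rewrite EFinD (AE _ gam_gt0 (lexx _)); congr (_ + _)%E.
  under eq_integral do rewrite EFinM.
  rewrite ge0_integralZl//; last 2 first.
  - by apply/measurable_EFinP/measurable_funTS; exact: mP.
  - by move=> x _; rewrite lee_fin mulr_ge0 ?powR_ge0.
  by rewrite (AE (gam / 2)) ?EFinM//; have := gam_gt0; lra.
have stj_le : stj K 0 q w <= w^-1 * (C * w `^ (1 - gam) * (1 + ln w) * (A1 + 2 / gam * A2)).
  rewrite -lee_fin -(integral_stj mK K0 intK) ?(ltW w0)// EFinM -BE integral_mkcond.
  pose F : R -> \bar R := ((fun l => (stj_fun K 0 q w l)%:E) \_ `]0, 1[)%R.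
  have mF : measurable_fun (setT : set R) F.
    apply/(measurable_restrictT _ _).1 => //.
    by apply/measurable_EFinP; exact: measurable_stj_fun.
  have F0 x : (0 <= F x)%E.
    rewrite /F patchE; case: ifPn => // /set_mem; rewrite /= in_itv/= => x01.
    by rewrite lee_fin stj_fun_ge0// ltW.
  rewrite (ge0_integral_scale wi0 mF F0) lee_wpmul2l ?lee_fin ?(ltW wi0)//.
  rewrite [leRHS]integral_mkcond; apply: ge0_le_integralW => //.
  - move=> x _; rewrite /F !patchE; case: ifPn => [/set_mem|_]; last first.
      by case: ifPn => //; rewrite lee_fin.
    rewrite /= in_itv/= => /andP[x0 x1].
    have {}x0 : 0 < x by rewrite pmulr_rgt0 in x0.
    have {}x1 : x < w by move: x1; rewrite ltr_pdivrMl// mulr1.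
    rewrite mem_set; last by rewrite /= in_itv/= x0.
    by rewrite lee_fin /stj_fun expr0 mulr1; exact: KB.
rewrite /int_factor -/gam.
apply: le_trans (ler_wpM2l (powR_ge0 _ _) stj_le) _.
have wE : w `^ gam * w^-1 * w `^ (1 - gam) = 1.
  rewrite -powR_inv1 ?(ltW w0)// -!powRD ?(gt_eqF w0) ?implybT//.
  by rewrite (_ : gam + -1 + (1 - gam) = 0) ?powRr0//; ring.
rewrite [leLHS](_ : _ = w `^ gam * w^-1 * w `^ (1 - gam) *
  (C * (A1 + 2 / gam * A2) * (1 + ln w))); last by ring.
by rewrite wE mul1r ler_wpM2r// lerDl.
Qed.

(** Since [l `^ al * L (1 / l)] is nearly homogeneous of degree [al = gam - 1] near 0,
    the substitution [l -> 2 l] bounds the part near 0 of [stj K 0 q w] by a multiple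
    less than 1 of itself, up to a multiple of [stj K 0 (q + 1) w]. *)
Lemma bayes_phi_bounded : exists2 M, 0 < M & forall w, 0 < w -> bayes_phi p n K w <= M.
Proof.
pose r : R := 2 `^ 2^-1.
have r1 : 1 < r.
  have e1 : 1 `^ 2^-1 = 1 :> R by rewrite powR1.
  by rewrite -[ltLHS]e1; apply: gt0_ltr_powR; rewrite ?nnegrE ?ltr1n ?invr_gt0.
have h0 : 0 < 2^-1 :> R by rewrite invr_gt0.
have [y0 y01 HL] := slowly_varying_le L_ge0 L_slow h0 r1.
pose t0 : R := (y0 + 1)^-1.
have t00 : 0 < t0 by rewrite invr_gt0; lra.
have t0y : t0^-1 = y0 + 1 by rewrite invrK.
have t0h : t0 < 1 by rewrite invf_lt1; lra.
have gq : gam + 1 < q by rewrite qE; have := n_ge2; lra.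
have g0 : 0 < gam + 1 by have := gam_gt0; lra.
have [C C0 HC] := powR_onepD_split g0 gq.
have q10 : 0 <= q + 1 by have := q_ge0; lra.
have sub : `]0, t0[ `<=` `]0, 1[.
  by move=> l; rewrite /= !in_itv/= => /andP[-> lt]; exact: lt_trans lt t0h.
have mt0 : measurable (`]0, t0[%classic : set (measurableTypeR R)) by exact: measurable_itv.
have m01 : measurable (`]0, 1[%classic : set (measurableTypeR R)) by exact: measurable_itv.
have k_gt0 := kern_gt0 L_ge0 L_slow L_der al t00 (ltW t0h).
pose k0 := \int[mu]_(l in `]0, t0[) K l.
have iK : mu.-integrable `]0, t0[ (EFin \o K).
  exact: (integrableS m01 mt0 sub (integrable_kernel mK K0 intK)).
have k0E : (k0%:E = \int[mu]_(l in `]0%R, t0[) (K l)%:E)%E.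
  by rewrite /k0 /Rintegral fineK//; exact: (integrable_fin_num _ iK).
have k00 : 0 < k0 by rewrite -lte_fin k0E.
pose C' : R := 2 `^ gam * r * C.
have C'0 : 0 <= C' by rewrite !mulr_ge0 ?powR_ge0// ltW.
pose th : R := 2 `^ (- 2^-1).
have th1 : 0 < 1 - th.
  rewrite subr_gt0 /th powRN invf_lt1// (lt_trans ltr01 r1)//.
pose A := mass K / k0.
have A0 : 0 <= A.
  by rewrite divr_ge0 ?(ltW k00)//; apply: Rintegral_ge0 => l; rewrite /= in_itv/=; exact: stj_fun_ge0.
exists ((1 + A) * (C' / (1 - th)) + 1).
  by rewrite ltr_wpDl// mulr_ge0 ?addr_ge0// divr_ge0// ltW.
move=> w w0; have w_ge0 := ltW w0.
pose I0 := stj K 0 (q + 1) w.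
have I00 : 0 <= I0 by exact: stj_ge0.
pose mT := \int[mu]_(l in `]0, t0[) stj_fun K 0 q w l.
have iS s : 0 <= s -> mu.-integrable `]0, t0[ (EFin \o stj_fun K 0 s w).
  by move=> s0; apply: (integrableS m01 mt0 sub (integrable_stj_fun mK K0 intK 0 s0 w_ge0)).
have mS s : measurable_fun (`]0, t0[%classic : set R) (stj_fun K 0 s w).
  by apply: measurable_funS (measurable_stj_fun mK 0 s w).
have S0 s l : 0 < l < t0 -> 0 <= stj_fun K 0 s w l.
  by move=> /andP[l0 lt]; apply: stj_fun_ge0 => //; rewrite l0 (lt_trans lt).
have mTE : (mT%:E = \int[mu]_(l in `]0%R, t0[) (stj_fun K 0 q w l)%:E)%E.
  by rewrite /mT /Rintegral fineK//; exact: (integrable_fin_num _ (iS _ q_ge0)).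
have mI : (\int[mu]_(l in `]0%R, t0[) (stj_fun K 0 (q + 1) w l)%:E <= I0%:E)%E.
  rewrite /I0 -(integral_stj mK K0 intK)//; apply: ge0_subset_integral => //.
  - by apply/measurable_EFinP; exact: measurable_stj_fun.
  - by move=> l; rewrite /= in_itv/= lee_fin => l01; exact: stj_fun_ge0.
(* The factors [2 ^ gam], [2 ^ (1/2)] from [L] and [2 ^ -(gam + 1)] multiply to [th < 1]. *)
have half l : 0 < l -> 2 * l < t0 ->
    2 * stj_fun K 0 q w (2 * l) <= th * stj_fun K 0 q w l + C' * stj_fun K 0 (q + 1) w l.
  move=> l0 lt; have l20 : 0 < 2 * l by rewrite mulr_gt0.
  have l1 : l < 1 by lra.
  have ly : y0 <= l^-1.
    apply: (@le_trans _ _ t0^-1); first by rewrite t0y; lra.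
    by rewrite lef_pV2 ?posrE//; lra.
  have [_ L2] := HL _ ly.
  rewrite /stj_fun expr0 !mulr1 !kernE ?l0 ?l1 ?l20 ?(lt_trans lt t0h)//.
  rewrite invfM; set Ll := L l^-1; set La := L (_ * _) in L2 *.
  have Ll0 : 0 <= Ll by apply: L_ge0; apply: le_trans ly.
  have wl : 0 <= w * l by rewrite mulr_ge0// ltW.
  have Pl0 : 0 <= l `^ al by exact: powR_ge0.
  rewrite (mulrCA w) powRM ?ler0n ?(ltW l0)//.
  rewrite [leLHS](_ : _ = (2 * 2 `^ al) * l `^ al * La * (1 + 2 * (w * l)) `^ (- q)); last by ring.
  have -> : 2 * 2 `^ al = 2 `^ gam :> R.
    rewrite -[X in X * _](powRr1 (ler0n R 2)) -powRD ?pnatr_eq0 ?implybT//.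
    by congr (_ `^ _); rewrite alE; ring.
  apply: (@le_trans _ _ (2 `^ gam * l `^ al * (r * Ll) *
    (2 `^ (- (gam + 1)) * (1 + w * l) `^ (- q) + C * (1 + w * l) `^ (- (q + 1))))).
    apply: ler_pM; rewrite ?mulr_ge0 ?powR_ge0//.
    - by apply: L_ge0; rewrite -invfM invf_ge1//; lra.
    - by rewrite ler_wpM2l// mulr_ge0// powR_ge0.
    - exact: HC.
  have -> : th = 2 `^ gam * r * 2 `^ (- (gam + 1)).
    rewrite /r /th -!powRD ?pnatr_eq0 ?implybT//; congr (_ `^ _).
    by field.
  by rewrite /C' le_eqVlt; apply/orP; left; apply/eqP; ring.
have mT_le : mT <= th * mT + C' * I0.
  pose F : R -> \bar R := ((fun l => (stj_fun K 0 q w l)%:E) \_ `]0, t0[)%R.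
  have mF : measurable_fun (setT : set R) F.
    by apply/(measurable_restrictT _ _).1 => //; apply/measurable_EFinP; exact: mS.
  have F0 x : (0 <= F x)%E.
    rewrite /F patchE; case: ifPn => // /set_mem; rewrite /= in_itv/= => x01.
    by rewrite lee_fin S0.
  have mth : 0 <= th by exact: powR_ge0.
  rewrite -lee_fin mTE integral_mkcond (ge0_integral_scale (ltr0n R 2) mF F0).
  rewrite -ge0_integralZl//; last by apply: (measurableT_comp mF); exact: mulrl_measurable.
  apply: (@le_trans _ _ (\int[mu]_(l in `]0%R, t0[)
     (th * stj_fun K 0 q w l + C' * stj_fun K 0 (q + 1) w l)%:E)%E).
    rewrite [leRHS]integral_mkcond; apply: ge0_le_integralW => //.
    - by move=> x _; rewrite mule_ge0.
    move=> x _; rewrite /F !patchE; case: ifPn => [/set_mem|_]; last first.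
      rewrite mule0; case: ifPn => // /set_mem; rewrite /= in_itv/= => x01.
      by rewrite lee_fin addr_ge0// mulr_ge0// S0.
    rewrite /= in_itv/= => /andP[x0 x1]; have {}x0 : 0 < x by rewrite pmulr_rgt0 in x0.
    rewrite mem_set; last by rewrite /= in_itv/= x0; lra.
    by rewrite -EFinM lee_fin; exact: half.
  under eq_integral do rewrite EFinD !EFinM.
  rewrite ge0_integralD//; last 4 first.
  - move=> x; rewrite /= in_itv/= => x01; rewrite -EFinM lee_fin mulr_ge0// S0//.
  - by apply: emeasurable_funM => //; apply/measurable_EFinP; exact: mS.
  - move=> x; rewrite /= in_itv/= => x01; rewrite -EFinM lee_fin mulr_ge0// S0//.
  - by apply: emeasurable_funM => //; apply/measurable_EFinP; exact: mS.
  have Zl c s : 0 <= c -> (\int[mu]_(l in `]0%R, t0[) (c%:E * (stj_fun K 0 s w l)%:E) =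
      c%:E * \int[mu]_(l in `]0%R, t0[) (stj_fun K 0 s w l)%:E)%E.
    move=> c0; rewrite ge0_integralZl//.
    - by apply/measurable_EFinP; exact: mS.
    - by move=> x; rewrite /= in_itv/= => x01; rewrite lee_fin S0.
  rewrite (Zl th)// (Zl C')//.
  rewrite -mTE EFinD !EFinM leeD// lee_wpmul2l// lee_fin//.
have mT0 : 0 <= mT.
  by apply: Rintegral_ge0 => l; rewrite /= in_itv/=; exact: S0.
have mT_le' : mT <= C' / (1 - th) * I0.
  by rewrite mulrAC ler_pdivlMr//; move: mT_le; lra.
(* Away from 0 the factor [(1 + w l) ^ -q] is smaller than it is near 0. *)
have rest : stj K 0 q w <= (1 + A) * mT.
  pose P := (1 + w * t0) `^ (- q).
  have wt0 : 0 <= w * t0 by rewrite mulr_ge0// ltW.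
  have P0 : 0 <= P by exact: powR_ge0.
  have Pmon l v : 0 <= l -> l <= v -> (1 + w * v) `^ (- q) <= (1 + w * l) `^ (- q).
    move=> l0 lv; have wl : 0 <= w * l by rewrite mulr_ge0.
    have wv : w * l <= w * v by rewrite ler_wpM2l.
    have p1 : 0 < 1 + w * l by rewrite ltr_wpDr.
    have p2 : 1 + w * l <= 1 + w * v by rewrite lerD2l.
    have p3' : 0 < 1 + w * v by exact: lt_le_trans p2.
    rewrite !powRN lef_pV2 ?posrE ?powR_gt0//.
    by apply: ge0_ler_powR; rewrite ?nnegrE ?(ltW p1) ?(ltW p3').
  have mTk : P * k0 <= mT.
    rewrite -lee_fin EFinM k0E mTE -ge0_integralZl//; last 2 first.
    - by apply/measurable_EFinP; apply: measurable_funS mK.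
    - by move=> l; rewrite /= in_itv/= => /andP[l0 lt]; rewrite lee_fin K0// l0 (lt_trans lt).
    apply: ge0_le_integralW => //.
    - move=> l; rewrite /= in_itv/= => /andP[l0 lt].
      by rewrite -EFinM lee_fin mulr_ge0// K0// l0 (lt_trans lt).
    - move=> l; rewrite /= in_itv/= => /andP[l0 lt]; rewrite -EFinM lee_fin.
      rewrite /stj_fun expr0 mulr1 mulrC ler_wpM2l ?K0 ?l0 ?(lt_trans lt)//.
      by apply: Pmon; exact: ltW.
  have -> : (1 + A) * mT = mT + A * mT by ring.
  have AP : mass K * P <= A * mT.
    rewrite [leLHS](_ : _ = A * (P * k0)); first by rewrite ler_wpM2l.
    by rewrite /A; field; rewrite gt_eqF.
  apply: (@le_trans _ _ (mT + mass K * P)); last by rewrite lerD2l.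
  rewrite -lee_fin -(integral_stj mK K0 intK)// EFinD mTE.
  have mSt : measurable_fun (`[t0, 1[%classic : set R) (stj_fun K 0 q w).
    apply: measurable_funS (measurable_stj_fun mK 0 q w) => // l.
    by rewrite /= !in_itv/= => /andP[tl ->]; rewrite (lt_le_trans t00 tl).
  have mKt : measurable_fun (`[t0, 1[%classic : set R) K.
    apply: measurable_funS mK => // l.
    by rewrite /= !in_itv/= => /andP[tl ->]; rewrite (lt_le_trans t00 tl).
  rewrite (@itv_bndbnd_setU _ _ _ (BLeft t0)) ?bnd_simp ?(ltW t00) ?(ltW t0h)//.
  rewrite ge0_integral_setU//; last 3 first.
  - rewrite -itv_bndbnd_setU ?bnd_simp ?(ltW t00) ?(ltW t0h)//.
    by apply/measurable_EFinP; exact: measurable_stj_fun.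
  - rewrite -itv_bndbnd_setU ?bnd_simp ?(ltW t00) ?(ltW t0h)//.
    by move=> l; rewrite /= in_itv/= lee_fin => l01; exact: stj_fun_ge0.
  - by apply/disj_setPLR => x/=; rewrite !in_itv/= => /andP[_ x1]; apply/negP; rewrite negb_and -ltNge x1.
  rewrite leeD2l// EFinM massE//.
  apply: (@le_trans _ _ (\int[mu]_(l in `[t0, 1%R[) (K l * P)%:E)%E).
    apply: ge0_le_integralW => //.
    - move=> l; rewrite /= in_itv/= => /andP[tl l1]; rewrite lee_fin stj_fun_ge0//.
      by rewrite (lt_le_trans t00 tl).
    - move=> l; rewrite /= in_itv/= => /andP[tl l1]; rewrite lee_fin.
      rewrite /stj_fun expr0 mulr1 ler_wpM2l ?K0 ?(lt_le_trans t00 tl)//.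
      by apply: Pmon => //; exact: ltW.
  under eq_integral do rewrite EFinM.
  rewrite ge0_integralZr//; last 2 first.
  - exact/measurable_EFinP.
  - by move=> l; rewrite /= in_itv/= => /andP[tl l1]; rewrite lee_fin K0// (lt_le_trans t00 tl).
  rewrite lee_wpmul2r ?lee_fin//; apply: ge0_subset_integral => //.
  - exact/measurable_EFinP.
  - by move=> l; rewrite /= !in_itv/= => /andP[tl ->]; rewrite (lt_le_trans t00 tl).
have k1 : (0 < \int[mu]_(l in `]0%R, 1%R[) (K l)%:E)%E.
  exact: (kern_gt0 L_ge0 L_slow L_der al ltr01 (lexx 1)).
rewrite -(lerD2l 1) (onepD_bayes_phi p n mK K0 intK k1 w0).
have I0_gt0 : 0 < I0 by exact: (stj0_gt0 mK K0 intK k1).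
clear mI mT_le; move: rest mT_le' I00 I0_gt0; rewrite -/I0.
move: I0 (stj K 0 q w) => J0 m rest mT_le'' J00 J0_gt0.
rewrite ler_pdivrMr//.
apply: (le_trans rest); apply: (@le_trans _ _ ((1 + A) * (C' / (1 - th) * J0))).
  by rewrite ler_wpM2l// addr_ge0.
rewrite mulrA; apply: ler_wpM2r => //; lra.
Qed.

End critical_case.

(** * Normal and inverse gamma integrals *)

Section reflection.
Context {R : realType}.
Local Notation mu := (@lebesgue_measure R).
Implicit Types x t m : R.

Lemma ge0_integral_reflect m (f : R -> \bar R) :
  measurable_fun setT f -> (forall x, 0 <= f x)%E ->
  (\int[mu]_x f x = \int[mu]_x f (m - x)%R)%E.
Proof.
move=> mf f0.
have mc : measurable_fun setT (fun x => m - x : measurableTypeR R).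
  by apply: measurable_funB.
pose nu : {measure set (measurableTypeR R) -> \bar R} :=
  measure_function_pushforward__canonical__measure_function_Measure mu mc.
transitivity (\int[nu]_x f x)%E; last by rewrite ge0_integral_pushforward.
apply: eq_measure_integral => A mA _.
apply: lebesgue_measure_unique => //= _ [[a b]] _ <-.
rewrite /pushforward.
rewrite (_ : (fun x => m - x) @^-1` _ = `[m - b, m - a[%classic); last first.
  by apply/seteqP; split => x /=; rewrite !in_itv/= => /andP[? ?]; apply/andP; split; lra.
rewrite !lebesgue_measure_itv/= !lte_fin ltrD2l ltrN2.
by case: ifPn => _; rewrite -?EFinB//; congr EFin; ring.
Qed.

End reflection.

Section gaussian.
Context {R : realType}.
Local Notation mu := (@lebesgue_measure R).
Implicit Types x t m V l v : R.

(** The normal density with mean [m] and variance [V]; unlike [normal_pdf] it is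
    written so as to be jointly measurable in its three arguments. *)
Definition gau m V t : R :=
  (V * (pi * 2)) `^ (- 2^-1) * expR (- ((t - m) ^+ 2 * (V * 2) `^ (-1))).

Lemma gauE m V t : 0 < V -> gau m V t = normal_pdf m (Num.sqrt V) t.
Proof.
move=> V0; rewrite normal_pdfE ?gt_eqF ?sqrtr_gt0// /normal_peak /normal_fun /gau.
rewrite !sqr_sqrtr ?(ltW V0)//; congr (_ * expR _).
  by rewrite powRN powR12_sqrt ?mulr_ge0 ?pi_ge0 ?(ltW V0)//; congr (Num.sqrt _)^-1; ring.
by rewrite powR_inv1 ?mulr_ge0 ?(ltW V0)// -mulNr; congr (_ / _); ring.
Qed.

Lemma gau_ge0 m V t : 0 <= gau m V t.
Proof. by rewrite mulr_ge0 ?powR_ge0 ?expR_ge0. Qed.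

Lemma measurable_fun_gau d (T : measurableType d) (m V t : T -> R) :
  measurable_fun setT m -> measurable_fun setT V -> measurable_fun setT t ->
  measurable_fun setT (fun z => gau (m z) (V z) (t z)).
Proof.
move=> mm mV mt; apply: measurable_funM.
  apply: (measurableT_comp (@measurable_powR _ (- 2^-1))).
  exact: measurable_funM.
apply: (measurableT_comp (@measurable_expR R)).
apply: (measurableT_comp (@oppr_measurable R _)).
apply: measurable_funM.
  by apply: measurable_funX; exact: measurable_funB.
apply: (measurableT_comp (@measurable_powR _ (-1))).
exact: measurable_funM.
Qed.

Lemma measurable_gau m V : measurable_fun (setT : set R) (gau m V).
Proof. by apply: (@measurable_fun_gau _ R (cst m) (cst V) id). Qed.

Lemma integral_gau m V : 0 < V -> (\int[mu]_t (gau m V t)%:E = 1)%E.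
Proof.
move=> V0; rewrite -(integral_normal_pdf m (Num.sqrt V)).
by apply: eq_integral => t _; rewrite gauE.
Qed.

Lemma integral_gau_reflect m V :
  (\int[mu]_t (Num.max 0 (t - m) * gau m V t)%:E =
   \int[mu]_t (Num.max 0 (m - t) * gau m V t)%:E)%E.
Proof.
have mf : measurable_fun (setT : set R) (fun t => (Num.max 0 (t - m) * gau m V t)%:E).
  apply/measurable_EFinP; apply: measurable_funM; last exact: measurable_gau.
  by apply: measurable_maxr => //; exact: measurable_funB.
have f0 t : (0 <= (Num.max 0 (t - m) * gau m V t)%:E)%E.
  by rewrite lee_fin mulr_ge0 ?gau_ge0// le_max lexx.
rewrite (ge0_integral_reflect (2 * m) mf f0); apply: eq_integral => t _.
rewrite /gau; congr (Num.max 0 _ * (_ * expR (- (_ * _)))%R)%:E; ring.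
Qed.

(** Up to a constant, [m - t] times the density is at most the normal density of twice
    the variance. *)
Lemma integral_gau_moment m V : 0 < V ->
  (\int[mu]_t (Num.max 0 (m - t) * gau m V t)%:E <= (2 * (1 + V))%:E)%E.
Proof.
move=> V0; have V20 : 0 < V * 2 by rewrite mulr_gt0.
have C0 : 0 <= 2 * (1 + V) by rewrite mulr_ge0 ?addr_ge0 ?(ltW V0).
apply: (@le_trans _ _ (\int[mu]_t (2 * (1 + V) * gau m (V * 2) t)%:E)%E); last first.
  under eq_integral do rewrite EFinM.
  rewrite ge0_integralZl//; last 2 first.
  - by apply/measurable_EFinP; exact: measurable_gau.
  - by move=> t _; rewrite lee_fin gau_ge0.
  by rewrite integral_gau// mule1.
apply: ge0_le_integralW => //.
- by move=> t _; rewrite lee_fin mulr_ge0 ?gau_ge0// le_max lexx.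
move=> t _; rewrite lee_fin /gau; set y := (t - m) ^+ 2.
have yE : y * (V * 2) `^ (-1) = y / (V * 4) + y * (V * 2 * 2) `^ (-1).
  rewrite !powR_inv1 ?mulr_ge0 ?(ltW V0)//; field.
  by rewrite gt_eqF.
rewrite yE opprD expRD.
have h1 : Num.max 0 (m - t) * expR (- (y / (V * 4))) <= 1 + V.
  rewrite expRN ler_pdivrMr ?expR_gt0//.
  apply: (@le_trans _ _ ((1 + V) * (1 + y / (V * 4)))).
    have -> : (1 + V) * (1 + y / (V * 4)) = 1 + V + y / (V * 4) + y / 4.
      by field; rewrite gt_eqF.
    have y0 : 0 <= y / (V * 4) by rewrite divr_ge0 ?sqr_ge0 ?mulr_ge0 ?(ltW V0).
    rewrite ge_max; apply/andP; split.
      have : 0 <= y by exact: sqr_ge0.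
      lra.
    have : 0 <= (2 - (m - t)) ^+ 2 by exact: sqr_ge0.
    have -> : (2 - (m - t)) ^+ 2 = 4 - 4 * (m - t) + y by rewrite /y; ring.
    lra.
  by rewrite ler_wpM2l ?expR_ge1Dx// addr_ge0// ltW.
have h2 : (V * (pi * 2)) `^ (- 2^-1) <= 2 * (V * 2 * (pi * 2)) `^ (- 2^-1).
  have W0 : 0 < V * (pi * 2) by rewrite !mulr_gt0 ?pi_gt0.
  rewrite (_ : V * 2 * (pi * 2) = 2 * (V * (pi * 2))); last by ring.
  rewrite (powRM _ (ler0n R 2) (ltW W0)) [leRHS]mulrA ler_peMl ?powR_ge0//.
  rewrite powRN ler_pdivlMr ?powR_gt0// mul1r.
  by rewrite -[leRHS](powRr1 (ler0n R 2)) ler_powR ?ler1n//; lra.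
rewrite [leLHS](_ : _ = (V * (pi * 2)) `^ (- 2^-1) *
   (Num.max 0 (m - t) * expR (- (y / (V * 4)))) * expR (- (y * (V * 2 * 2) `^ (-1)))); last by ring.
rewrite [leRHS](_ : _ = (2 * (V * 2 * (pi * 2)) `^ (- 2^-1)) * (1 + V) *
  expR (- (y * (V * 2 * 2) `^ (-1)))); last by ring.
rewrite ler_wpM2r ?expR_ge0// ler_pM ?powR_ge0 ?mulr_ge0 ?expR_ge0//.
by rewrite le_max lexx.
Qed.

(** Completing the square: a normal likelihood times the exponential factor of the
    prior is a normal density in [t] around the shrunken observation. *)
Lemma gau_complete_square x t v l : 0 < v -> 0 < l < 1 ->
  gau t v x * expR (- (l / (1 - l)) * (t ^+ 2 / v / 2)) =
  (1 - l) `^ 2^-1 * gau ((1 - l) * x) (v * (1 - l)) t * expR (- (l * x ^+ 2 * 2^-1 / v)).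
Proof.
move=> v0 /andP[l0 l1]; have l1' : 0 < 1 - l by rewrite subr_gt0.
have W0 : 0 < v * (pi * 2) by rewrite !mulr_gt0 ?pi_gt0.
rewrite /gau (_ : v * (1 - l) * (pi * 2) = (1 - l) * (v * (pi * 2))); last by ring.
rewrite (powRM _ (ltW l1') (ltW W0)).
have c12 : (1 - l) `^ 2^-1 * (1 - l) `^ (- 2^-1) = 1.
  by rewrite -powRD ?(gt_eqF l1') ?implybT// subrr powRr0.
rewrite -!mulrA [RHS]mulrA c12 mul1r; congr (_ * _); rewrite -!expRD; congr expR.
rewrite !powR_inv1 ?mulr_ge0 ?(ltW v0) ?(ltW l1')//; field.
by rewrite !gt_eqF.
Qed.

End gaussian.

Section inverse_gamma.
Context {R : realType}.
Local Notation mu := (@lebesgue_measure R).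
Implicit Types c r v : R.

Definition inv_gamma_fun r v : R := v `^ (- (r + 1)) * expR (- v `^ (-1)).

(** By the substitution [v = 1 / t] this is the gamma function at [r]. *)
Definition inv_gamma r : R := \int[mu]_(v in `]0, +oo[) inv_gamma_fun r v.

Lemma measurable_inv_gamma_fun r : measurable_fun (setT : set R) (inv_gamma_fun r).
Proof.
apply: measurable_funM; first exact: measurable_powR.
apply: (measurableT_comp (@measurable_expR R)).
apply: (measurableT_comp (@oppr_measurable R _)); exact: measurable_powR.
Qed.

Lemma inv_gamma_fun_ge0 r v : 0 <= inv_gamma_fun r v.
Proof. by rewrite mulr_ge0 ?powR_ge0 ?expR_ge0. Qed.

Lemma inv_gammaE r : 1 <= r ->
  (\int[mu]_(v in `]0%R, +oo[) (inv_gamma_fun r v)%:E = (inv_gamma r)%:E)%E.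
Proof.
move=> r1; rewrite /inv_gamma /Rintegral fineK// ge0_fin_numE; last first.
  by apply: integral_ge0 => v _; rewrite lee_fin inv_gamma_fun_ge0.
have r0 : 0 <= r - 1 by rewrite subr_ge0.
have r0' : 0 <= r + 1 by lra.
have [A A0 HA] := powR_expRN_bounded r0.
have [B B0 HB] := powR_expRN_bounded r0'.
apply: (@integral_le_oneDsqr_fin _ _ (A + B)); first by rewrite addr_ge0// ltW.
- by move=> v _; exact: inv_gamma_fun_ge0.
move=> v v0; have v0' := ltW v0; pose u := v `^ (-1).
have u0 : 0 <= u by exact: powR_ge0.
have pE : v `^ (- (r + 1)) = u `^ (r + 1) by rewrite /u -powRrM mulN1r.
have pE2 : v `^ (- (r + 1)) * v ^+ 2 = u `^ (r - 1).
  rewrite -powR_mulrn// -powRD ?(gt_eqF v0) ?implybT// /u -powRrM.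
  by congr (_ `^ _); ring.
have -> : inv_gamma_fun r v * (1 + v ^+ 2) =
    u `^ (r - 1) * expR (- u) + u `^ (r + 1) * expR (- u).
  by rewrite -pE2 -pE /inv_gamma_fun -/u; ring.
by apply: lerD; [exact: HA|exact: HB].
Qed.

Lemma inv_gamma_gt0 r : 1 <= r -> 0 < inv_gamma r.
Proof.
move=> r1; rewrite -lte_fin -inv_gammaE//.
apply: (@integral_gt0_itv _ _ _ 1 2 (2 `^ (- (r + 1)) * expR (- 1))) => //.
- by apply/measurable_EFinP/measurable_funTS; exact: measurable_inv_gamma_fun.
- by move=> v _; rewrite lee_fin inv_gamma_fun_ge0.
- by rewrite ltr1n.
- by move=> v; rewrite /= !in_itv/= andbT => /andP[v1 _]; exact: lt_le_trans v1.
move=> v /andP[v1 v2]; have v0 : 0 < v by exact: lt_le_trans v1.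
rewrite lee_fin; apply: ler_pM; rewrite ?powR_ge0 ?expR_ge0//.
  rewrite !powRN lef_pV2 ?posrE ?powR_gt0//.
  by apply: ge0_ler_powR => //; rewrite ?nnegrE ?(ltW v0)//; lra.
by rewrite ler_expR lerN2 powR_inv1 ?(ltW v0)// invf_le1.
Qed.

Lemma integral_inv_gamma c r : 0 < c -> 1 <= r ->
  (\int[mu]_(v in `]0%R, +oo[) (v `^ (- (r + 1)) * expR (- (c * v `^ (-1))))%:E =
   (c `^ (- r) * inv_gamma r)%:E)%E.
Proof.
move=> c0 r1; pose f v := v `^ (- (r + 1)) * expR (- (c * v `^ (-1))).
have mf : measurable_fun (setT : set R) f.
  apply: measurable_funM; first exact: measurable_powR.
  apply: (measurableT_comp (@measurable_expR R)).
  apply: (measurableT_comp (@oppr_measurable R _)).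
  by apply: measurable_funM => //; exact: measurable_powR.
have f0 v : 0 <= f v by rewrite mulr_ge0 ?powR_ge0 ?expR_ge0.
rewrite [LHS]integral_mkcond.
pose F : R -> \bar R := ((fun v => (f v)%:E) \_ `]0, +oo[)%R.
have mF : measurable_fun (setT : set R) F.
  by apply/(measurable_restrictT _ _).1 => //; apply/measurable_EFinP/measurable_funTS.
have F0 v : (0 <= F v)%E by rewrite /F patchE; case: ifPn; rewrite ?lee_fin.
rewrite [LHS](ge0_integral_scale c0 mF F0) EFinM -inv_gammaE//.
transitivity (c%:E * ((c `^ (- (r + 1)))%:E *
    \int[mu]_(v in `]0%R, +oo[) (inv_gamma_fun r v)%:E))%E; last first.
  rewrite muleA -EFinM; congr (_%:E * _)%E.
  rewrite -[X in X * _](powRr1 (ltW c0)) -powRD ?(gt_eqF c0) ?implybT//.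
  by congr (_ `^ _); ring.
congr (_ * _)%E; rewrite -ge0_integralZl//; last 3 first.
- by apply/measurable_EFinP/measurable_funTS; exact: measurable_inv_gamma_fun.
- by move=> v _; rewrite lee_fin inv_gamma_fun_ge0.
- by rewrite lee_fin powR_ge0.
rewrite [RHS]integral_mkcond; apply: eq_integral => v _.
rewrite /F !patchE; have [v0|v0] := ltP 0 v; last first.
  by rewrite !memNset//= in_itv/= andbT; apply/negP; rewrite -leNgt// pmulr_rle0.
have cv0 : 0 < c * v by rewrite mulr_gt0.
rewrite (mem_set (_ : `]0, +oo[%classic v)); last by rewrite /= in_itv/= v0.
rewrite (mem_set (_ : `]0, +oo[%classic (c * v))); last by rewrite /= in_itv/= cv0.
rewrite -EFinM /f /inv_gamma_fun powRM ?(ltW c0) ?(ltW v0)// -mulrA.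
rewrite (powR_inv1 (ltW v0)) (powR_inv1 (ltW cv0)).
congr (_ * (_ * expR (- _)))%:E; field; rewrite !gt_eqF//.
Qed.

End inverse_gamma.

(** * The posterior as a mixture *)

Section product_sigma_finite.
Context d1 d2 (T1 : measurableType d1) (T2 : measurableType d2) (R : realType).
Variable m1 : {sigma_finite_measure set T1 -> \bar R}.
Variable m2 : {sigma_finite_measure set T2 -> \bar R}.

Let sigma_finite_mixin := lebesgue_integral_fubini.measure_function_Measure_isSigmaFinite__to__measure_function_isSigmaFinite m1 m2.
Let sfinite_mixin := lebesgue_integral_fubini.measure_function_Measure_isSigmaFinite__to__measure_function_isSFinite m1 m2.

(** The structure of sigma-finite measure on the product is what Tonelli's theorem asks
    for when the product is itself a factor. *)
Definition product_sigma_finite : {sigma_finite_measure set (T1 * T2)%type -> \bar R} :=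
  HB.pack (m1 \x m2)%E sfinite_mixin sigma_finite_mixin.

End product_sigma_finite.

Section posterior.
Context {R : realType}.
Local Notation mu := (@lebesgue_measure R).
Variables (p n : nat) (L : R -> R) (al : R) (x : p.-tuple R) (s : R).
Implicit Types (c l v t : R) (h k : (p.-tuple R * R) * R -> R).
Hypotheses (p3 : (3 <= p)%N) (n2 : (2 <= n)%N).
Hypothesis L_ge0 : forall y, 1 <= y -> 0 <= L y.
Hypothesis L_slow : slowly_varying L.
Hypothesis L_der : exists dL, derivative_on_ge1 L dL.
Hypothesis al_gtN1 : -1 < al.
Hypothesis s0 : 0 < s.

Local Notation K := (kern L al).
Local Notation q := (half_dim p n : R).
Local Notation w := (Wstat x s).
Local Notation LT := (lebesgue_tuple p : {sigma_finite_measure set (p.-tuple R) -> \bar R}).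
Local Notation X3 := ((p.-tuple R * R) * R)%type.

Definition sampling_const : R :=
  s `^ (n%:R / 2 - 1) / (2 `^ (n%:R / 2) * gamma_fun (n%:R / 2)).

(** What remains of the sampling density times the prior when the normal density in
    [theta] is split off, the mixing variable [l] of the prior being kept. *)
Definition mix_dens l v : R :=
  sampling_const * (\1_`]0, 1[%classic l * (l `^ al * ext1 L (l `^ (-1)))) *
  (\1_`]0, +oo[%classic v * (v `^ (- (q + 1)) *
     expR (- ((s + l * sqnorm x) / 2 * v `^ (-1))))).

Definition post_dens (z : X3) : R :=
  mix_dens z.2 z.1.2 *
  \prod_(i < p) gau ((1 - z.2) * tnth x i) (z.1.2 * (1 - z.2)) (tnth z.1.1 i).

(** Posterior integrals with [l] as an additional variable; integrands depending on [l]
    are needed to center [theta] at its conditional mean given [l]. *)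
Definition post_int (h : X3 -> R) : \bar R :=
  (\int[((LT \x mu) \x mu)]_z (h z * post_dens z)%:E)%E.

Lemma sampling_const_gt0 : 0 < sampling_const.
Proof.
rewrite divr_gt0 ?mulr_gt0 ?powR_gt0//; apply: gamma_fun_gt0.
by rewrite ler_pdivlMr// mul1r ler_nat.
Qed.

Lemma mix_dens_ge0 l v : 0 <= mix_dens l v.
Proof.
apply: mulr_ge0; last by rewrite !mulr_ge0 ?powR_ge0 ?expR_ge0.
rewrite mulr_ge0 ?(ltW sampling_const_gt0)// mulr_ge0// mulr_ge0 ?powR_ge0//.
exact: ext1_ge0.
Qed.

Lemma mix_densE l v : 0 < l < 1 -> 0 < v -> mix_dens l v =
  sampling_const * K l * (v `^ (- (q + 1)) * expR (- ((s + l * sqnorm x) / 2 * v `^ (-1)))).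
Proof.
move=> /andP[l0 l1] v0; rewrite /mix_dens !indicE.
rewrite mem_set; last by rewrite /= in_itv/= l0.
rewrite mem_set; last by rewrite /= in_itv/= v0.
by rewrite !mul1r /kern powR_inv1// ltW.
Qed.

Lemma mix_dens_eq0 l v : ~~ ((0 < l < 1) && (0 < v)) -> mix_dens l v = 0.
Proof.
rewrite negb_and /mix_dens !indicE => /orP[] h.
  by rewrite memNset ?mul0r ?mulr0 ?mul0r//= in_itv/=; exact/negP.
by rewrite [v \in _]memNset ?mul0r ?mulr0//= in_itv/= andbT; exact/negP.
Qed.

Lemma measurable_mix_dens d (T : measurableType d) (l v : T -> R) :
  measurable_fun setT l -> measurable_fun setT v ->
  measurable_fun setT (fun z => mix_dens (l z) (v z)).
Proof.
move=> ml mv; apply: measurable_funM.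
  apply: measurable_funM => //; apply: measurable_funM.
    by apply: (measurableT_comp (f := \1_`]0, 1[%classic : R -> R)) => //; exact: measurable_indic.
  apply: measurable_funM.
    by apply: (measurableT_comp (@measurable_powR _ al)).
  apply: (measurableT_comp (f := ext1 L)).
    by apply: continuous_measurable_fun; exact: continuous_ext1.
  by apply: (measurableT_comp (@measurable_powR _ (-1))).
apply: measurable_funM.
  by apply: (measurableT_comp (f := \1_`]0, +oo[%classic : R -> R)) => //; exact: measurable_indic.
apply: measurable_funM.
  by apply: (measurableT_comp (@measurable_powR _ (- (q + 1)))).
apply: (measurableT_comp (@measurable_expR R)).
apply: (measurableT_comp (@oppr_measurable R _)).
apply: measurable_funM.
  by apply: measurable_funM => //; apply: measurable_funD => //; exact: measurable_funM.
by apply: (measurableT_comp (@measurable_powR _ (-1))).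
Qed.

Lemma post_dens_ge0 z : 0 <= post_dens z.
Proof.
by rewrite mulr_ge0 ?mix_dens_ge0// prodr_ge0// => i _; exact: gau_ge0.
Qed.

Let m_l : measurable_fun (setT : set X3) snd. Proof. exact: measurable_snd. Qed.
Let m_v : measurable_fun (setT : set X3) (fun z => z.1.2).
Proof. by apply: (measurableT_comp measurable_snd); exact: measurable_fst. Qed.
Let m_t i : measurable_fun (setT : set X3) (fun z => tnth z.1.1 i).
Proof.
apply: (measurableT_comp (measurable_tnth i)).
by apply: (measurableT_comp measurable_fst); exact: measurable_fst.
Qed.

Lemma measurable_post_dens : measurable_fun setT post_dens.
Proof.
apply: measurable_funM; first exact: measurable_mix_dens.
apply: measurable_prod => i _; apply: measurable_fun_gau => //.
  by apply: measurable_funM => //; exact: measurable_funB.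
by apply: measurable_funM => //; exact: measurable_funB.
Qed.

Lemma post_intD h k : measurable_fun setT h -> measurable_fun setT k ->
  (forall z, 0 <= h z) -> (forall z, 0 <= k z) ->
  (post_int (h \+ k)%R = post_int h + post_int k)%E.
Proof.
move=> mh mk h0 k0; rewrite /post_int -ge0_integralD//.
- by apply: eq_integral => z _; rewrite /= mulrDl EFinD.
- by move=> z _; rewrite lee_fin mulr_ge0 ?post_dens_ge0.
- by apply/measurable_EFinP; apply: measurable_funM => //; exact: measurable_post_dens.
- by move=> z _; rewrite lee_fin mulr_ge0 ?post_dens_ge0.
- by apply/measurable_EFinP; apply: measurable_funM => //; exact: measurable_post_dens.
Qed.

Lemma post_int_le h k :
  (forall z, 0 <= h z) -> (forall z, h z <= k z) -> (post_int h <= post_int k)%E.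
Proof.
move=> h0 hk; apply: ge0_le_integralW => //.
- by move=> z _; rewrite lee_fin mulr_ge0 ?post_dens_ge0.
- by move=> z _; rewrite lee_fin ler_wpM2r ?post_dens_ge0.
Qed.

Lemma post_int_iterated h : measurable_fun setT h -> (forall z, 0 <= h z) ->
  (post_int h = \int[mu]_l \int[mu]_v \int[LT]_t (h ((t, v), l) * post_dens ((t, v), l))%:E)%E.
Proof.
move=> mh h0; pose F z := (h z * post_dens z)%:E.
have mF : measurable_fun setT F.
  by apply/measurable_EFinP; apply: measurable_funM => //; exact: measurable_post_dens.
have F0 z : (0 <= F z)%E by rewrite lee_fin mulr_ge0 ?post_dens_ge0.
rewrite /post_int [LHS](@fubini_tonelli2 _ _ _ _ _ (product_sigma_finite LT mu) mu F mF F0).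
rewrite /fubini_G.
apply: eq_integral => l _.
rewrite [LHS](@fubini_tonelli2 _ _ _ _ _ LT mu (fun y => F (y, l)) _ (fun y => F0 (y, l)))//.
exact: (measurableT_comp mF).
Qed.

(** The other coordinates of [theta] integrate to 1. *)
Lemma post_int_coord i (k : R -> R -> R -> R) :
  measurable_fun setT (fun y : (R * R) * R => k y.1.1 y.1.2 y.2) ->
  (forall l v t, 0 <= k l v t) ->
  (post_int (fun z => k z.2 z.1.2 (tnth z.1.1 i)) =
   \int[mu]_l \int[mu]_v ((mix_dens l v)%:E *
     \int[mu]_t (k l v t * gau ((1 - l) * tnth x i) (v * (1 - l)) t)%:E))%E.
Proof.
move=> mk k0; rewrite post_int_iterated; [|clear k0|by move=> z; exact: k0]; last first.
  pose f (z : X3) := ((z.2, z.1.2), tnth z.1.1 i).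
  rewrite (_ : (fun z : X3 => _) = (fun y : (R * R) * R => k y.1.1 y.1.2 y.2) \o f)//.
  apply: measurableT_comp => //; apply: measurable_fun_pair => //.
  exact: measurable_fun_pair.
apply: eq_integral => l _; apply: eq_integral => v _.
have [/andP[/andP[l0 l1] v0]|lv] := boolP ((0 < l < 1) && (0 < v)); last first.
  rewrite mix_dens_eq0// mul0e integral0_eq// => t _.
  by rewrite /post_dens mix_dens_eq0// mul0r mulr0.
have V0 : 0 < v * (1 - l) by rewrite mulr_gt0 ?subr_gt0.
pose g j t := (if j == i then k l v t else 1) * gau ((1 - l) * tnth x j) (v * (1 - l)) t.
have mkt : measurable_fun setT (k l v).
  rewrite (_ : k l v = (fun y : (R * R) * R => k y.1.1 y.1.2 y.2) \o (fun t => ((l, v), t)))//.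
  by apply: measurableT_comp => //; exact: measurable_pair1.
have mg j : measurable_fun setT (g j).
  by rewrite /g; have [_|_] := eqVneq j i; apply: measurable_funM => //; exact: measurable_gau.
have g0 j t : 0 <= g j t.
  by rewrite /g mulr_ge0 ?gau_ge0//; case: ifPn.
transitivity (\int[LT]_t ((mix_dens l v)%:E * (\prod_(j < p) g j (tnth t j))%:E))%E.
  apply: eq_integral => t _; rewrite -EFinM /post_dens/=; congr EFin.
  rewrite mulrCA; congr (_ * _).
  by rewrite /g [RHS]big_split/= -big_mkcond/= big_pred1_eq.
rewrite ge0_integralZl ?lee_fin ?mix_dens_ge0//; last 2 first.
- by apply/measurable_EFinP; exact: measurable_prod_tnth.
- by move=> t _; rewrite lee_fin prodr_ge0.
congr (_ * _)%E; rewrite integral_lebesgue_tuple_prod// (bigD1 i)//= big1 ?mule1.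
  by apply: eq_integral => t _; rewrite /g eqxx.
move=> j /negbTE ji; rewrite -[RHS](integral_gau ((1 - l) * tnth x j) V0).
by apply: eq_integral => t _; rewrite /g ji mul1r.
Qed.

End posterior.

Section posterior_density.
Context {R : realType}.
Local Notation mu := (@lebesgue_measure R).
Variables (p n : nat) (L : R -> R) (a : R) (x : p.-tuple R) (s : R).
Implicit Types (c l v t : R) (theta : p.-tuple R).
Hypotheses (n2 : (2 <= n)%N).
Hypothesis L_ge0 : forall y, 1 <= y -> 0 <= L y.
Hypothesis L_der : exists dL, derivative_on_ge1 L dL.
Hypothesis s0 : 0 < s.

Let al : R := p%:R / 2 + a.
Local Notation q := (half_dim p n : R).
Local Notation X2 := (p.-tuple R * R)%type.
Local Notation LT := (lebesgue_tuple p : {sigma_finite_measure set (p.-tuple R) -> \bar R}).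

Definition prior_kernel theta v l : R :=
  (l / (1 - l)) `^ (p%:R / 2) *
  expR (- (l / (1 - l)) * ((Num.sqrt (sqnorm theta) / Num.sqrt v) ^+ 2 / 2)) *
  l `^ a * L l^-1.

Lemma sampling_pdf_ge0 theta v : 0 < v -> 0 <= sampling_pdf n theta v x s.
Proof.
have g0 : 0 < gamma_fun (n%:R / 2) :> R.
  by apply: gamma_fun_gt0; rewrite ler_pdivlMr// mul1r ler_nat.
move=> v0; apply: mulr_ge0; first by rewrite prodr_ge0// => i _; exact: normal_pdf_ge0.
rewrite /chi2_pdf; apply: divr_ge0; last exact: ltW.
apply: divr_ge0; first by rewrite mulr_ge0 ?powR_ge0 ?expR_ge0.
by rewrite mulr_ge0 ?powR_ge0 ?(ltW g0).
Qed.

Lemma prior_ge0 theta v : 0 < v -> (0 <= prior a L theta v)%E.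
Proof.
move=> v0; rewrite /prior mule_ge0//.
  by rewrite lee_fin mulr_ge0 ?invr_ge0 ?exprn_ge0 ?sqrtr_ge0// ltW.
apply: integral_ge0 => l; rewrite /= in_itv/= => /andP[l0 l1].
rewrite lee_fin mulr_ge0 ?mulr_ge0 ?powR_ge0 ?expR_ge0//.
by apply: L_ge0; rewrite invf_ge1// ltW.
Qed.

Lemma mix_densM l v : 0 < l < 1 -> 0 < v ->
  chi2_pdf n (s / v) / v * (v^-1 * (Num.sqrt v ^+ p)^-1) *
  ((l / (1 - l)) `^ (p%:R / 2) * l `^ a * L l^-1) *
  (((1 - l) `^ 2^-1) ^+ p * expR (- (l * sqnorm x * 2^-1 / v))) = mix_dens n L al x s l v.
Proof.
move=> l01 v0; have /andP[l0 l1] := l01; have l1' : 0 < 1 - l by rewrite subr_gt0.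
rewrite mix_densE// kernE// /chi2_pdf /sampling_const.
have -> : Num.sqrt v ^+ p = v `^ (p%:R / 2).
  by rewrite -powR12_sqrt ?(ltW v0)// -powR_mulrn ?powR_ge0// -powRrM mulrC.
have -> : ((1 - l) `^ 2^-1) ^+ p = (1 - l) `^ (p%:R / 2).
  by rewrite -powR_mulrn ?powR_ge0// -powRrM mulrC.
have vi : v^-1 = v `^ (-1) by rewrite powR_inv1// ltW.
have -> : (s / v) `^ (n%:R / 2 - 1) = s `^ (n%:R / 2 - 1) * v `^ (- (n%:R / 2 - 1)).
  by rewrite vi powRM ?powR_ge0 ?(ltW s0)// -powRrM; congr (_ * _ `^ _); ring.
have -> : (l / (1 - l)) `^ (p%:R / 2) = l `^ (p%:R / 2) * (1 - l) `^ (- (p%:R / 2)).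
  rewrite -powR_inv1 ?(ltW l1')// powRM ?powR_ge0 ?(ltW l0)// -powRrM.
  by congr (_ * _ `^ _); ring.
have -> : l `^ al = l `^ (p%:R / 2) * l `^ a.
  by rewrite -powRD ?(gt_eqF l0) ?implybT.
have -> : (v `^ (p%:R / 2))^-1 = v `^ (- (p%:R / 2)) by rewrite powRN.
have e1 : expR (- ((s + l * sqnorm x) / 2 * v `^ (-1))) =
    expR (- (s / v) / 2) * expR (- (l * sqnorm x * 2^-1 / v)).
  by rewrite -expRD -vi; congr expR; ring.
have e2 : v `^ (- (q + 1)) =
    v `^ (- (n%:R / 2 - 1)) * v `^ (- (p%:R / 2)) * v `^ (-1) * v `^ (-1).
  by rewrite -!powRD ?(gt_eqF v0) ?implybT//; congr (_ `^ _); rewrite /half_dim; field.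
have e3 : (1 - l) `^ (- (p%:R / 2)) * (1 - l) `^ (p%:R / 2) = 1.
  by rewrite -powRD ?(gt_eqF l1') ?implybT// addNr powRr0.
rewrite e1 e2 -!vi.
set E1 := expR _; set E2 := expR _; set V1 := v `^ _; set V2 := v `^ _.
set S1 := s `^ _; set P1 := l `^ _; set P2 := l `^ _; set C := _ * gamma_fun _.
transitivity (((1 - l) `^ (- (p%:R / 2)) * (1 - l) `^ (p%:R / 2)) *
  (S1 / C * (P1 * P2 * L l^-1) * (V1 * V2 * v^-1 * v^-1 * (E1 * E2)))); first by ring.
by rewrite e3 mul1r.
Qed.

Lemma sampling_prior_kernel theta v l : 0 < l < 1 -> 0 < v ->
  sampling_pdf n theta v x s * (v^-1 * (Num.sqrt v ^+ p)^-1) * prior_kernel theta v l =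
  post_dens n L al x s ((theta, v), l).
Proof.
move=> l01 v0; have /andP[l0 l1] := l01.
rewrite /sampling_pdf /post_dens /= -mix_densM//.
have th0 : 0 <= sqnorm theta by apply: sumr_ge0 => i _; exact: sqr_ge0.
have prodE : \prod_(i < p) normal_pdf (tnth theta i) (Num.sqrt v) (tnth x i) *
    expR (- (l / (1 - l)) * ((Num.sqrt (sqnorm theta) / Num.sqrt v) ^+ 2 / 2)) =
  ((1 - l) `^ 2^-1) ^+ p * expR (- (l * sqnorm x * 2^-1 / v)) *
  \prod_(i < p) gau ((1 - l) * tnth x i) (v * (1 - l)) (tnth theta i).
  have -> : - (l / (1 - l)) * ((Num.sqrt (sqnorm theta) / Num.sqrt v) ^+ 2 / 2) =
      \sum_(i < p) (- (l / (1 - l)) * (tnth theta i ^+ 2 / v / 2)).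
    by rewrite -mulr_sumr -!mulr_suml exprMn exprVn !sqr_sqrtr// ltW.
  have -> : - (l * sqnorm x * 2^-1 / v) = \sum_(i < p) (- (l * tnth x i ^+ 2 * 2^-1 / v)).
    by rewrite sumrN -!mulr_suml -mulr_sumr.
  rewrite !expR_sum -[p in _ ^+ p]card_ord -prodr_const -!big_split/=.
  apply: eq_bigr => i _; rewrite -gauE// gau_complete_square//; ring.
rewrite /prior_kernel.
rewrite [LHS](_ : _ = (\prod_(i < p) normal_pdf (tnth theta i) (Num.sqrt v) (tnth x i) *
    expR (- (l / (1 - l)) * ((Num.sqrt (sqnorm theta) / Num.sqrt v) ^+ 2 / 2))) *
    (chi2_pdf n (s / v) / v * (v^-1 * (Num.sqrt v ^+ p)^-1) *
  ((l / (1 - l)) `^ (p%:R / 2) * l `^ a * L l^-1))); last by ring.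
by rewrite prodE; ring.
Qed.

Lemma measurable_prior_kernel theta v :
  measurable_fun (`]0, 1[%classic : set R) (prior_kernel theta v).
Proof.
have m1 : measurable_fun (setT : set R) (fun l => l * (1 - l) `^ (-1)).
  apply: measurable_funM => //.
  apply: (measurableT_comp (@measurable_powR _ (-1))); exact: measurable_funB.
apply: (eq_measurable_fun (fun l => (l * (1 - l) `^ (-1)) `^ (p%:R / 2) *
  expR (- (l * (1 - l) `^ (-1)) * ((Num.sqrt (sqnorm theta) / Num.sqrt v) ^+ 2 / 2)) *
  l `^ a * ext1 L (l `^ (-1)))).
  move=> l; rewrite inE/= in_itv/= => /andP[l0 l1].
  rewrite /prior_kernel !powR_inv1 ?subr_ge0 ?(ltW l0) ?(ltW l1)//.
  by rewrite ext1E// invf_ge1// ltW.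
apply: measurable_funTS; apply: measurable_funM.
  apply: measurable_funM; last exact: measurable_powR.
  apply: measurable_funM; first exact: (measurableT_comp (@measurable_powR _ _) m1).
  apply: (measurableT_comp (@measurable_expR R)).
  apply: measurable_funM => //; exact: (measurableT_comp (@oppr_measurable R _) m1).
apply: (measurableT_comp (f := ext1 L)); last exact: measurable_powR.
by apply: continuous_measurable_fun; exact: continuous_ext1.
Qed.

(** Only nonnegative [h] are covered: the interchange of integrals is Tonelli's. *)
Lemma posterior_integral_ge0E (h : p.-tuple R -> R -> R) :
  measurable_fun setT (fun z : X2 => h z.1 z.2) -> (forall theta v, 0 <= h theta v) ->
  posterior_integral n (prior a L) h x s = post_int n L al x s (fun z => h z.1.1 z.1.2).
Proof.
move=> mh h0; pose F (z : X2 * R) := (h z.1.1 z.1.2 * post_dens n L al x s z)%:E.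
have mF : measurable_fun setT F.
  apply/measurable_EFinP; apply: measurable_funM; last exact: measurable_post_dens.
  exact: (measurableT_comp mh measurable_fst).
have F0 z : (0 <= F z)%E by rewrite lee_fin mulr_ge0 ?post_dens_ge0.
rewrite /post_int [RHS](@fubini_tonelli1 _ _ _ _ _ (product_sigma_finite LT mu) mu F mF F0).
rewrite /posterior_integral integral_mkcond; apply: eq_integral => -[theta v] _.
rewrite patchE /fubini_F/=; case: ifPn => [|vn]; last first.
  rewrite integral0_eq// => l _; rewrite /F /post_dens /= mix_dens_eq0 ?mul0r ?mulr0//.
  by apply: contra vn => /andP[_ v0]; rewrite inE.
rewrite inE /upper_half_space/= => v0.
have c0 : 0 <= h theta v * sampling_pdf n theta v x s * (v^-1 * (Num.sqrt v ^+ p)^-1).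
  apply: mulr_ge0; last by rewrite mulr_ge0 ?invr_ge0 ?exprn_ge0 ?sqrtr_ge0 ?(ltW v0).
  by apply: mulr_ge0 => //; exact: sampling_pdf_ge0.
have k0 l : 0 < l < 1 -> 0 <= prior_kernel theta v l.
  move=> /andP[l0 l1]; rewrite /prior_kernel mulr_ge0 ?mulr_ge0 ?powR_ge0 ?expR_ge0//.
  by apply: L_ge0; rewrite invf_ge1// ltW.
rewrite /prior muleA -EFinM.
transitivity ((h theta v * sampling_pdf n theta v x s * (v^-1 * (Num.sqrt v ^+ p)^-1))%:E *
    \int[mu]_(l in `]0%R, 1%R[) (prior_kernel theta v l)%:E)%E; first by [].
rewrite -ge0_integralZl//; last by apply/measurable_EFinP; exact: measurable_prior_kernel.
rewrite [LHS]integral_mkcond; apply: eq_integral => l _; rewrite patchE.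
case: ifPn => [|ln]; last first.
  rewrite /F /post_dens /= mix_dens_eq0 ?mul0r ?mulr0//.
  by apply: contra ln => /andP[l01 _]; rewrite inE/= in_itv/=.
rewrite inE/= in_itv/= => l01; rewrite /F -EFinM; congr EFin => /=.
by rewrite -sampling_prior_kernel//; ring.
Qed.

End posterior_density.

(** * Posterior moments *)

Section posterior_moments.
Context {R : realType}.
Local Notation mu := (@lebesgue_measure R).
Variables (p n : nat) (L : R -> R) (al : R) (x : p.-tuple R) (s : R).
Implicit Types (c l v t : R) (u : R -> R).
Hypotheses (p3 : (3 <= p)%N) (n2 : (2 <= n)%N).
Hypothesis L_ge0 : forall y, 1 <= y -> 0 <= L y.
Hypothesis L_slow : slowly_varying L.
Hypothesis L_der : exists dL, derivative_on_ge1 L dL.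
Hypothesis al_gtN1 : -1 < al.
Hypothesis s0 : 0 < s.

Local Notation K := (kern L al).
Local Notation q := (half_dim p n : R).
Local Notation w := (Wstat x s).
Local Notation X3 := ((p.-tuple R * R) * R)%type.
Local Notation PI := (post_int n L al x s).
Local Notation A := (mix_dens n L al x s).

Let p_ge3 : 3 <= p%:R :> R. Proof. by rewrite (ler_nat R 3 p). Qed.
Let n_ge2 : 2 <= n%:R :> R. Proof. by rewrite (ler_nat R 2 n). Qed.
Let q_ge1 : 1 <= q.
Proof. by rewrite /half_dim; have := p_ge3; have := n_ge2; lra. Qed.
Let q_ge0 : 0 <= q. Proof. exact: le_trans ler01 q_ge1. Qed.
Let sqnorm_ge0 : 0 <= sqnorm x. Proof. by apply: sumr_ge0 => i _; exact: sqr_ge0. Qed.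
Let w_ge0 : 0 <= w. Proof. by rewrite divr_ge0// ltW. Qed.
Let i0 : 'I_p := Ordinal (leq_trans (isT : 0 < 3)%N p3).

Let mK := measurable_kern L_der al.
Let K0 := kern_ge0 L_ge0 al.
Let intK := kern_fin L_ge0 L_slow L_der al_gtN1.
Let intK_gt0 : (0 < \int[mu]_(l in `]0%R, 1%R[) (K l)%:E)%E :=
  kern_gt0 L_ge0 L_slow L_der al ltr01 (lexx 1).

(** The constant factor of the [v]-integral of the posterior times [v ^ -j]. *)
Definition moment_const (j : nat) : R :=
  sampling_const n s * ((s / 2) `^ (- (q + j%:R)) * inv_gamma (q + j%:R)).

Lemma moment_const_gt0 j : 0 < moment_const j.
Proof.
have c0 : 0 < sampling_const n s by exact: sampling_const_gt0.
have qj1 : 1 <= q + j%:R by rewrite (le_trans q_ge1)// lerDl.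
have g0 : 0 < inv_gamma (q + j%:R) by exact: inv_gamma_gt0.
by apply: mulr_gt0 => //; apply: mulr_gt0 => //; rewrite powR_gt0// divr_gt0.
Qed.

Lemma integral_mix_dens j l : 0 < l < 1 ->
  (\int[mu]_v (A l v * v `^ (- j%:R))%:E = (moment_const j * stj_fun K 0 (q + j%:R) w l)%:E)%E.
Proof.
move=> l01; have /andP[l0 l1] := l01; pose c := (s + l * sqnorm x) / 2.
have c0 : 0 < c by rewrite divr_gt0// ltr_pwDl// mulr_ge0// ltW.
have qj1 : 1 <= q + j%:R by rewrite (le_trans q_ge1)// lerDl.
have cE : c = (s / 2) * (1 + w * l).
  by rewrite /c /Wstat; field; rewrite gt_eqF.
have wl : 0 <= 1 + w * l by rewrite addr_ge0// mulr_ge0// ltW.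
have c0' : 0 < sampling_const n s by exact: sampling_const_gt0.
have Kl0 : 0 <= sampling_const n s * K l by rewrite mulr_ge0 ?(ltW c0')//; exact: K0.
transitivity (\int[mu]_(v in `]0%R, +oo[) ((sampling_const n s * K l)%:E *
    (v `^ (- (q + j%:R + 1)) * expR (- (c * v `^ (-1))))%:E))%E.
  rewrite [RHS]integral_mkcond; apply: eq_integral => v _; rewrite patchE.
  case: ifPn => [|vn].
    rewrite inE/= in_itv/= andbT => v0; rewrite -EFinM mix_densE//; congr EFin.
    have -> : v `^ (- (q + j%:R + 1)) = v `^ (- (q + 1)) * v `^ (- j%:R).
      by rewrite -powRD ?(gt_eqF v0) ?implybT//; congr (_ `^ _); ring.
    rewrite /c; ring.
  rewrite mix_dens_eq0 ?mul0r// l01/=; apply: contra vn => v0.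
  by rewrite inE/= in_itv/= v0.
rewrite ge0_integralZl//; last 2 first.
- apply/measurable_EFinP; apply: measurable_funTS; apply: measurable_funM.
    exact: measurable_powR.
  apply: (measurableT_comp (@measurable_expR R)).
  apply: (measurableT_comp (@oppr_measurable R _)).
  by apply: measurable_funM => //; exact: measurable_powR.
- by move=> v _; rewrite lee_fin mulr_ge0 ?powR_ge0 ?expR_ge0.
rewrite (integral_inv_gamma c0 qj1) -EFinM cE; congr EFin.
rewrite (powRM _ _ wl); last by rewrite divr_ge0// ltW.
by rewrite /moment_const /stj_fun expr0; ring.
Qed.

Lemma post_int_mix (j : nat) u : measurable_fun setT u -> (forall l, 0 <= u l) ->
  (PI (fun z => u z.2 * z.1.2 `^ (- j%:R))%R =
   (moment_const j)%:E * \int[mu]_(l in `]0%R, 1%R[) (u l * stj_fun K 0 (q + j%:R) w l)%:E)%E.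
Proof.
move=> mu_ u0.
rewrite (@post_int_coord _ p n L al x s n2 L_ge0 L_der s0 i0 (fun l v _ => u l * v `^ (- j%:R))); last 2 first.
- apply: measurable_funM.
    by apply: (measurableT_comp mu_); apply: (measurableT_comp measurable_fst); exact: measurable_fst.
  apply: (measurableT_comp (@measurable_powR _ (- j%:R))).
  by apply: (measurableT_comp measurable_snd); exact: measurable_fst.
- by move=> l v _; rewrite mulr_ge0 ?powR_ge0.
rewrite -ge0_integralZl//; last 3 first.
- apply/measurable_EFinP; apply: measurable_funM; first exact: measurable_funTS.
  exact: measurable_stj_fun.
- move=> l; rewrite /= in_itv/= => l01; rewrite lee_fin mulr_ge0// stj_fun_ge0//.
- by rewrite lee_fin ltW// moment_const_gt0.
rewrite [RHS]integral_mkcond; apply: eq_integral => l _; rewrite patchE.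
case: ifPn => [|ln]; last first.
  rewrite integral0_eq// => v _; rewrite mix_dens_eq0 ?mul0e//.
  apply: contra ln => /andP[l01 _]; rewrite inE/= in_itv/=//.
rewrite inE/= in_itv/= => l01; have /andP[l0 l1] := l01.
transitivity (\int[mu]_v ((u l)%:E * (A l v * v `^ (- j%:R))%:E))%E.
  apply: eq_integral => v _; have [v0|v0] := ltP 0 v; last first.
    by rewrite mix_dens_eq0 ?mul0e ?mul0r ?mule0// l01/= -leNgt.
  under eq_integral do rewrite EFinM.
  rewrite ge0_integralZl//; last 3 first.
  - by apply/measurable_EFinP; exact: measurable_gau.
  - by move=> t _; rewrite lee_fin gau_ge0.
  - by rewrite lee_fin mulr_ge0 ?powR_ge0.
  rewrite integral_gau ?mulr_gt0 ?subr_gt0// mule1 -!EFinM; congr EFin; ring.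
rewrite ge0_integralZl//; last 3 first.
- apply/measurable_EFinP; apply: measurable_funM; last exact: measurable_powR.
  exact: (measurable_mix_dens _ _ _ _ L_der).
- by move=> v _; rewrite lee_fin mulr_ge0 ?powR_ge0 ?mix_dens_ge0.
- by rewrite lee_fin.
by rewrite integral_mix_dens// -!EFinM; congr EFin; ring.
Qed.

Local Notation PC := moment_const.
Local Notation I0 := (stj K 0 (q + 1) w).
Local Notation I1 := (stj K 1 (q + 1) w).
Variable i : 'I_p.
Local Notation xi := (tnth x i).

Let m_l : measurable_fun (setT : set X3) snd. Proof. exact: measurable_snd. Qed.
Let m_v : measurable_fun (setT : set X3) (fun z => z.1.2).
Proof. by apply: (measurableT_comp measurable_snd); exact: measurable_fst. Qed.
Let m_t : measurable_fun (setT : set X3) (fun z => tnth z.1.1 i).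
Proof.
apply: (measurableT_comp (measurable_tnth i)).
by apply: (measurableT_comp measurable_fst); exact: measurable_fst.
Qed.

Let m_vV : measurable_fun (setT : set X3) (fun z => z.1.2 `^ (- 1%:R)).
Proof. exact: (measurableT_comp (@measurable_powR _ (- 1%:R)) m_v). Qed.

Let m_c : measurable_fun (setT : set X3) (fun z => (1 - z.2) * xi).
Proof. by apply: measurable_funM => //; exact: measurable_funB. Qed.

Let mk (f : X3 -> R) : measurable_fun setT f ->
  measurable_fun setT (fun z => Num.max 0 (f z) * z.1.2 `^ (- 1%:R)).
Proof. by move=> mf; apply: measurable_funM => //; exact: measurable_maxr. Qed.

Let pos0 (f : X3 -> R) z : 0 <= Num.max 0 (f z) * z.1.2 `^ (- 1%:R).
Proof. by rewrite mulr_ge0 ?powR_ge0// le_max lexx. Qed.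

Let max0_ge0 (y : R) : 0 <= Num.max 0 y. Proof. by rewrite le_max lexx. Qed.

Let coordE := @post_int_coord _ p n L al x s n2 L_ge0 L_der s0 i.

Let m3 : measurable_fun (setT : set ((R * R) * R)) (fun y => y.1.1).
Proof. by apply: (measurableT_comp measurable_fst); exact: measurable_fst. Qed.
Let m3v : measurable_fun (setT : set ((R * R) * R)) (fun y => y.1.2).
Proof. by apply: (measurableT_comp measurable_snd); exact: measurable_fst. Qed.
Let m3t : measurable_fun (setT : set ((R * R) * R)) snd.
Proof. exact: measurable_snd. Qed.

Let m3k (f : R * R * R -> R) : measurable_fun setT f ->
  measurable_fun setT (fun y => Num.max 0 (f y) * y.1.2 `^ (- 1%:R)).
Proof.
move=> mf; apply: measurable_funM; first exact: measurable_maxr.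
exact: (measurableT_comp (@measurable_powR _ (- 1%:R)) m3v).
Qed.

Let m3c : measurable_fun (setT : set ((R * R) * R)) (fun y => (1 - y.1.1) * xi).
Proof. by apply: measurable_funM => //; exact: measurable_funB. Qed.

Let scale (f : R -> R) c m V : 0 <= c -> measurable_fun setT f -> (forall t, 0 <= f t) ->
  (\int[mu]_t (f t * c * gau m V t)%:E = c%:E * \int[mu]_t (f t * gau m V t)%:E)%E.
Proof.
move=> c0 mf f0; rewrite -ge0_integralZl//.
- by apply: eq_integral => t _; rewrite -EFinM; congr EFin; ring.
- by apply/measurable_EFinP; apply: measurable_funM => //; exact: measurable_gau.
- by move=> t _; rewrite lee_fin mulr_ge0 ?gau_ge0.
Qed.

Let m_right m : measurable_fun setT (fun t : R => Num.max 0 (t - m)).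
Proof. by apply: measurable_maxr => //; exact: measurable_funB. Qed.
Let m_left m : measurable_fun setT (fun t : R => Num.max 0 (m - t)).
Proof. by apply: measurable_maxr => //; exact: measurable_funB. Qed.

(** Both sides of the mean of the normal density carry the same first moment. *)
Lemma post_int_center :
  PI (fun z => Num.max 0 (tnth z.1.1 i - (1 - z.2) * xi) * z.1.2 `^ (- 1%:R)) =
  PI (fun z => Num.max 0 ((1 - z.2) * xi - tnth z.1.1 i) * z.1.2 `^ (- 1%:R)).
Proof.
rewrite (coordE (k := fun l v t => Num.max 0 (t - (1 - l) * xi) * v `^ (- 1%:R))); last 2 first.
- by apply: m3k; exact: measurable_funB.
- by move=> l v t; rewrite mulr_ge0 ?powR_ge0.
rewrite (coordE (k := fun l v t => Num.max 0 ((1 - l) * xi - t) * v `^ (- 1%:R))); last 2 first.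
- by apply: m3k; exact: measurable_funB.
- by move=> l v t; rewrite mulr_ge0 ?powR_ge0.
apply: eq_integral => l _; apply: eq_integral => v _; congr (_ * _)%E.
by rewrite !scale ?powR_ge0// integral_gau_reflect.
Qed.

Let q1_ge0 : 0 <= q + 1. Proof. by rewrite addr_ge0. Qed.

Lemma post_int_cst j c : 0 <= c ->
  PI (fun z => c * z.1.2 `^ (- j%:R)) = (PC j * (c * stj K 0 (q + j%:R) w))%:E.
Proof.
move=> c0; have qj0 : 0 <= q + j%:R by rewrite addr_ge0.
rewrite (@post_int_mix j (fun=> c))//.
rewrite [RHS]EFinM; congr (_ * _)%E; rewrite EFinM -(integral_stj mK K0 intK)//.
rewrite -ge0_integralZl ?lee_fin//.
- by apply/measurable_EFinP; exact: measurable_stj_fun.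
- by move=> l; rewrite /= in_itv/= lee_fin => l01; exact: stj_fun_ge0.
Qed.

Let integral_stj_sub :
  (\int[mu]_(l in `]0%R, 1%R[) ((1 - l) * stj_fun K 0 (q + 1) w l)%:E = (I0 - I1)%:E)%E.
Proof.
have d0 l : 0 < l < 1 -> 0 <= (1 - l) * stj_fun K 0 (q + 1) w l.
  by move=> l01; have /andP[l0 l1] := l01; rewrite mulr_ge0 ?subr_ge0 ?(ltW l1) ?stj_fun_ge0.
set D := (LHS); have : (D + I1%:E = I0%:E)%E.
  rewrite /D -!(integral_stj mK K0 intK)// -ge0_integralD//.
  - apply: eq_integral => l _; rewrite -EFinD /stj_fun expr0 expr1; congr EFin; ring.
  - apply/measurable_EFinP; apply: measurable_funM; last exact: measurable_stj_fun.
    by apply: measurable_funTS; exact: measurable_funB.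
  - by move=> l; rewrite /= in_itv/= lee_fin => l01; exact: stj_fun_ge0.
  - by apply/measurable_EFinP; exact: measurable_stj_fun.
case: D => [r| |]//=; rewrite -EFinD => -[rE]; congr EFin; rewrite -rE; ring.
Qed.

Lemma post_int_shrunk c :
  PI (fun z => Num.max 0 ((1 - z.2) * c) * z.1.2 `^ (- 1%:R)) =
  (PC 1 * (Num.max 0 c * (I0 - I1)))%:E.
Proof.
have mu_ : measurable_fun setT (fun l : R => Num.max 0 ((1 - l) * c)).
  by apply: measurable_maxr => //; apply: measurable_funM => //; exact: measurable_funB.
rewrite (@post_int_mix 1 (fun l => Num.max 0 ((1 - l) * c)))//.
rewrite [RHS]EFinM; congr (_ * _)%E; rewrite EFinM -integral_stj_sub.
rewrite -ge0_integralZl ?lee_fin//.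
- apply: eq_integral => l; rewrite inE/= in_itv/= => /andP[l0 l1].
  have -> : Num.max 0 ((1 - l) * c) = (1 - l) * Num.max 0 c.
    by rewrite maxr_pMr ?mulr0// subr_ge0 ltW.
  by rewrite -EFinM; congr EFin; ring.
- apply/measurable_EFinP; apply: measurable_funM; last exact: measurable_stj_fun.
  by apply: measurable_funTS; exact: measurable_funB.
- move=> l; rewrite /= in_itv/= lee_fin => l01; have /andP[l0 l1] := l01.
  by rewrite mulr_ge0 ?subr_ge0 ?(ltW l1) ?stj_fun_ge0.
Qed.

(** The conditional first absolute moment given [l] and [v] is at most [2 (1 + v)],
    and [1] and [1 / v] have finite posterior integrals. *)
Lemma post_int_center_fin :
  (PI (fun z => Num.max 0 ((1 - z.2) * xi - tnth z.1.1 i) * z.1.2 `^ (- 1%:R))%R < +oo)%E.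
Proof.
pose g (j : nat) (z : X3) : R := 2 * z.1.2 `^ (- j%:R).
have mg j : measurable_fun setT (g j).
  by apply: measurable_funM => //; exact: (measurableT_comp (@measurable_powR _ (- j%:R)) m_v).
have g0 j z : 0 <= g j z by rewrite mulr_ge0 ?powR_ge0.
apply: (@le_lt_trans _ _ (PI (g 1 \+ g 0))); last first.
  rewrite (@post_intD _ p n L al x s n2 L_ge0 L_der s0)//.
  by rewrite (post_int_cst 1)// (post_int_cst 0)// -EFinD ltry.
rewrite (coordE (k := fun l v t => Num.max 0 ((1 - l) * xi - t) * v `^ (- 1%:R))); last 2 first.
- by apply: m3k; exact: measurable_funB.
- by move=> l v t; rewrite mulr_ge0 ?powR_ge0.
rewrite (coordE (k := fun l v t => 2 * v `^ (- 1%:R) + 2 * v `^ (- 0%:R))); last 2 first.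
- apply: measurable_funD; apply: measurable_funM => //.
    exact: (measurableT_comp (@measurable_powR _ (- 1%:R)) m3v).
  exact: (measurableT_comp (@measurable_powR _ (- 0%:R)) m3v).
- by move=> l v t; rewrite addr_ge0// mulr_ge0 ?powR_ge0.
have in0 l v (f : R -> R) : (forall t, 0 <= f t) ->
    (0 <= (A l v)%:E * \int[mu]_t (f t * gau ((1 - l) * xi) (v * (1 - l)) t)%:E)%E.
  move=> f0; rewrite mule_ge0 ?lee_fin ?mix_dens_ge0//.
  by apply: integral_ge0 => t _; rewrite lee_fin mulr_ge0 ?gau_ge0.
apply: ge0_le_integralW => [l _|l _].
  by apply: integral_ge0 => v _; apply: in0 => t; rewrite mulr_ge0 ?powR_ge0.
apply: ge0_le_integralW => [v _|v _].
  by apply: in0 => t; rewrite mulr_ge0 ?powR_ge0.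
have [/andP[/andP[l0 l1] v0]|lv] := boolP ((0 < l < 1) && (0 < v)); last first.
  by rewrite mix_dens_eq0// !mul0e.
have V0 : 0 < v * (1 - l) by rewrite mulr_gt0 ?subr_gt0.
rewrite lee_wpmul2l ?lee_fin ?mix_dens_ge0// scale ?powR_ge0//.
rewrite [X in (_ <= X)%E](_ : _ = (2 * v `^ (- 1%:R) + 2 * v `^ (- 0%:R))%:E); last first.
  under eq_integral do rewrite EFinM.
  rewrite ge0_integralZl//; last 3 first.
  - by apply/measurable_EFinP; exact: measurable_gau.
  - by move=> t _; rewrite lee_fin gau_ge0.
  - by rewrite lee_fin addr_ge0// mulr_ge0 ?powR_ge0.
  by rewrite integral_gau// mule1.
apply: (@le_trans _ _ ((v `^ (- 1%:R))%:E * (2 * (1 + v * (1 - l)))%:E)%E).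
  by rewrite lee_wpmul2l ?lee_fin ?powR_ge0// integral_gau_moment.
rewrite -EFinM lee_fin oppr0 powRr0 mulr1 powR_inv1 ?(ltW v0)//.
have -> : v^-1 * (2 * (1 + v * (1 - l))) = 2 * v^-1 + 2 * (1 - l).
  by field; rewrite gt_eqF.
by rewrite lerD2l; lra.
Qed.

Let max0_sub (y : R) : Num.max 0 y - Num.max 0 (- y) = y.
Proof.
have [y0|/ltW y0] := lerP 0 y.
  by rewrite max_l ?oppr_le0// subr0.
by rewrite max_r ?oppr_ge0// sub0r opprK.
Qed.

Let max0_le (y z : R) : Num.max 0 (y + z) <= Num.max 0 y + Num.max 0 z.
Proof.
have y0 := max0_ge0 y; have z0 := max0_ge0 z.
have yy : y <= Num.max 0 y by rewrite le_max lexx orbT.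
have zz : z <= Num.max 0 z by rewrite le_max lexx orbT.
by rewrite ge_max; apply/andP; split; lra.
Qed.

(** With [m = (1 - l) xi], the identity [theta = (theta - m) + m] is integrated in
    terms of positive and negative parts; the centered parts cancel. *)
Lemma post_int_tnth : exists b c : R, [/\
  PI (fun z => Num.max 0 (tnth z.1.1 i) * z.1.2 `^ (- 1%:R)) = b%:E,
  PI (fun z => Num.max 0 (- tnth z.1.1 i) * z.1.2 `^ (- 1%:R)) = c%:E &
  b - c = PC 1 * (xi * (I0 - I1))].
Proof.
pose T (f : X3 -> R) (z : X3) : R := Num.max 0 (f z) * z.1.2 `^ (- 1%:R).
pose th (z : X3) : R := tnth z.1.1 i; pose m (z : X3) : R := (1 - z.2) * xi.
pose m' (z : X3) : R := (1 - z.2) * - xi.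
have mT f : measurable_fun setT f -> measurable_fun setT (T f) by exact: mk.
have T0 f z : 0 <= T f z by exact: pos0.
have mth : measurable_fun setT th by exact: m_t.
have mm : measurable_fun setT m by exact: m_c.
have mm' : measurable_fun setT m' by apply: measurable_funM => //; exact: measurable_funB.
have mthN : measurable_fun setT (fun z => - th z) by exact: (measurableT_comp (@oppr_measurable R _)).
have mr : measurable_fun setT (fun z => th z - m z) by exact: measurable_funB.
have ml : measurable_fun setT (fun z => m z - th z) by exact: measurable_funB.
have D f g : measurable_fun setT f -> measurable_fun setT g ->
    PI (T f \+ T g) = (PI (T f) + PI (T g))%E.
  by move=> mf mg; apply: post_intD => //; exact: mT.
have PE f : measurable_fun setT f -> (0 <= PI (T f))%E.
  move=> mf; apply: integral_ge0 => z _; rewrite lee_fin mulr_ge0 ?post_dens_ge0//; exact: T0.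
have cE : PI (T (fun z => th z - m z)) = PI (T (fun z => m z - th z)) by exact: post_int_center.
have [M ME] : exists M : R, PI (T (fun z => m z - th z)) = M%:E.
  have := post_int_center_fin; have := PE _ ml; rewrite -/(T (fun z => m z - th z)).
  by case: (PI _) => // M _ _; exists M.
rewrite ME in cE.
have mE : PI (T m) = (PC 1 * (Num.max 0 xi * (I0 - I1)))%:E by exact: post_int_shrunk.
have m'E : PI (T m') = (PC 1 * (Num.max 0 (- xi) * (I0 - I1)))%:E by exact: post_int_shrunk.
have finT (f g h : X3 -> R) (k : R) : measurable_fun setT f -> measurable_fun setT g -> measurable_fun setT h ->
    (forall z, f z = g z + h z) -> (PI (T g) + PI (T h) = k%:E)%E -> exists b : R, PI (T f) = b%:E.
  move=> mf mg mh fgh kE; have := PE _ mf.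
  have : (PI (T f) <= k%:E)%E.
    rewrite -kE -D//; apply: post_int_le => //.
    by move=> z; rewrite /T/= -mulrDl ler_wpM2r ?powR_ge0// fgh; exact: max0_le.
  by case: (PI _) => // b _ _; exists b.
have [b bE] : exists b : R, PI (T th) = b%:E.
  apply: (finT _ (fun z => th z - m z) m) => //.
    by move=> z; rewrite subrK.
  by rewrite cE mE -EFinD; reflexivity.
have [c c'E] : exists c : R, PI (T (fun z => - th z)) = c%:E.
  apply: (finT _ (fun z => m z - th z) m') => //.
    by move=> z; rewrite /m /m' mulrN; ring.
  by rewrite ME m'E -EFinD; reflexivity.
exists b, c; split => //.
have : PI (T th \+ T (fun z => m z - th z) \+ T m') =
       PI (T (fun z => - th z) \+ T (fun z => th z - m z) \+ T m).
  congr post_int; apply/funext => z; rewrite /T/= -!mulrDl; congr (_ * _).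
  have h1 := max0_sub (th z); have h2 := max0_sub (th z - m z); have h3 := max0_sub (m z).
  have e2 : - (th z - m z) = m z - th z by ring.
  have e3 : m' z = - m z by rewrite /m /m'; ring.
  by rewrite e3; rewrite e2 in h2; lra.
have D3 f g h : measurable_fun setT f -> measurable_fun setT g -> measurable_fun setT h ->
    PI (T f \+ T g \+ T h) = (PI (T f) + PI (T g) + PI (T h))%E.
  move=> mf mg mh; rewrite -D//; apply: post_intD => //; first by apply: measurable_funD; exact: mT.
    exact: mT.
  by move=> z; rewrite addr_ge0.
rewrite !D3// bE c'E cE ME mE m'E -!EFinD => -[] e.
by rewrite -[X in X * (I0 - I1)](max0_sub xi); lra.
Qed.

End posterior_moments.

(** * The generalized Bayes estimator *)

Section generalized_bayes_estimator.
Context {R : realType}.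
Local Notation mu := (@lebesgue_measure R).
Variables (p n : nat) (L : R -> R) (a : R).
Implicit Types (s v : R) (x theta : p.-tuple R) (h : p.-tuple R -> R -> R).
Hypotheses (p3 : (3 <= p)%N) (n2 : (2 <= n)%N).
Hypothesis L_ge0 : forall y, 1 <= y -> 0 <= L y.
Hypothesis L_slow : slowly_varying L.
Hypothesis L_der : exists dL, derivative_on_ge1 L dL.
Hypothesis a_lb : 0 < p%:R / 2 + a + 1.

Let al : R := p%:R / 2 + a.
Local Notation K := (kern L al).
Local Notation q := (half_dim p n : R).
Local Notation X2 := (p.-tuple R * R)%type.
Local Notation LT := (lebesgue_tuple p : {sigma_finite_measure set (p.-tuple R) -> \bar R}).

Let al_gtN1 : -1 < al. Proof. by rewrite /al; move: a_lb; lra. Qed.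
Let mK := measurable_kern L_der al.
Let K0 := kern_ge0 L_ge0 al.
Let intK := kern_fin L_ge0 L_slow L_der al_gtN1.
Let intK_gt0 : (0 < \int[mu]_(l in `]0%R, 1%R[) (K l)%:E)%E :=
  kern_gt0 L_ge0 L_slow L_der al ltr01 (lexx 1).

Lemma eq_posterior_integral h1 h2 x s :
  (forall theta v, 0 < v -> h1 theta v = h2 theta v) ->
  posterior_integral n (prior a L) h1 x s = posterior_integral n (prior a L) h2 x s.
Proof.
move=> h12; apply: eq_integral => -[theta v]; rewrite inE /upper_half_space/= => v0.
by rewrite h12.
Qed.

(** The prior may take the value [+oo], so this is not linearity of the integral but the
    definition of the integral by positive and negative parts. *)
Lemma posterior_integral_posneg h x s :
  posterior_integral n (prior a L) h x s =
  (posterior_integral n (prior a L) (fun theta v => Num.max 0 (h theta v))%R x s -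
   posterior_integral n (prior a L) (fun theta v => Num.max 0 (- h theta v))%R x s)%E.
Proof.
have P0 theta v : 0 < v -> (0 <= prior a L theta v)%E by exact: prior_ge0.
have S0 theta v : 0 < v -> 0 <= sampling_pdf n theta v x s by exact: sampling_pdf_ge0.
rewrite /posterior_integral integralE; congr (_ - _)%E; apply: eq_integral => -[theta v];
  rewrite inE /upper_half_space/= => v0; rewrite ?funeposE ?funenegE/=;
  have {}P0 := P0 theta v v0; have {}S0 := S0 theta v v0.
  have [h0|/ltW h0] := lerP 0 (h theta v).
    by rewrite max_l// mule_ge0// lee_fin mulr_ge0.
  by rewrite max_r ?mul0r ?mul0e// mule_le0_ge0// lee_fin mulr_le0_ge0.
rewrite -muleN1 muleAC -EFinM mulrN1 -mulNr.
have [h0|/ltW h0] := lerP 0 (- h theta v).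
  by rewrite max_l// mule_ge0// lee_fin mulr_ge0.
by rewrite max_r ?mul0r ?mul0e// mule_le0_ge0// lee_fin mulr_le0_ge0.
Qed.

Let m_vV : measurable_fun (setT : set X2) (fun z => z.2 `^ (- 1%:R)).
Proof. by apply: (measurableT_comp (@measurable_powR _ (- 1%:R))); exact: measurable_snd. Qed.

Lemma generalized_bayesE x s : 0 < s ->
  generalized_bayes n (prior a L) x s = shrinkage (bayes_phi p n K) x s.
Proof.
move=> s0; have w0 : 0 <= Wstat x s.
  by rewrite divr_ge0 ?(ltW s0)// sumr_ge0// => i _; exact: sqr_ge0.
have q0 : 0 <= q by rewrite divr_ge0// addr_ge0.
have q10 : 0 <= q + 1 by rewrite addr_ge0.
have P1 : posterior_integral n (prior a L) (fun _ _ => 1) x s =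
    (moment_const p n s 0 * (1 * stj K 0 (q + 0%:R) (Wstat x s)))%:E.
  rewrite posterior_integral_ge0E// -post_int_cst//.
  by congr post_int; apply/funext => z; rewrite oppr0 powRr0 mulr1.
have Pv : posterior_integral n (prior a L) (fun _ v => v^-1) x s =
    (moment_const p n s 1 * (1 * stj K 0 (q + 1) (Wstat x s)))%:E.
  rewrite -post_int_cst// (@eq_posterior_integral _ (fun _ v => v `^ (- 1%:R))); last first.
    by move=> _ v v0; rewrite powR_inv1// ltW.
  rewrite posterior_integral_ge0E//; last by move=> _ v; exact: powR_ge0.
  by congr post_int; apply/funext => z; rewrite mul1r.
apply: eq_from_tnth => i; rewrite !tnth_mktuple /posterior_expectation.
have Pt : posterior_integral n (prior a L) (fun theta v => tnth theta i / v) x s =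
    (moment_const p n s 1 * (tnth x i *
      (stj K 0 (q + 1) (Wstat x s) - stj K 1 (q + 1) (Wstat x s))))%:E.
  have [b [c [bE cE <-]]] := post_int_tnth x p3 n2 L_ge0 L_slow L_der al_gtN1 s0 i.
  have m_t : measurable_fun (setT : set X2) (fun z => tnth z.1 i).
    by apply: (measurableT_comp (measurable_tnth i)); exact: measurable_fst.
  rewrite posterior_integral_posneg EFinB -bE -cE; congr (_ - _)%E.
    rewrite (@eq_posterior_integral _ (fun theta v => Num.max 0 (tnth theta i) * v `^ (- 1%:R))).
      rewrite posterior_integral_ge0E//.
        by apply: measurable_funM => //; exact: measurable_maxr.
      by move=> theta v; rewrite mulr_ge0 ?powR_ge0// le_max lexx.
    move=> theta v v0; rewrite powR_inv1 ?(ltW v0)// [RHS]mulrC.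
    by rewrite maxr_pMr ?invr_ge0 ?(ltW v0)// mulr0 mulrC.
  rewrite (@eq_posterior_integral _ (fun theta v => Num.max 0 (- tnth theta i) * v `^ (- 1%:R))).
    rewrite posterior_integral_ge0E//.
      apply: measurable_funM => //; apply: measurable_maxr => //.
      exact: (measurableT_comp (@oppr_measurable R _)).
    by move=> theta v; rewrite mulr_ge0 ?powR_ge0// le_max lexx.
  move=> theta v v0; rewrite powR_inv1 ?(ltW v0)// [RHS]mulrC.
  by rewrite maxr_pMr ?invr_ge0 ?(ltW v0)// mulr0 -mulNr mulrC.
rewrite P1 Pv Pt/= !mul1r addr0.
have I00 : 0 < stj K 0 (q + 1) (Wstat x s) by exact: stj0_gt0.
have I00' : 0 < stj K 0 q (Wstat x s) by exact: stj0_gt0.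
have c0 := moment_const_gt0 p3 n2 s0 0; have c1 := moment_const_gt0 p3 n2 s0 1.
have [W0|W0] := eqVneq (Wstat x s) 0.
  have -> : tnth x i = 0.
    have S0 : sqnorm x = 0.
      by move: W0 => /eqP; rewrite mulf_eq0 invr_eq0 (gt_eqF s0) orbF => /eqP.
    move/eqP: S0; rewrite psumr_eq0 => [/allP/(_ i)|j _]; last exact: sqr_ge0.
    by rewrite mem_index_enum => /(_ isT)/implyP/(_ isT); rewrite sqrf_eq0 => /eqP.
  by rewrite !(mul0r, mulr0).
rewrite /bayes_phi.
move: (lt0r_neq0 I00) (lt0r_neq0 I00') (lt0r_neq0 c0) (lt0r_neq0 c1) W0.
move: (stj K 0 (q + 1) (Wstat x s)) (stj K 1 (q + 1) (Wstat x s)) (stj K 0 q (Wstat x s)).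
move: (moment_const p n s 0) (moment_const p n s 1) => k0 k1 J0 J1 m.
move: (tnth x i) (Wstat x s) => y W J0n mn k0n k1n Wn.
by field; rewrite J0n mn k0n k1n Wn.
Qed.

End generalized_bayes_estimator.

Theorem theorem3p3 (R : realType) (p n : nat) (hp : (3 <= p)%N) (hn : (3 <= n)%N)
    (a : R) (ha : 0 < p%:R / 2 + a + 1)
    (L : R -> R) (hL : forall y, 1 <= y -> 0 <= L y)
    (hL1 : slowly_varying L)
    (hL2 : ultimately_monotone L)
    (hL3 : exists2 dL : R -> R, derivative_on_ge1 L dL & ultimately_monotone dL) :
  (-2 < a -> quasi_admissible n (generalized_bayes n (prior (p := p) a L)))
  /\
  (a = -2 ->
   (exists2 b : R, b < 1 &
      {in `]1, +oo[ &, nondecreasing_fun (fun y => ln y `^ b / L y)}) ->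
   quasi_admissible n (generalized_bayes n (prior (p := p) a L))).
Proof.
have n2 : (2 <= n)%N by exact: ltnW.
have L_der : exists dL, derivative_on_ge1 L dL by have [dL ? _] := hL3; exists dL.
have al1 : -1 < p%:R / 2 + a by lra.
have mK := measurable_kern L_der (p%:R / 2 + a).
have K0 := kern_ge0 hL (p%:R / 2 + a).
have intK := kern_fin hL hL1 L_der al1.
have intK_gt0 := kern_gt0 hL hL1 L_der (p%:R / 2 + a) ltr01 (lexx 1).
have bayesE (x : p.-tuple R) s : 0 < s -> generalized_bayes n (prior a L) x s =
    shrinkage (bayes_phi p n (kern L (p%:R / 2 + a))) x s.
  exact: generalized_bayesE.
split => [a2|a2 [b b1 mono]].
  exists (bayes_phi p n (kern L (p%:R / 2 + a))) => //.
  apply: stieltjes_quasi_admissible => //; left.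
  exact: int_factor_vanishes.
exists (bayes_phi p n (kern L (p%:R / 2 + a))) => //.
apply: stieltjes_quasi_admissible => //; right; rewrite a2.
have [C C0 HC] := slowly_varying_le_ln hL hL1 L_der b1 mono.
have [M1 M10 HM1] := int_factor_le_ln hp n2 hL hL1 L_der C0 HC.
have [M2 M20 HM2] := bayes_phi_bounded hp n2 hL hL1 L_der.
exists (M1 + M2); first exact: addr_gt0.
move=> w w1; split; first by rewrite (le_trans (HM2 _ (lt_le_trans ltr01 w1)))// lerDr ltW.
apply: (le_trans (HM1 _ w1)); rewrite ler_wpM2r ?addr_ge0 ?ln_ge0//.
by rewrite lerDl ltW.
Qed.
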